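(* There are universal constants $C,c>0$ such that the following holds. Let $\lambda\ge0$, let $v\in\mathbb{R}^p$ with $\|v\|=1$, let $\Sigma=\lambda\,vv^*+\mathbf{1}_p$, let $X_1,\dots,X_n$ be i.i.d. Gaussian random vectors in $\mathbb{R}^p$ with distribution $N(0,\Sigma)$, and let $\hat\Sigma:=\frac1n\sum_{i=1}^nX_iX_i^*$. Let $\delta=\frac pn$ and $d=\max\{n,p\}\ge 2$, and assume $n\ge(\log d)^3$. Then $$\mathbf{P}\big[\big|\|\hat\Sigma\|-\mathrm{S}(\lambda,\delta)\big|>C(1+\lambda+\delta)\,n^{-\frac14}(\log d)^{\frac34}\big]\le e^{-cn^{\frac12}},$$ $$\mathbf{P}\big[\big|\lambda_{\rm max}(\hat\Sigma-\Sigma)-\mathrm{H}_+(\lambda,\delta)\big|>C(1+\lambda+\delta)\,n^{-\frac14}(\log d)^{\frac34}\big]\le e^{-cn^{\frac12}},$$ $$\mathbf{P}\big[\big|\lambda_{\rm min}(\hat\Sigma-\Sigma)-\mathrm{H}_-(\lambda,\delta)\big|>C(1+\lambda+\delta)\,n^{-\frac14}(\log d)^{\frac34}\big]\le e^{-cn^{\frac12}}.$$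
   Context: The functions are defined as follows. $\mathrm{S}(\lambda,\delta)=(1+\sqrt\delta)^2$ for $\lambda\le\sqrt\delta$, and $\mathrm{S}(\lambda,\delta)=(1+\lambda)(1+\frac\delta\lambda)$ for $\lambda>\sqrt\delta$. $\mathrm{H}_+(\lambda,\delta)=\delta+2\sqrt\delta$ for $\lambda\le1+\sqrt\delta$, and $\mathrm{H}_+(\lambda,\delta)=\frac{1+\lambda}{2\lambda}(\sqrt\delta+\sqrt{\delta+4\lambda})\sqrt\delta$ for $\lambda>1+\sqrt\delta$. $\mathrm{H}_-(\lambda,\delta)=\delta-2\sqrt\delta$ for $\lambda\le1-\sqrt\delta$, and $\mathrm{H}_-(\lambda,\delta)=\frac{1+\lambda}{2\lambda}(\sqrt\delta-\sqrt{\delta+4\lambda})\sqrt\delta$ for $\lambda>1-\sqrt\delta$ (when $\lambda=0$ and $\delta>1$, the last expression is understood as its limit $-1$ as $\lambda\downarrow0$). $\lambda_{\rm max},\lambda_{\rm min}$ denote the largest and smallest eigenvalues and $\|\cdot\|$ the operator norm. *)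

(* Defs.v *)
From mathcomp Require Import all_boot all_order all_algebra.
From mathcomp Require Import all_classical all_reals all_analysis.

Set Implicit Arguments.
Unset Strict Implicit.
Unset Printing Implicit Defensive.

Import Order.TTheory GRing.Theory Num.Theory.

Local Open Scope classical_set_scope.
Local Open Scope ring_scope.

(* The norm that MathComp-Analysis puts on matrices is the maximum norm, hence
   the explicit Euclidean norm. *)
Definition enorm (R : realType) (p : nat) (x : 'cV[R]_p) : R :=
  Num.sqrt (\sum_(i < p) x i 0 ^+ 2).

Definition opnorm (R : realType) (m p : nat) (A : 'M[R]_(m, p)) : R :=
  sup [set enorm (A *m x) | x in [set x : 'cV[R]_p | enorm x <= 1]].

(* Meant for symmetric matrices of positive size: their set of eigenvalues is
   finite and nonempty, so that the supremum and the infimum are attained. *)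
Definition lambda_max (R : realType) (p : nat) (A : 'M[R]_p) : R :=
  sup [set a : R | eigenvalue A a].

Definition lambda_min (R : realType) (p : nat) (A : 'M[R]_p) : R :=
  inf [set a : R | eigenvalue A a].

(* The law N(m, s ^ 2) on the line. The library's normal_prob m 0 is the
   uniform law on [0, 1], not the point mass at m. *)
Definition normal_law (R : realType) (m s : R) : set R -> \bar R :=
  if s == 0 then \d_m else normal_prob m s.

(* X is a random vector with law N(m, Sigma): every linear functional u^T X has
   law N(u^T m, u^T Sigma u). *)
Definition gaussian_vector (disp : measure_display) (T : measurableType disp)
    (R : realType) (P : probability T R) (p : nat) (X : T -> 'cV[R]_p)
    (m : 'cV[R]_p) (Sigma : 'M[R]_p) : Prop :=
  (forall j : 'I_p, measurable_fun setT (fun w : T => X w j 0)) /\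
  (forall (u : 'cV[R]_p) (B : set R), measurable B ->
    P [set w | B ((u^T *m X w) 0 0)] =
    normal_law ((u^T *m m) 0 0) (Num.sqrt ((u^T *m Sigma *m u) 0 0)) B).

(* Mutual independence of the sigma-algebras generated by the vectors X i; the
   sigma-algebra of a vector is the one generated by its coordinates. *)
Definition independent_vectors (disp : measure_display)
    (T : measurableType disp) (R : realType) (P : probability T R)
    (I : finType) (p : nat) (X : I -> T -> 'cV[R]_p) : Prop :=
  forall (J : {set I}) (A : I -> set T),
    (forall i, i \in J ->
      g_sigma_preimage (fun (j : 'I_p) (w : T) => X i w j 0) (A i)) ->
    P (\bigcap_(i in [set` J]) A i) = (\prod_(i in J) P (A i))%E.

Definition spiked_cov (R : realType) (p : nat) (lam : R) (v : 'cV[R]_p) :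
    'M[R]_p :=
  lam *: (v *m v^T) + 1%:M.

Definition sample_cov (R : realType) (n p : nat) (x : 'I_n -> 'cV[R]_p) :
    'M[R]_p :=
  n%:R^-1 *: \sum_(i < n) x i *m (x i)^T.

Definition Sfun (R : realType) (lam delta : R) : R :=
  if lam <= Num.sqrt delta then (1 + Num.sqrt delta) ^+ 2
  else (1 + lam) * (1 + delta / lam).

Definition Hplus (R : realType) (lam delta : R) : R :=
  if lam <= 1 + Num.sqrt delta then delta + 2 * Num.sqrt delta
  else (1 + lam) / (2 * lam)
       * (Num.sqrt delta + Num.sqrt (delta + 4 * lam)) * Num.sqrt delta.

(* For lam >= 0 the case lam = 0 is reached only when delta > 1; the value -1 is
   then the limit of the last expression as lam decreases to 0. *)
Definition Hminus (R : realType) (lam delta : R) : R :=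
  if lam <= 1 - Num.sqrt delta then delta - 2 * Num.sqrt delta
  else if lam == 0 then -1
  else (1 + lam) / (2 * lam)
       * (Num.sqrt delta - Num.sqrt (delta + 4 * lam)) * Num.sqrt delta.

Definition error_bound (R : realType) (C lam delta : R) (n d : nat) : R :=
  C * (1 + lam + delta) * (n%:R `^ (- (1 / 4))) * (ln d%:R `^ (3 / 4)).

(* Main.v *)
(* Let [h] be the Householder reflection that exchanges [v] and the first basis
   vector [e]. The matrix with columns [X_i] is [h D G] with [D = diag (sqrt (1 +
   lam), 1, 1, ...)] and [G] standard Gaussian. Alternating Householder reflections
   on rows and columns, all row reflections fixing [e] and hence commuting with
   [D], turn [G] into a lower bidiagonal matrix; by rotation invariance each new
   entry is the norm of a fresh Gaussian vector, so that by the chi-square tail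
   and a union bound all entries are, after division by [sqrt n], close to
   [sqrt (1 - j / n)] and [sqrt (delta - (j + 1) / n)], outside an event of
   probability at most [2 (n + p) exp (- t^2 / 2)]. What remains is a quadratic
   form given by a deterministic tridiagonal matrix. AM-GM with the decay rate
   [rho] of the extremal eigenvector as weight bounds the form from above, and a
   geometric sequence (respectively a plateau when [rho = 1]) supported on the
   first [n^(1/2)] coordinates shows that the bound is nearly attained. *)

Require Import Defs.
From mathcomp Require Import all_boot all_order all_algebra.
From mathcomp Require Import all_classical all_reals all_analysis.
From mathcomp Require Import measurable_realfun gauss_integral.
From mathcomp Require Import ring lra.

Set Implicit Arguments.
Unset Strict Implicit.
Unset Printing Implicit Defensive.

Import Order.TTheory GRing.Theory Num.Theory.
Import numFieldNormedType.Exports.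

Local Open Scope classical_set_scope.
Local Open Scope ring_scope.

(** * Laws determined by linear functionals *)

(** Gaussian vectors are known only through the laws of their linear functionals, so joint laws are
    recovered by a Cramér-Wold argument built on cosines and bounded limits. Independence of one row
    from the others is expressed by drawing the two blocks on a product space: the reflection
    computed from the row is then constant on each section, and Tonelli replaces conditional laws.
    The three estimates are treated as one: [kappa] times the population form is subtracted, with
    [kappa] equal to 0 for the norm and 1 for the difference, and a sign [sg] selects the upper or
    the lower edge. The lower bound at the lower edge is the delicate one. Elsewhere the entries may
    be replaced by their limits; there this goes in the wrong direction on the diagonal, and the
    exact decay along both diagonals has to enter. A probability [exp (- n^(1/2))] asks for [t] of
    order [n^(1/4)], that is, entries fluctuating by [n^(-1/4)] after normalisation. The
    deterministic error matches: [sqrt (delta - j / n)] with [j] of order [n^(1/2)] may fall below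
    [sqrt delta] by order [n^(-1/4)] when [delta] is small. *)

Section same_law.
Context (R : realType) d1 (T1 : measurableType d1) (P1 : probability T1 R)
  d2 (T2 : measurableType d2) (P2 : probability T2 R)
  (S : Type) (X1 : T1 -> S) (X2 : T2 -> S).
Implicit Types (F G f g : S -> R).

(** [S] carries no sigma-algebra of its own, so measurability is asked of the two pullbacks. *)
Definition bounded_meas F := [/\ measurable_fun setT (F \o X1),
  measurable_fun setT (F \o X2) & exists M, forall s, `|F s| <= M].

Lemma bounded_meas_integrable F : bounded_meas F ->
  P1.-integrable setT (EFin \o (F \o X1)) /\
  P2.-integrable setT (EFin \o (F \o X2)).
Proof.
have H d (T : measurableType d) (P : probability T R) (h : T -> R) :
    measurable_fun setT h -> (exists M, forall w, `|h w| <= M) ->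
    P.-integrable setT (EFin \o h).
  move=> mh [M hM]; apply: measurable_bounded_integrable => //.
    exact: fin_num_fun_lty.
  exists M; split; first exact: num_real.
  by move=> x Mx w _ /=; apply: (le_trans (hM _)); apply: ltW.
by case=> m1 m2 [M FM]; split; apply: H => //; exists M => w; exact: FM.
Qed.

Lemma bounded_meas_cst c : bounded_meas (fun=> c).
Proof. by split; [exact: measurable_cst..|exists `|c|]. Qed.

Lemma bounded_measD F G : bounded_meas F -> bounded_meas G ->
  bounded_meas (fun s => F s + G s).
Proof.
move=> [m1 m2 [M FM]] [n1 n2 [N GN]]; split.
- exact: measurable_funD m1 n1.
- exact: measurable_funD m2 n2.
- by exists (M + N) => s; rewrite (le_trans (ler_normD _ _))// lerD.
Qed.

Lemma bounded_measM F G : bounded_meas F -> bounded_meas G ->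
  bounded_meas (fun s => F s * G s).
Proof.
move=> [m1 m2 [M FM]] [n1 n2 [N GN]]; split.
- exact: measurable_funM m1 n1.
- exact: measurable_funM m2 n2.
- by exists (M * N) => s; rewrite normrM ler_pM.
Qed.

Lemma bounded_meas_lim (F_ : nat -> S -> R) F M :
  (forall n, bounded_meas (F_ n)) -> (forall n s, `|F_ n s| <= M) ->
  (forall s, F_ ^~ s @ \oo --> F s) -> bounded_meas F.
Proof.
move=> bF FM cF; split.
- apply: (@measurable_fun_cvg _ _ _ _ (fun n => F_ n \o X1)).
    by move=> n; case: (bF n).
  by move=> x _; exact: cF.
- apply: (@measurable_fun_cvg _ _ _ _ (fun n => F_ n \o X2)).
    by move=> n; case: (bF n).
  by move=> x _; exact: cF.
- exists M => s; have cn : `|F_ n s| @[n --> \oo] --> `|F s| by apply: cvg_norm; exact: cF.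
  rewrite -(cvg_lim _ cn)//; apply: limr_le; first by apply/cvg_ex; exists `|F s|.
  by near=> n.
Unshelve. all: end_near. Qed.

Definition same_mean F :=
  (\int[P1]_w (F (X1 w))%:E = \int[P2]_w (F (X2 w))%:E)%E.

Lemma same_meanD F G : bounded_meas F -> bounded_meas G ->
  same_mean F -> same_mean G -> same_mean (fun s => F s + G s).
Proof.
move=> /bounded_meas_integrable[iF1 iF2] /bounded_meas_integrable[iG1 iG2].
rewrite /same_mean => eF eG.
under eq_integral do rewrite EFinD.
under [RHS]eq_integral do rewrite EFinD.
by rewrite (integralD _ iF1 iG1)// (integralD _ iF2 iG2)//= eF eG.
Qed.

Lemma same_meanZ c F : bounded_meas F -> same_mean F ->
  same_mean (fun s => c * F s).
Proof.
move=> /bounded_meas_integrable[iF1 iF2]; rewrite /same_mean => eF.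
under eq_integral do rewrite EFinM.
under [RHS]eq_integral do rewrite EFinM.
by rewrite (integralZl _ iF1)// (integralZl _ iF2)//= eF.
Qed.

Lemma same_mean_lim (F_ : nat -> S -> R) F M :
  (forall n, bounded_meas (F_ n)) -> (forall n s, `|F_ n s| <= M) ->
  (forall s, F_ ^~ s @ \oo --> F s) -> (forall n, same_mean (F_ n)) ->
  same_mean F.
Proof.
move=> bF FM cF sF.
have [mF1 mF2 _] := bounded_meas_lim bF FM cF.
have H d (T : measurableType d) (P : probability T R) (X : T -> S) :
    (forall n, measurable_fun setT (F_ n \o X)) ->
    measurable_fun setT (F \o X) ->
    ((\int[P]_w (F_ n (X w))%:E)%E @[n --> \oo] -->
      \int[P]_w (F (X w))%:E)%E.
  move=> mn mF.
  have [//|||||_ _] := @dominated_convergence _ _ _ P setT measurableT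
      (fun n w => (F_ n (X w))%:E) (fun w => (F (X w))%:E) (cst M%:E).
  - by move=> n; apply/measurable_EFinP; exact: mn.
  - exact/measurable_EFinP.
  - by apply: aeW => w _; apply: cvg_EFin; [exact: nearW|exact: cF].
  - apply: (@measurable_bounded_integrable _ _ _ P (cst M)) => //.
      exact: fin_num_fun_lty.
    exists `|M|; split; first exact: num_real.
    by move=> x Mx w _ /=; exact: ltW.
  - by apply: aeW => w n _; rewrite /= lee_fin; exact: FM.
  by [].
have c1 := H _ _ P1 X1 (fun n => let: And3 m _ _ := bF n in m) mF1.
have c2 := H _ _ P2 X2 (fun n => let: And3 _ m _ := bF n in m) mF2.
rewrite /same_mean -(cvg_lim _ c1)// -(cvg_lim _ c2)//.
by congr (limn _); apply/funext => n; exact: sF.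
Qed.

End same_law.

Lemma expr_cvg0 (R : realType) (z : R) : `|z| < 1 ->
  (fun n => z ^+ n) @ \oo --> (0 : R).
Proof.
move=> /(cvg_geometric 1); have -> // : geometric 1 z = (fun n => z ^+ n).
by apply/funext => n; rewrite /geometric/= mul1r.
Qed.

Section cramer_wold.
Context (R : realType) d1 (T1 : measurableType d1) (P1 : probability T1 R)
  d2 (T2 : measurableType d2) (P2 : probability T2 R)
  (S : Type) (X1 : T1 -> S) (X2 : T2 -> S) (L : set (S -> R)).
Hypothesis LD : forall l m, L l -> L m -> L (fun s => l s + m s).
Hypothesis LZ : forall c l, L l -> L (fun s => c * l s).
Hypothesis L0 : L (fun=> 0).
Hypothesis mL1 : forall l, L l -> measurable_fun setT (l \o X1).
Hypothesis mL2 : forall l, L l -> measurable_fun setT (l \o X2).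
Hypothesis lawL : forall l (B : set R), L l -> measurable B ->
  P1 (X1 @^-1` (l @^-1` B)) = P2 (X2 @^-1` (l @^-1` B)).
Implicit Types (F G f g : S -> R).
Local Notation bm := (bounded_meas X1 X2).
Local Notation sm := (same_mean P1 P2 X1 X2).

Let bm_cos l b : L l -> bm (fun s => cos (l s + b)).
Proof.
move=> Ll; have mc : measurable_fun setT (fun x : R => cos (x + b)).
  apply: continuous_measurable_fun => x; apply: continuous_comp.
    by apply: (@cvgD _ R^o) => //; exact: cvg_cst.
  exact: continuous_cos.
split.
- exact: (measurableT_comp mc (mL1 Ll)).
- exact: (measurableT_comp mc (mL2 Ll)).
- by exists 1 => s; rewrite ler_norml cos_geN1 cos_le1.
Qed.

(** The equality of the one-dimensional laws is used directly only here; joint information comes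
    afterwards from the algebra of cosines. *)
Let sm_cos l b : L l -> sm (fun s => cos (l s + b)).
Proof.
move=> Ll; pose f (x : R) := (cos (x + b))%:E.
have mc : measurable_fun setT (fun x : R => cos (x + b)).
  apply: continuous_measurable_fun => x; apply: continuous_comp.
    by apply: (@cvgD _ R^o) => //; exact: cvg_cst.
  exact: continuous_cos.
have mf : measurable_fun setT f by exact/measurable_EFinP.
have [i1 i2] := bounded_meas_integrable P1 P2 (bm_cos b Ll).
have e1 := integral_pushforward (mL1 Ll) mf i1 measurableT.
have e2 := integral_pushforward (mL2 Ll) mf i2 measurableT.
rewrite /same_mean -[LHS]e1 -[RHS]e2.
apply: eq_measure_integral; [exact: mL2|exact: mL1|].
by move=> ? ? A mA _; exact: (lawL Ll mA).
Qed.

(* The multipliers of this class form an algebra closed under bounded pointwise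
   limits; it contains the functions [cos (l s + b)], because a product of
   cosines is a sum of cosines. Hence the indicators that are multipliers form a
   sigma-algebra, and it contains the half-spaces. *)
Definition trig_same F := bm F /\
  forall l b, L l -> sm (fun s => F s * cos (l s + b)).

Definition multiplier f := bm f /\
  forall F, trig_same F -> trig_same (fun s => f s * F s).

Lemma trig_sameD F G : trig_same F -> trig_same G ->
  trig_same (fun s => F s + G s).
Proof.
move=> [bF tF] [bG tG]; split; first exact: bounded_measD.
move=> l b Ll; under eq_fun do rewrite mulrDl.
apply: same_meanD; [|..| exact: tG]; last exact: tF.
  by apply: bounded_measM => //; exact: bm_cos.
by apply: bounded_measM => //; exact: bm_cos.
Qed.

Lemma trig_sameZ c F : trig_same F -> trig_same (fun s => c * F s).
Proof.
move=> [bF tF]; split.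
  by apply: bounded_measM => //; exact: bounded_meas_cst.
move=> l b Ll; under eq_fun do rewrite -mulrA.
apply: same_meanZ; last exact: tF.
by apply: bounded_measM => //; exact: bm_cos.
Qed.

Lemma trig_same_lim (F_ : nat -> S -> R) F M :
  (forall n, trig_same (F_ n)) -> (forall n s, `|F_ n s| <= M) ->
  (forall s, F_ ^~ s @ \oo --> F s) -> trig_same F.
Proof.
move=> tF FM cF; have bF n : bm (F_ n) by case: (tF n).
split; first exact: bounded_meas_lim cF.
move=> l b Ll.
apply: (@same_mean_lim _ _ _ _ _ _ _ _ _ _ (fun n s => F_ n s * cos (l s + b))
   _ M) => //.
- by move=> n; apply: bounded_measM => //; exact: bm_cos.
- move=> n s; rewrite normrM -[leRHS]mulr1 ler_pM//.
  by rewrite ler_norml cos_geN1 cos_le1.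
- by move=> s; apply: cvgM; [exact: cF|exact: cvg_cst].
- by move=> n; case: (tF n) => _; apply.
Qed.

Lemma trig_same1 : trig_same (fun=> 1).
Proof.
split; first exact: bounded_meas_cst.
by move=> l b Ll; under eq_fun do rewrite mul1r; exact: sm_cos.
Qed.

Lemma multiplier_cst c : multiplier (fun=> c).
Proof.
by split; [exact: bounded_meas_cst|move=> F tF; exact: trig_sameZ].
Qed.

Lemma multiplierD f g : multiplier f -> multiplier g ->
  multiplier (fun s => f s + g s).
Proof.
move=> [bf mf] [bg mg]; split; first exact: bounded_measD.
move=> F tF; under eq_fun do rewrite mulrDl.
by apply: trig_sameD; [exact: mf|exact: mg].
Qed.

Lemma multiplierM f g : multiplier f -> multiplier g ->
  multiplier (fun s => f s * g s).
Proof.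
move=> [bf mf] [bg mg]; split; first exact: bounded_measM.
by move=> F tF; under eq_fun do rewrite -mulrA; apply/mf/mg.
Qed.

Lemma multiplierZ c f : multiplier f -> multiplier (fun s => c * f s).
Proof. exact: multiplierM (multiplier_cst c). Qed.

Lemma multiplierB f g : multiplier f -> multiplier g ->
  multiplier (fun s => f s - g s).
Proof.
move=> mf mg; under eq_fun do rewrite -mulN1r.
by apply: multiplierD => //; exact: multiplierZ.
Qed.

Lemma multiplierX f n : multiplier f -> multiplier (fun s => f s ^+ n).
Proof.
move=> mf; elim: n => [|n ih].
  by under eq_fun do rewrite expr0; exact: multiplier_cst.
by under eq_fun do rewrite exprS; exact: multiplierM.
Qed.

Lemma multiplier_lim (f_ : nat -> S -> R) f M :
  (forall n, multiplier (f_ n)) -> (forall n s, `|f_ n s| <= M) ->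
  (forall s, f_ ^~ s @ \oo --> f s) -> multiplier f.
Proof.
move=> tf fM cf; have bf n : bm (f_ n) by case: (tf n).
split; first exact: bounded_meas_lim cf.
move=> F tF; have [[_ _ [N FN]] _] := tF.
apply: (@trig_same_lim (fun n s => f_ n s * F s) _ (M * N)).
- by move=> n; case: (tf n) => _; apply.
- by move=> n s; rewrite normrM ler_pM.
- by move=> s; apply: cvgM; [exact: cf|exact: cvg_cst].
Qed.

Lemma multiplier_cos l b : L l -> multiplier (fun s => cos (l s + b)).
Proof.
move=> Ll; split; first exact: bm_cos.
move=> F [bF tF]; split; first by apply: bounded_measM => //; exact: bm_cos.
move=> m c Lm.
have -> : (fun s => cos (l s + b) * F s * cos (m s + c)) =
    (fun s => 2^-1 * (F s * cos ((l s + m s) + (b + c)) +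
                      F s * cos ((l s + -1 * m s) + (b - c)))).
  apply/funext => s.
  have -> : l s + m s + (b + c) = (l s + b) + (m s + c) by ring.
  have -> : l s + -1 * m s + (b - c) = (l s + b) - (m s + c) by ring.
  by move: (l s + b) (m s + c) => x y; rewrite cosD cosB; field.
have b1 x y : L x -> bm (fun s => F s * cos (x s + y)).
  by move=> Lx; apply: bounded_measM => //; exact: bm_cos.
have L1 := LD Ll Lm; have L2 := LD Ll (LZ (-1) Lm).
apply: same_meanZ; first by apply: bounded_measD; exact: (b1 _ _).
by apply: same_meanD; [exact: (b1 _ _ L1)|exact: (b1 _ _ L2)|exact: (tF _ _ L1)|exact: (tF _ _ L2)].
Qed.

Let abs_iter f := fix w n s := if n is n'.+1 then
  w n' s + 2^-1 * (f s ^+ 2 - w n' s ^+ 2) else 0.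

(** One iteration multiplies the gap [|f| - w] by [1 - (|f| + w) / 2], which lies between 0 and
    [1 - |f| / 2]. *)
Let abs_iterP f n s : `|f s| <= 1 ->
  0 <= abs_iter f n s <= `|f s| /\
  `|f s| - abs_iter f n s <= (1 - `|f s| / 2) ^+ n.
Proof.
move=> f1; elim: n => [|n [/andP[h1 h2] h3]] /=.
  by rewrite expr0 subr0 lexx normr_ge0.
set w := abs_iter f n s in h1 h2 h3 *; set a := `|f s| in f1 h2 h3 *.
have a0 : 0 <= a by rewrite normr_ge0.
have -> : f s ^+ 2 = a ^+ 2 by rewrite real_normK ?num_real.
have e : a - (w + 2^-1 * (a ^+ 2 - w ^+ 2)) = (a - w) * (1 - (a + w) / 2).
  by field.
have k0 : 0 <= 1 - (a + w) / 2 by lra.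
have k1 : 1 - (a + w) / 2 <= 1 - a / 2 by lra.
split; last first.
  by rewrite e exprSr ler_pM// subr_ge0.
apply/andP; split; last by rewrite -subr_ge0 e mulr_ge0// subr_ge0.
rewrite addr_ge0// mulr_ge0// subr_ge0 ler_sqr ?nnegrE//.
Qed.

(* The square root iteration [w + (f^2 - w^2)/2] converges to [|f|]. *)
Lemma multiplier_norm1 f : (forall s, `|f s| <= 1) -> multiplier f ->
  multiplier (fun s => `|f s|).
Proof.
move=> f1 mf; apply: (@multiplier_lim (abs_iter f) _ 1).
- elim=> [|n ih]; first exact: multiplier_cst.
  apply: multiplierD => //; apply: multiplierZ.
  by apply: multiplierB; exact: multiplierX.
- move=> n s; have [/andP[h1 h2] _] := abs_iterP n (f1 s).
  by rewrite ger0_norm// (le_trans h2).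
(* At a zero of [f] the rate [1 - |f| / 2] is 1 and gives nothing, but there the iterates are
   squeezed between 0 and 0. *)
- move=> s; have [fs0|fs0] := eqVneq (f s) 0.
    rewrite fs0 normr0; apply: cvg_near_cst; apply: nearW => n.
    have [h _] := @abs_iterP f n s (f1 s).
    by apply/eqP; rewrite eq_le andbC; move: h; rewrite fs0 normr0.
  have c0 : (fun n => (1 - `|f s| / 2) ^+ n) @ \oo --> (0 : R).
    apply: expr_cvg0.
    rewrite ltr_norml; have := f1 s; have : 0 < `|f s| by rewrite normr_gt0.
    by move=> *; apply/andP; split; lra.
  have c1 : (fun n => `|f s| - (1 - `|f s| / 2) ^+ n) @ \oo --> `|f s|.
    by rewrite -[X in _ --> X]subr0; apply: cvgB => //; exact: cvg_cst.
  apply: squeeze_cvgr c1 (cvg_cst _).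
  apply: nearW => n; have [/andP[h1 h2] h3] := abs_iterP n (f1 s).
  by rewrite h2 andbT; lra.
Qed.

Lemma multiplier_norm f : multiplier f -> multiplier (fun s => `|f s|).
Proof.
move=> mf; have [[_ _ [M fM]] _] := mf.
pose N := `|M| + 1; have N0 : 0 < N by rewrite ltr_wpDl.
have -> : (fun s => `|f s|) = (fun s => N * `|N^-1 * f s|).
  apply/funext => s; rewrite normrM gtr0_norm ?invr_gt0//.
  by rewrite mulrA divff ?mul1r// gt_eqF.
apply/multiplierZ/multiplier_norm1; last exact: multiplierZ.
move=> s; rewrite normrM gtr0_norm ?invr_gt0// mulrC ler_pdivrMr// mul1r.
by rewrite (le_trans (fM s))// /N (le_trans (ler_norm M))// lerDl.
Qed.

Let pos f s := 2^-1 * (f s + `|f s|).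

Let multiplier_pos f : multiplier f -> multiplier (pos f).
Proof.
by move=> mf; apply: multiplierZ; apply: multiplierD => //; exact: multiplier_norm.
Qed.

Let Sset : set (set S) := [set B | multiplier \1_B].

(** For values in [0, 1], [1 - (1 - f)^n] tends to the indicator of [f > 0]. *)
Let Sset_gt01 f : multiplier f -> (forall s, 0 <= f s <= 1) ->
  Sset [set s | 0 < f s].
Proof.
move=> mf f01; apply: (@multiplier_lim (fun n s => 1 - (1 - f s) ^+ n) _ 1).
- move=> n; apply: multiplierB; first exact: multiplier_cst.
  by apply: multiplierX; apply: multiplierB => //; exact: multiplier_cst.
- move=> n s; have /andP[h0 h1] := f01 s.
  have : 0 <= (1 - f s) ^+ n <= 1.
    by rewrite exprn_ge0 ?exprn_ile1 ?subr_ge0//; lra.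
  by move=> /andP[? ?]; rewrite ger0_norm; lra.
- move=> s; have /andP[h0 h1] := f01 s.
  rewrite indicE; have [fs|fs] := ltrP 0 (f s).
    rewrite mem_set//= -[X in _ --> X]subr0; apply: cvgB; first exact: cvg_cst.
    by apply: expr_cvg0; rewrite ltr_norml; lra.
  rewrite memNset/=; last by apply/negP; rewrite -leNgt.
  have -> : f s = 0 by apply/eqP; rewrite eq_le fs h0.
  by under eq_fun do rewrite subr0 expr1n subrr; exact: cvg_cst.
Qed.

Let Sset_gt0 f : multiplier f -> (forall s, `|f s| <= 1) ->
  Sset [set s | 0 < f s].
Proof.
move=> mf f1.
have pE s : (0 < pos f s) = (0 < f s) /\ 0 <= pos f s <= 1.
  have := f1 s; rewrite /pos; case: (ltrP 0 (f s)) => h.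
    by rewrite (gtr0_norm h) => h1; split; [apply/idP; lra|lra].
  by rewrite (ler0_norm h) subrr mulr0 ltxx lexx ler01.
have -> : [set s | 0 < f s] = [set s | 0 < pos f s].
  by apply/seteqP; split => s /=; have [->] := pE s.
by apply: Sset_gt01; [exact: multiplier_pos|move=> s; have [] := pE s].
Qed.

(** Multipliers are closed under products, so the indicator of a finite union is
    [1 - \prod (1 - \1_(A k))] and no Dynkin argument is called for; countable unions are bounded
    pointwise limits of these. *)
Let Sset_sigma : sigma_algebra setT Sset.
Proof.
split.
- by rewrite /Sset/= indic0; exact: multiplier_cst.
- move=> B mB; rewrite /Sset/=.
  have -> : \1_(setT `\` B) = (fun s => 1 - \1_B s) :> (S -> R).
    apply/funext => s; rewrite setTD indicE in_setC indicE.
    by case: (_ \in _); rewrite /= ?subrr ?subr0.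
  by apply: multiplierB => //; exact: multiplier_cst.
- move=> A mA; rewrite /Sset/=.
  pose f_ n s : R := 1 - \prod_(k < n) (1 - \1_(A k) s).
  have p01 n s : \prod_(k < n) (1 - \1_(A k) s) =
      ((s \notin \bigcup_(k < n) A k)%:R : R).
    elim: n => [|n ih].
      by rewrite big_ord0 bigcup_mkord big_ord0 in_set0.
    rewrite [in RHS]bigcup_mkord [in RHS]big_ord_recr/= -[in RHS]bigcup_mkord.
    rewrite big_ord_recr/= ih in_setU.
    rewrite indicE negb_or.
    by case: (s \in A n); case: (s \in \bigcup_(k < n) A k);
      rewrite /= ?subrr ?subr0 ?mulr0 ?mulr1.
  apply: (@multiplier_lim f_ _ 1).
  + move=> n; apply: multiplierB; first exact: multiplier_cst.
    elim: n => [|n ih].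
      by under eq_fun do rewrite big_ord0; exact: multiplier_cst.
    under eq_fun do rewrite big_ord_recr.
    apply: multiplierM => //; apply: multiplierB; first exact: multiplier_cst.
    exact: mA.
  + by move=> n s; rewrite /f_ p01; case: (_ \in _); rewrite /= ?subrr ?subr0 ?normr0 ?normr1.
  + move=> s; rewrite /f_; under eq_fun do rewrite p01.
    rewrite indicE; have [[k _ Aks]|nA] := pselect ((\bigcup_k A k) s).
      rewrite mem_set/=; last by exists k.
      apply: cvg_near_cst; near=> n.
      rewrite mem_set/= ?subr0//; exists k => //=.
      by near: n; exact: nbhs_infty_gt.
    rewrite memNset//=; apply: cvg_near_cst; apply: nearW => n.
    by rewrite memNset/= ?subrr// => -[k _ Aks]; apply: nA; exists k.
Unshelve. all: end_near. Qed.

(* [sin ((l - c) / n)] has the sign of [l - c] for large [n]. *)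
Let Sset_ray l c : L l -> Sset [set s | c < l s].
Proof.
move=> Ll.
pose g n s := cos (n.+1%:R^-1 * l s + (- (n.+1%:R^-1 * c) - pi / 2)).
have gE n s : g n s = sin (n.+1%:R^-1 * (l s - c)).
  rewrite /g addrA cosB cos_pihalf sin_pihalf mulr0 add0r mulr1.
  by rewrite mulrBr.
have mg n : Sset [set s | 0 < g n s].
  apply: Sset_gt0; first exact/multiplier_cos/LZ.
  by move=> s; rewrite ler_norml cos_geN1 cos_le1.
apply: (@multiplier_lim (fun n => \1_[set s | 0 < g n s]) _ 1) => //.
  by move=> n s; rewrite indicE; case: (_ \in _); rewrite ?normr0 ?normr1.
move=> s; apply: cvg_near_cst; near=> n.
have npi : `|n.+1%:R^-1 * (l s - c)| < pi.
  rewrite normrM gtr0_norm ?invr_gt0// mulrC ltr_pdivrMr//.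
  rewrite -ltr_pdivrMl ?pi_gt0//.
  apply: lt_trans (_ : n%:R < _); last by rewrite ltr_nat.
  near: n; exact: nbhs_infty_gtr.
rewrite !indicE.
suff -> : (s \in [set s | 0 < g n s]) = (s \in [set s | c < l s]) by [].
apply/idP/idP.
  rewrite !inE/= gE => h; rewrite ltNge; apply/negP => h1.
  have h2 : sin (- (n.+1%:R^-1 * (l s - c))) >= 0.
    apply: sin_ge0_pi; apply/andP; split.
      by rewrite oppr_ge0 mulr_ge0_le0// ?invr_ge0// subr_le0.
    by move: npi; rewrite -normrN => /ltW; apply: le_trans; exact: ler_norm.
  by move: h2; rewrite sinN oppr_ge0 leNgt h.
rewrite !inE/= gE => h; apply: sin_gt0_pi; apply/andP; split.
  by rewrite mulr_gt0 ?invr_gt0// subr_gt0.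
by apply: le_lt_trans npi; exact: ler_norm.
Unshelve. all: end_near. Qed.

Lemma cramer_wold (B : set S) :
  <<s [set l @^-1` A | l in L & A in (@measurable _ R)] >> B ->
  P1 (X1 @^-1` B) = P2 (X2 @^-1` B).
Proof.
move=> sB; have : Sset B.
  apply: smallest_sub sB; first exact: Sset_sigma.
  move=> _ [l Ll [A mA <-]].
  have {mA} : (ocitv (R:=R)).-sigma.-measurable A by exact: mA.
  rewrite RGenOInfty.measurableE => mA.
  apply: (@smallest_sub _ (sigma_algebra setT) (RGenOInfty.G (R:=R))
    [set A | Sset (l @^-1` A)]) mA.
    have [S0 SC SU] := Sset_sigma.
    split => /=; first by rewrite preimage_set0.
      by move=> A' /SC; rewrite !setTD.
    by move=> F /SU; rewrite preimage_bigcup.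
  move=> _ [x ->] /=; have := Sset_ray x Ll.
  by congr Sset; apply/seteqP; split => s /=; rewrite in_itv/= andbT.
move=> [[m1 m2 _] tB].
(* The multiplier acts on the constant 1 and is tested against the cosine of the zero functional, so
   that the equality of means becomes the equality of probabilities. *)
have [_ /(_ _ 0 L0)] := tB _ trig_same1.
rewrite /same_mean addr0 cos0.
under eq_integral do rewrite mulr1 mulr1.
under [X in _ = X -> _]eq_integral do rewrite mulr1 mulr1.
have H d (T : measurableType d) (P : probability T R) (X : T -> S) :
    measurable_fun setT (\1_B \o X : T -> R) ->
    (\int[P]_w (\1_B (X w))%:E)%E = P (X @^-1` B).
  move=> mX; have mXB : measurable (X @^-1` B).
    have := mX measurableT [set 1 : R] (measurable_set1 _).
    rewrite setTI; congr measurable; apply/seteqP; split => w /=; rewrite indicE.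
      by case: (boolP (_ \in _)) => [|_ /eqP]; rewrite ?inE// eq_sym oner_eq0.
    by move=> h; rewrite mem_set.
  by rewrite -[X in P X]setIT; exact: (@integral_indic _ _ R P setT).
by rewrite (H _ _ _ _ m1) (H _ _ _ _ m2).
Qed.

End cramer_wold.

(** * Sums of independent normal variables *)

Section normal_laws.
Import HBNNSimple.
Context {R : realType}.
Local Notation mu := (@lebesgue_measure R).
Implicit Types (m s t a : R).

(** The law of a set is the integral of the density over it; simple functions and monotone
    convergence extend this to nonnegative integrands. *)
Lemma integral_normal_prob m s (f : R -> \bar R) :
  measurable_fun setT f -> (forall x, 0 <= f x)%E ->
  (\int[normal_prob m s]_x f x = \int[mu]_x (f x * (normal_pdf m s x)%:E))%E.
Proof.
move=> mf f0; pose g := nnsfun_approx measurableT mf.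
have mpdf : measurable_fun setT (EFin \o normal_pdf m s).
  by apply/measurable_EFinP; exact: measurable_normal_pdf.
have pdf0 x : (0 <= (normal_pdf m s x)%:E)%E by rewrite lee_fin normal_pdf_ge0.
have step (A : set R) : measurable A ->
    (\int[normal_prob m s]_x (\1_A x)%:E =
     \int[mu]_x ((\1_A x)%:E * (normal_pdf m s x)%:E))%E.
  move=> mA; rewrite integral_indic// setIT.
  rewrite [LHS](_ : _ = \int[mu]_(x in A) (normal_pdf m s x)%:E)%E//.
  rewrite integral_mkcond; apply: eq_integral => x _.
  rewrite patchE indicE; case: (x \in A); rewrite ?mul1e ?mul0e//.
have mg n : measurable_fun setT (g n : R -> R) by exact: measurable_funP.
have gcvg (x : R) : (fun n => (g n x)%:E) @ \oo --> f x.
  by apply: cvg_nnsfun_approx => // y _; exact: f0.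
have nd (x : R) : {homo (fun n => (g n x)%:E) : a b / (a <= b)%N >-> (a <= b)%E}.
  by move=> a b ab; rewrite lee_fin; exact/lefP/nd_nnsfun_approx.
transitivity (limn (fun n => \int[normal_prob m s]_x (g n x)%:E))%E.
  rewrite -monotone_convergence//.
  - by apply: eq_integral => x _; apply/esym/cvg_lim => //; exact: gcvg.
  - by move=> n; (apply/measurable_EFinP; exact: mg).
  - by move=> n x _; rewrite lee_fin.
transitivity (limn (fun n => \int[mu]_x ((g n x)%:E * (normal_pdf m s x)%:E)))%E;
    last first.
  rewrite -monotone_convergence//.
  - apply: eq_integral => x _; apply/cvg_lim => //.
    by apply: cvgeZr => //; exact: gcvg.
  - by move=> n; apply: emeasurable_funM => //; (apply/measurable_EFinP; exact: mg).
  - by move=> n x _; rewrite mule_ge0// lee_fin.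
  - by move=> x _ a b ab; rewrite lee_wpmul2r//; exact: nd.
congr (limn _); apply/funext => n.
have mr r : measurable (g n @^-1` [set r]) by exact: measurable_sfunP.
have mi k : measurable_fun setT
    (fun x : R => (k * \1_(g n @^-1` [set k]) x : R)).
  by apply: measurable_funM => //; apply: measurable_indic; exact: mr.
transitivity (\sum_(k \in range (g n))
    \int[normal_prob m s]_x (k * \1_(g n @^-1` [set k]) x)%:E)%E.
  under eq_integral do rewrite fimfunE -fsumEFin//.
  rewrite ge0_integral_fsum//.
  - by move=> y; apply/measurable_EFinP; exact: mi.
  - by move=> y x _; rewrite nnfun_muleindic_ge0.
transitivity (\sum_(k \in range (g n))
    \int[mu]_x ((k * \1_(g n @^-1` [set k]) x)%:E * (normal_pdf m s x)%:E))%E;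
    last first.
  rewrite -ge0_integral_fsum//.
  - apply: eq_integral => x _; rewrite [in RHS]fimfunE -fsumEFin// ge0_mule_fsuml//.
    by move=> y; rewrite nnfun_muleindic_ge0.
  - move=> y; apply: emeasurable_funM => //.
    by apply/measurable_EFinP; exact: mi.
  - by move=> y x _; rewrite mule_ge0// nnfun_muleindic_ge0.
apply: eq_fsbigr => r; rewrite inE => -[x _ rE].
have r0 : 0 <= r by rewrite -rE.
under eq_integral do rewrite EFinM.
rewrite ge0_integralZl//; first last.
- by apply/measurable_EFinP; apply: measurable_indic; exact: mr.
under [RHS]eq_integral do rewrite EFinM -muleA.
rewrite ge0_integralZl//; last 2 first.
- apply: emeasurable_funM => //.
  by apply/measurable_EFinP; apply: measurable_indic; exact: mr.
- by move=> y _; rewrite mule_ge0// lee_fin.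
by rewrite step.
Qed.

(** The image of Lebesgue measure under a translation has the right value on half-open intervals,
    which characterises Lebesgue measure. *)
Lemma lebesgue_measure_translate a (A : set R) : measurable A ->
  mu [set x | A (x + a)] = mu A.
Proof.
move=> mA; have mT : @measurable_fun _ _ (measurableTypeR R) (measurableTypeR R) setT
    (fun x => x + a).
  exact: measurable_funD.
pose nu : {measure set (measurableTypeR R) -> \bar R} :=
  measure_function_pushforward__canonical__measure_function_Measure mu mT.
rewrite [RHS](@lebesgue_measure_unique R nu)//.
move=> X [[b c] /= bc <-]; rewrite /pushforward.
have -> : (fun x => x + a) @^-1` `]b, c] = `]b - a, c - a]%classic.
  by apply/seteqP; split => x /=; rewrite !in_itv/= ltrBlDr lerBrDr.
rewrite !lebesgue_measure_itv/= !lte_fin ltrD2r; case: ifP => // _.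
by rewrite -!EFinB; congr (_%:E); ring.
Qed.

Lemma ge0_integral_translate a (f : R -> \bar R) : measurable_fun setT f ->
  (forall x, 0 <= f x)%E -> (\int[mu]_x (f (x + a)%R) = \int[mu]_x (f x))%E.
Proof.
move=> mf f0; have mT : @measurable_fun _ _ (measurableTypeR R) (measurableTypeR R) setT
    (fun x => x + a).
  exact: measurable_funD.
have := (@ge0_integral_pushforward _ _ (measurableTypeR R) (measurableTypeR R) R _ mT mu setT f measurableT).
rewrite preimage_setT => <-//.
apply: eq_measure_integral => A mA _.
exact: lebesgue_measure_translate.
Qed.

(** Completing the square in [y]. The second factor on the right is the conditional density of the
    summand [y] given the sum [x]. *)
Lemma normal_pdf_conv s t x y : 0 < s -> 0 < t ->
  normal_pdf 0 s (x - y) * normal_pdf 0 t y =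
  normal_pdf 0 (Num.sqrt (s ^+ 2 + t ^+ 2)) x *
  normal_pdf (t ^+ 2 / (s ^+ 2 + t ^+ 2) * x)
    (s * t / Num.sqrt (s ^+ 2 + t ^+ 2)) y.
Proof.
move=> s_gt0 t_gt0; have s0 : s != 0 by rewrite gt_eqF.
have t0 : t != 0 by rewrite gt_eqF.
have st0 : 0 < s ^+ 2 + t ^+ 2.
  by rewrite ltr_wpDr ?sqr_ge0// exprn_even_gt0.
set u := Num.sqrt _.
have u2 : u ^+ 2 = s ^+ 2 + t ^+ 2 by rewrite sqr_sqrtr// ltW.
have u_gt0 : 0 < u by rewrite sqrtr_gt0.
have u0 : u != 0 by rewrite gt_eqF// sqrtr_gt0.
have v0 : s * t / u != 0 by rewrite !mulf_neq0 ?invr_neq0.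
rewrite !normal_pdfE// /normal_peak /normal_fun.
rewrite mulrACA [RHS]mulrACA -!expRD; congr (_ * expR _); last first.
  have u20 : s ^+ 2 + t ^+ 2 != 0 by rewrite gt_eqF.
  rewrite exprMn exprVn exprMn u2 !subr0; field.
  by rewrite s0 t0 u20.
rewrite -!invfM -!sqrtrM ?mulrn_wge0 ?mulr_ge0 ?sqr_ge0 ?pi_ge0 ?(ltW s_gt0) ?(ltW t_gt0) ?(ltW u_gt0)//.
congr (Num.sqrt _)^-1.
rewrite exprMn exprVn exprMn; field.
by rewrite u0.
Qed.

End normal_laws.

Section normal_conv.
Context (R : realType) d1 (T1 : measurableType d1) (P1 : probability T1 R)
  d2 (T2 : measurableType d2) (P2 : probability T2 R).
Local Notation mu := (@lebesgue_measure R).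

Lemma integral_law d (T : measurableType d) (P : probability T R)
    (X : T -> R) (Q : probability (measurableTypeR R) R) (f : R -> \bar R) :
  measurable_fun setT X ->
  (forall B, measurable B -> P (X @^-1` B) = Q B) ->
  measurable_fun setT f -> (forall x, 0 <= f x)%E ->
  (\int[P]_w f (X w) = \int[Q]_x f x)%E.
Proof.
move=> mX lX mf f0.
have mX' : @measurable_fun _ _ T (measurableTypeR R) setT X by exact: mX.
have := @ge0_integral_pushforward _ _ T (measurableTypeR R) R X mX' P setT f
  measurableT.
rewrite preimage_setT => <-//.
by apply: eq_measure_integral => A mA _; exact: lX.
Qed.

Lemma normal_prob_conv s t (B : set R) : 0 < s -> 0 < t -> measurable B ->
  (\int[normal_prob 0 s]_x normal_prob 0 t [set y | B (x + y)%R] =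
   normal_prob 0 (Num.sqrt (s ^+ 2 + t ^+ 2)) B)%E.
Proof.
move=> s0 t0 mB.
pose C : set (R * R) := [set z | B (z.1 + z.2)].
have mC : measurable C.
  have mD : measurable_fun setT (fun z : R * R => z.1 + z.2).
    by apply: measurable_funD.
  by rewrite -[C]setTI; exact: mD.
have mg : measurable_fun setT (fun x : R => normal_prob 0 t [set y | B (x + y)]).
  have := measurable_fun_xsection (normal_prob 0 t) mC.
  congr measurable_fun; apply/funext => x /=; congr (normal_prob 0 t).
  by apply/seteqP; split => y; rewrite /xsection /= inE.
rewrite integral_normal_prob//.
(* The coordinates of [z] are the first summand and the sum. Once the integrals are exchanged, the
   inner one is over a conditional density of total mass 1. *)
pose F (z : R * R) := ((\1_B z.2 * normal_pdf 0 t (z.2 - z.1) *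
  normal_pdf 0 s z.1)%:E).
have mpdf m u : measurable_fun setT (normal_pdf m u : R -> R).
  exact: measurable_normal_pdf.
have mF : measurable_fun setT F.
  apply/measurable_EFinP; apply: measurable_funM; last first.
    by apply: measurableT_comp.
  apply: measurable_funM.
    by apply: (@measurableT_comp _ _ _ _ _ _ (\1_B : R -> R)); first exact: measurable_indic.
  apply: (@measurableT_comp _ _ _ _ _ _ (normal_pdf 0 t)) => //.
  by apply: measurable_funB.
have F0 z : (0 <= F z)%E.
  by rewrite lee_fin !mulr_ge0// ?normal_pdf_ge0// indicE.
transitivity (\int[mu]_x \int[mu]_y F (x, y))%E.
  apply: eq_integral => x _.
  have -> : normal_prob 0 t [set y | B (x + y)] =
      (\int[mu]_y (\1_B y * normal_pdf 0 t (y - x))%:E)%E.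
    rewrite -(ge0_integral_translate x).
    - rewrite [LHS](_ : _ = \int[mu]_(y in [set y | B (x + y)%R])
        (normal_pdf 0 t y)%:E)%E// integral_mkcond.
      apply: eq_integral => y _; rewrite patchE addrK indicE.
      have -> : (y \in [set y | B (x + y)]) = (y + x \in B).
        by apply/idP/idP; rewrite !inE/= addrC.
      by case: (_ \in _); rewrite ?mul1r ?mul0r.
    - apply/measurable_EFinP; apply: measurable_funM => //.
      by apply: measurableT_comp => //; exact: measurable_funB.
    - by move=> y; rewrite lee_fin mulr_ge0// ?normal_pdf_ge0// indicE.
  rewrite /F/=; under [RHS]eq_integral do rewrite EFinM.
  rewrite ge0_integralZr//.
  - apply/measurable_EFinP; apply: measurable_funM => //.
    by apply: measurableT_comp => //; exact: measurable_funB.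
  - by move=> y _; rewrite lee_fin mulr_ge0// ?normal_pdf_ge0// indicE.
  - by rewrite lee_fin normal_pdf_ge0.
rewrite fubini_tonelli//.
rewrite [RHS](_ : _ = \int[mu]_(y in B)
        (normal_pdf 0 (Num.sqrt (s ^+ 2 + t ^+ 2)) y)%:E)%E//.
rewrite [RHS]integral_mkcond; apply: eq_integral => y _.
rewrite patchE /F/= indicE; case: (y \in B); last first.
  by under eq_integral do rewrite !mul0r; rewrite integral0.
under eq_integral do rewrite mul1r normal_pdf_conv// EFinM.
rewrite ge0_integralZl//.
- by rewrite integral_normal_pdf mule1 addrC.
- by apply/measurable_EFinP; exact: measurable_normal_pdf.
- by move=> x _; rewrite lee_fin normal_pdf_ge0.
- by rewrite lee_fin normal_pdf_ge0.
Qed.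

Lemma normal_law_conv (X1 : T1 -> R) (X2 : T2 -> R) s t (B : set R) :
  0 <= s -> 0 <= t -> measurable_fun setT X1 -> measurable_fun setT X2 ->
  (forall B, measurable B -> P1 (X1 @^-1` B) = normal_law 0 s B) ->
  (forall B, measurable B -> P2 (X2 @^-1` B) = normal_law 0 t B) ->
  measurable B ->
  (P1 \x P2)%E [set w | B (X1 w.1 + X2 w.2)] =
    normal_law 0 (Num.sqrt (s ^+ 2 + t ^+ 2)) B.
Proof.
move=> s0 t0 mX1 mX2 l1 l2 mB.
have mshift x : measurable [set y | B (x + y)].
  have mD : measurable_fun setT (fun y : R => x + y) by exact: measurable_funD.
  by rewrite -[X in measurable X]setTI; exact: mD.
have E : (P1 \x P2)%E [set w | B (X1 w.1 + X2 w.2)] =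
    (\int[P1]_w normal_law 0 t [set y | B (X1 w + y)%R])%E.
  rewrite /product_measure1; apply: eq_integral => w _ /=.
  rewrite -l2//; congr (P2 _).
  by apply/seteqP; split => y; rewrite /xsection /= inE.
rewrite E /normal_law {E}.
have mg : t != 0 ->
    measurable_fun setT (fun x : R => normal_prob 0 t [set y | B (x + y)]).
  move=> t1; have mC : measurable ([set z | B (z.1 + z.2)] : set (R * R)).
    have mD : measurable_fun setT (fun z : R * R => z.1 + z.2).
      by apply: measurable_funD.
    by rewrite -[X in measurable X]setTI; exact: mD.
  have := measurable_fun_xsection (normal_prob 0 t) mC.
  congr measurable_fun; apply/funext => x /=; congr (normal_prob 0 t).
  by apply/seteqP; split => y; rewrite /xsection /= inE.
(* A law with zero deviation is a point mass and has no density, so the degenerate cases are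
   separated from the convolution of densities. *)
have [t1|t1] := eqVneq t 0.
  rewrite t1 expr0n/= addr0 sqrtr_sqr ger0_norm// -/(normal_law 0 s B) -l1//.
  rewrite -[X in P1 X]setIT -(@integral_indic _ _ R P1 setT measurableT).
    apply: eq_integral => w _; rewrite diracE indicE.
    suff -> : (0 \in [set y | B (X1 w + y)]) = (w \in X1 @^-1` B) by [].
    by apply/idP/idP; rewrite !inE/= addr0.
  by rewrite -[X in measurable X]setTI; exact: mX1.
have t2 : 0 < t by rewrite lt_neqAle eq_sym t1.
have [s1|s1] := eqVneq s 0.
  rewrite s1 expr0n/= add0r sqrtr_sqr ger0_norm// (negbTE t1).
  pose Q : probability (measurableTypeR R) R := @dirac _ (measurableTypeR R) 0 R.
  rewrite (@integral_law _ _ _ _ Q (fun x => normal_prob 0 t [set y | B (x + y)%R]))//.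
  - rewrite (@integral_dirac _ (measurableTypeR R) 0 R setT)//; last exact: mg.
    rewrite diracT mul1e; congr (normal_prob 0 t).
    by apply/seteqP; split => y /=; rewrite add0r.
  - by move=> A mA; rewrite l1// /normal_law s1 eqxx.
  - exact: mg.
have s2 : 0 < s by rewrite lt_neqAle eq_sym s1.
rewrite (@integral_law _ _ _ _ (normal_prob 0 s) (fun x => normal_prob 0 t [set y | B (x + y)%R]))//.
- rewrite normal_prob_conv// ifF//; apply/negbTE; rewrite gt_eqF// sqrtr_gt0.
  by rewrite addr_gt0// exprn_gt0.
- by move=> A mA; rewrite l1// /normal_law (negbTE s1).
- exact: mg.
Qed.

End normal_conv.

(** * Gaussian matrices *)

Section frobenius.
Context {R : comNzRingType}.

Definition fdot m n (U G : 'M[R]_(m, n)) : R := \tr (U^T *m G).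

Lemma fdotE m n (U G : 'M[R]_(m, n)) :
  fdot U G = \sum_i \sum_j U i j * G i j.
Proof.
rewrite /fdot /mxtrace exchange_big/=; apply: eq_bigr => j _.
by rewrite mxE; apply: eq_bigr => i _; rewrite mxE.
Qed.

Lemma fdotC m n (U G : 'M[R]_(m, n)) : fdot U G = fdot G U.
Proof. by rewrite /fdot -[LHS]mxtrace_tr trmx_mul trmxK. Qed.

Lemma fdotDl m n (U V G : 'M[R]_(m, n)) : fdot (U + V) G = fdot U G + fdot V G.
Proof. by rewrite /fdot linearD/= mulmxDl mxtraceD. Qed.

Lemma fdotZl m n a (U G : 'M[R]_(m, n)) : fdot (a *: U) G = a * fdot U G.
Proof. by rewrite /fdot linearZ/= -scalemxAl mxtraceZ. Qed.

Lemma fdot0l m n (G : 'M[R]_(m, n)) : fdot 0 G = 0.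
Proof. by rewrite /fdot trmx0 mul0mx mxtrace0. Qed.

Lemma fdot_tr m n (U : 'M[R]_(m, n)) (G : 'M[R]_(n, m)) :
  fdot U G^T = fdot U^T G.
Proof. by rewrite /fdot -[LHS]mxtrace_tr trmx_mul !trmxK mxtrace_mulC. Qed.

Lemma fdot_mulr m n p (U : 'M[R]_(m, p)) (G : 'M[R]_(m, n)) (H : 'M[R]_(n, p)) :
  fdot U (G *m H) = fdot (U *m H^T) G.
Proof. by rewrite /fdot mulmxA mxtrace_mulC mulmxA trmx_mul trmxK. Qed.

Lemma fdot_mull m n p (U : 'M[R]_(m, p)) (G : 'M[R]_(n, p)) (H : 'M[R]_(m, n)) :
  fdot U (H *m G) = fdot (H^T *m U) G.
Proof. by rewrite /fdot trmx_mul trmxK mulmxA. Qed.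

Lemma fdot_col_mx m1 m2 n (U1 G1 : 'M[R]_(m1, n)) (U2 G2 : 'M[R]_(m2, n)) :
  fdot (col_mx U1 U2) (col_mx G1 G2) = fdot U1 G1 + fdot U2 G2.
Proof. by rewrite /fdot tr_col_mx mul_row_col mxtraceD. Qed.

End frobenius.

(** * Measurability of matrix-valued maps *)

Section measurable_mx.
Context d (T : measurableType d) (R : realType).

Definition measurable_mx m n (G : T -> 'M[R]_(m, n)) :=
  forall i j, measurable_fun setT (fun w => G w i j).

Lemma measurable_mx_cst m n (A : 'M[R]_(m, n)) : measurable_mx (fun=> A).
Proof. by move=> i j; exact: measurable_cst. Qed.

Lemma measurable_mxM m n p (A : T -> 'M[R]_(m, n)) (B : T -> 'M[R]_(n, p)) :
  measurable_mx A -> measurable_mx B -> measurable_mx (fun w => A w *m B w).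
Proof.
move=> mA mB i j; under eq_fun do rewrite mxE.
by apply: measurable_sum => k; apply: measurable_funM.
Qed.

Lemma measurable_mxD m n (A B : T -> 'M[R]_(m, n)) :
  measurable_mx A -> measurable_mx B -> measurable_mx (fun w => A w + B w).
Proof.
by move=> mA mB i j; under eq_fun do rewrite mxE; apply: measurable_funD.
Qed.

Lemma measurable_mxZ m n (a : T -> R) (A : T -> 'M[R]_(m, n)) :
  measurable_fun setT a -> measurable_mx A ->
  measurable_mx (fun w => a w *: A w).
Proof.
by move=> ma mA i j; under eq_fun do rewrite mxE; apply: measurable_funM.
Qed.

Lemma measurable_mx_tr m n (A : T -> 'M[R]_(m, n)) :
  measurable_mx A -> measurable_mx (fun w => (A w)^T).
Proof. by move=> mA i j; under eq_fun do rewrite mxE; exact: mA. Qed.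

Lemma measurable_mx_usub m1 m2 n (A : T -> 'M[R]_(m1 + m2, n)) :
  measurable_mx A -> measurable_mx (fun w => usubmx (A w)).
Proof. by move=> mA i j; under eq_fun do rewrite mxE; exact: mA. Qed.

Lemma measurable_mx_dsub m1 m2 n (A : T -> 'M[R]_(m1 + m2, n)) :
  measurable_mx A -> measurable_mx (fun w => dsubmx (A w)).
Proof. by move=> mA i j; under eq_fun do rewrite mxE; exact: mA. Qed.

Lemma measurable_mx_col_mx m1 m2 n (A : T -> 'M[R]_(m1, n))
    (B : T -> 'M[R]_(m2, n)) :
  measurable_mx A -> measurable_mx B -> measurable_mx (fun w => col_mx (A w) (B w)).
Proof.
move=> mA mB i j; under eq_fun do rewrite mxE.
by case: (fintype.split i) => k; [exact: mA|exact: mB].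
Qed.

Lemma measurable_fdot m n (U : 'M[R]_(m, n)) (A : T -> 'M[R]_(m, n)) :
  measurable_mx A -> measurable_fun setT (fun w => fdot U (A w)).
Proof.
move=> mA; under eq_fun do rewrite fdotE.
apply: measurable_sum => i; apply: measurable_sum => j.
by apply: measurable_funM => //; exact: measurable_cst.
Qed.

End measurable_mx.

Lemma measurable_mx_comp d1 (T1 : measurableType d1) d2 (T2 : measurableType d2)
    (R : realType) m n (G : T2 -> 'M[R]_(m, n)) (f : T1 -> T2) :
  measurable_mx G -> measurable_fun setT f -> measurable_mx (G \o f).
Proof. by move=> mG mf i j; exact: (measurableT_comp (mG i j) mf). Qed.

(* Sets of matrices that are Borel sets, expressed through the random matrices
   for which they define an event. *)
Definition measurable_mx_set (R : realType) m n (B : set 'M[R]_(m, n)) :=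
  forall d (T : measurableType d) (G : T -> 'M[R]_(m, n)),
  measurable_mx G -> measurable (G @^-1` B).

Section std_gauss.
Context {R : realType}.

(** Independent standard normal entries, expressed through all linear functionals. In this form
    invariance under transposition and under orthogonal factors reduces to an identity for
    [fdot]. *)
Definition std_gauss d (T : measurableType d) (P : probability T R) m n
    (G : T -> 'M[R]_(m, n)) :=
  measurable_mx G /\ forall U (B : set R), measurable B ->
    P [set w | B (fdot U (G w))] = normal_law 0 (Num.sqrt (fdot U U)) B.

Lemma fdot_ge0 m n (U : 'M[R]_(m, n)) : 0 <= fdot U U.
Proof.
by rewrite fdotE; do 2 (apply: sumr_ge0 => ? _); rewrite -expr2 sqr_ge0.
Qed.

Lemma std_gauss_law d1 (T1 : measurableType d1) (P1 : probability T1 R)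
    d2 (T2 : measurableType d2) (P2 : probability T2 R) m n
    (G1 : T1 -> 'M[R]_(m, n)) (G2 : T2 -> 'M[R]_(m, n)) (B : set 'M[R]_(m, n)) :
  std_gauss P1 G1 -> std_gauss P2 G2 -> measurable_mx_set B ->
  P1 (G1 @^-1` B) = P2 (G2 @^-1` B).
Proof.
move=> [mG1 l1] [mG2 l2] mB.
pose L : set ('M[R]_(m, n) -> R) := [set l | exists U, l = fdot U].
apply: (@cramer_wold R _ _ P1 _ _ P2 _ G1 G2 L).
- move=> _ _ [U ->] [V ->]; exists (U + V).
  by apply/funext => s; rewrite fdotDl.
- by move=> c _ [U ->]; exists (c *: U); apply/funext => s; rewrite fdotZl.
- by exists 0; apply/funext => s; rewrite fdot0l.
- by move=> _ [U ->]; exact: measurable_fdot.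
- by move=> _ [U ->]; exact: measurable_fdot.
- by move=> _ A [U ->] mA; rewrite [LHS]l1// [RHS]l2.
pose C := [set l @^-1` A | l in L & A in (@measurable _ R)].
(* [B] is tested on the identity of the matrix space, equipped with the sigma-algebra generated by
   the functionals; the entry [(i, j)] is the functional given by [delta_mx i j]. *)
apply: (mB _ (g_sigma_algebraType C) idfun).
move=> i j _ A mA; rewrite setTI; apply: sub_sigma_algebra.
exists (fdot (delta_mx i j)); first by exists (delta_mx i j).
exists A => //; congr (fun f => f @^-1` A); apply/funext => M /=.
rewrite fdotE (bigD1 i)//= (bigD1 j)//= mxE !eqxx mul1r.
rewrite big1 ?addr0; last by move=> k kj; rewrite mxE (negbTE kj) andbF mul0r.
rewrite big1 ?addr0// => k ki; rewrite big1// => k' _.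
by rewrite mxE (negbTE ki) mul0r.
Qed.

Context d (T : measurableType d) (P : probability T R).

Lemma std_gauss_mulr m n (G : T -> 'M[R]_(m, n)) (H : 'M[R]_n) :
  H *m H^T = 1%:M -> std_gauss P G -> std_gauss P (fun w => G w *m H).
Proof.
move=> HH [mG lG]; split.
  by apply: measurable_mxM => //; exact: measurable_mx_cst.
move=> U B mB.
have -> : fdot U U = fdot (U *m H^T) (U *m H^T).
  by rewrite fdot_mulr -mulmxA -trmx_mul (mulmx1C HH) trmx1 mulmx1.
by rewrite -lG//; under eq_set do rewrite fdot_mulr.
Qed.

Lemma std_gauss_tr m n (G : T -> 'M[R]_(m, n)) :
  std_gauss P G -> std_gauss P (fun w => (G w)^T).
Proof.
move=> [mG lG]; split; first exact: measurable_mx_tr.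
move=> U B mB; have -> : fdot U U = fdot U^T U^T by rewrite fdot_tr trmxK.
by rewrite -lG//; under eq_set do rewrite fdot_tr.
Qed.

Lemma std_gauss_usub m1 m2 n (G : T -> 'M[R]_(m1 + m2, n)) :
  std_gauss P G -> std_gauss P (fun w => usubmx (G w)).
Proof.
move=> [mG lG]; split; first exact: measurable_mx_usub.
have E U w : fdot (col_mx U 0) (G w) = fdot U (usubmx (G w)).
  by rewrite -{1}(vsubmxK (G w)) fdot_col_mx fdot0l addr0.
move=> U B mB; have := lG (col_mx U 0) B mB.
rewrite fdot_col_mx fdot0l addr0 => <-; congr (P _).
by apply/seteqP; split => w /=; rewrite E.
Qed.

Lemma std_gauss_dsub m1 m2 n (G : T -> 'M[R]_(m1 + m2, n)) :
  std_gauss P G -> std_gauss P (fun w => dsubmx (G w)).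
Proof.
move=> [mG lG]; split; first exact: measurable_mx_dsub.
have E U w : fdot (col_mx 0 U) (G w) = fdot U (dsubmx (G w)).
  by rewrite -{1}(vsubmxK (G w)) fdot_col_mx fdot0l add0r.
move=> U B mB; have := lG (col_mx 0 U) B mB.
rewrite fdot_col_mx fdot0l add0r => <-; congr (P _).
by apply/seteqP; split => w /=; rewrite E.
Qed.

(* Disjoint blocks of rows are independent: they may be sampled separately. *)
Lemma std_gauss_split m1 m2 n (G : T -> 'M[R]_(m1 + m2, n)) :
  std_gauss P G -> std_gauss (P \x P)%E
    (fun w => col_mx (usubmx (G w.1)) (dsubmx (G w.2))).
Proof.
move=> sG; have [mu lu] := std_gauss_usub sG; have [md ld] := std_gauss_dsub sG.
split.
  apply: measurable_mx_col_mx.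
    exact: (@measurable_mx_comp _ _ _ _ _ _ _ (fun w => usubmx (G w)) fst).
  exact: (@measurable_mx_comp _ _ _ _ _ _ _ (fun w => dsubmx (G w)) snd).
move=> U B mB; rewrite -(vsubmxK U).
under eq_set do rewrite fdot_col_mx.
rewrite fdot_col_mx -[X in Num.sqrt (X + _)]sqr_sqrtr ?fdot_ge0//.
rewrite -[X in Num.sqrt (_ + X)]sqr_sqrtr ?fdot_ge0//.
apply: (@normal_law_conv R _ _ P _ _ P (fun w => fdot (usubmx U) (usubmx (G w)))
   (fun w => fdot (dsubmx U) (dsubmx (G w)))) => //; rewrite ?sqrtr_ge0//.
- exact: measurable_fdot.
- exact: measurable_fdot.
- by move=> A mA; exact: lu.
- by move=> A mA; exact: ld.
Qed.

End std_gauss.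

(** * Concentration of the norm of a Gaussian vector *)

Section chi_tail.
Context {R : realType}.

Lemma integral_same_law d1 (T1 : measurableType d1) (P1 : probability T1 R)
    d2 (T2 : measurableType d2) (P2 : probability T2 R)
    (X1 : T1 -> R) (X2 : T2 -> R) (f : R -> \bar R) :
  measurable_fun setT X1 -> measurable_fun setT X2 ->
  (forall B, measurable B -> P1 (X1 @^-1` B) = P2 (X2 @^-1` B)) ->
  measurable_fun setT f -> (forall x, 0 <= f x)%E ->
  (\int[P1]_w f (X1 w) = \int[P2]_w f (X2 w))%E.
Proof.
move=> mX1 mX2 lX mf f0.
have m1 : @measurable_fun _ _ T1 (measurableTypeR R) setT X1 by exact: mX1.
have m2 : @measurable_fun _ _ T2 (measurableTypeR R) setT X2 by exact: mX2.
have := @ge0_integral_pushforward _ _ T1 (measurableTypeR R) R X1 m1 P1 setT f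
  measurableT.
rewrite preimage_setT => <-//.
have := @ge0_integral_pushforward _ _ T2 (measurableTypeR R) R X2 m2 P2 setT f
  measurableT.
rewrite preimage_setT => <-//.
by apply: eq_measure_integral => A mA _; exact: lX.
Qed.

(** The integrand times the standard density is [u] times the density of [N(0, u^2)], where
    [u = (1 - 2 s)^(-1/2)]. *)
Lemma integral_expR_normal_prob (s : R) : s < 2^-1 ->
  (\int[normal_prob 0 1]_x (expR (s * x ^+ 2))%:E =
   ((Num.sqrt (1 - 2 * s))^-1)%:E)%E.
Proof.
move=> s1; have h0 : 0 < 1 - 2 * s by lra.
set u := (Num.sqrt (1 - 2 * s))^-1.
have u0 : 0 < u by rewrite invr_gt0 sqrtr_gt0.
have u2 : u ^+ 2 = (1 - 2 * s)^-1 by rewrite exprVn sqr_sqrtr// ltW.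
rewrite integral_normal_prob; last 2 first.
- apply/measurable_EFinP; apply: measurableT_comp => //.
  by apply: measurable_funM => //; exact: exprn_measurable.
- by move=> x; rewrite lee_fin expR_ge0.
transitivity (\int[@lebesgue_measure R]_x (u%:E * (normal_pdf 0 u x)%:E))%E.
  apply: eq_integral => x _; rewrite -!EFinM; congr (_%:E).
  have peakE : Num.sqrt (u ^+ 2 * pi *+ 2) = u * Num.sqrt (1 ^+ 2 * pi *+ 2).
    rewrite expr1n mul1r -mulrnAr sqrtrM ?sqr_ge0// sqrtr_sqr gtr0_norm//.
  rewrite !normal_pdfE ?gt_eqF// /normal_peak /normal_fun peakE u2 subr0.
  rewrite [LHS]mulrCA -expRD [RHS]mulrA; congr (_ * _).
    by rewrite invfM mulrA divff ?mul1r// gt_eqF.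
  congr expR; rewrite expr1n; field.
  by rewrite gt_eqF.
rewrite ge0_integralZl//.
- by rewrite integral_normal_pdf mule1.
- by apply/measurable_EFinP; exact: measurable_normal_pdf.
- by move=> x _; rewrite lee_fin normal_pdf_ge0.
- by rewrite lee_fin ltW.
Qed.

Lemma measurable_mx_fdot d (T : measurableType d) m n (A B : T -> 'M[R]_(m, n)) :
  measurable_mx A -> measurable_mx B ->
  measurable_fun setT (fun w => fdot (A w) (B w)).
Proof.
move=> mA mB; under eq_fun do rewrite fdotE.
apply: measurable_sum => i; apply: measurable_sum => j.
exact: measurable_funM.
Qed.

(** Induction on the dimension: the first coordinate and the rest are drawn on the two factors of a
    product, where the exponential factorises. *)
Lemma chi_square_mgf q d (T : measurableType d) (P : probability T R)
    (G : T -> 'cV[R]_q) (s : R) : s < 2^-1 -> std_gauss P G ->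
  (\int[P]_w (expR (s * fdot (G w) (G w)))%:E =
   ((Num.sqrt (1 - 2 * s))^-1 ^+ q)%:E)%E.
Proof.
move=> s1; elim: q d T P G => [|q ih] d T P G sG.
  under eq_integral do rewrite fdotE big_ord0 mulr0 expR0.
  rewrite (@integral_cst _ _ _ P setT measurableT) expr0 mul1e. exact: probability_setT.
pose G2 (w : T * T) : 'M[R]_(1 + q, 1) :=
  col_mx (@usubmx _ 1 q 1 (G w.1)) (@dsubmx _ 1 q 1 (G w.2)).
have sG2 : std_gauss (P \x P)%E G2 by exact: (@std_gauss_split R _ _ P 1 q 1 G).
have sU := @std_gauss_usub R _ _ P 1 q 1 G sG.
have sD := @std_gauss_dsub R _ _ P 1 q 1 G sG.
have mexp : measurable_fun setT (fun x : R => (expR (s * x))%:E).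
  by apply/measurable_EFinP; apply: measurableT_comp => //; exact: measurable_funM.
have -> : (\int[P]_w (expR (s * fdot (G w) (G w)))%:E =
    \int[P \x P]_w (expR (s * fdot (G2 w) (G2 w)))%:E)%E.
  apply: (@integral_same_law _ _ P _ _ (P \x P)%E (fun w => fdot (G w) (G w))
    (fun w => fdot (G2 w) (G2 w)) (fun x => (expR (s * x))%:E)) => //.
  - by apply: measurable_mx_fdot; exact: sG.1.
  - by apply: measurable_mx_fdot; exact: sG2.1.
  - move=> B mB; apply: (std_gauss_law (B := [set M | B (fdot M M)]) sG sG2).
    move=> d' T' H mH; rewrite -[X in measurable X]setTI.
    exact: (measurable_mx_fdot mH mH).
pose f w : \bar R := (expR (s * fdot (@usubmx _ 1 q 1 (G w)) (@usubmx _ 1 q 1 (G w))))%:E.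
pose g w : \bar R := (expR (s * fdot (@dsubmx _ 1 q 1 (G w)) (@dsubmx _ 1 q 1 (G w))))%:E.
have mf : measurable_fun setT f.
  by apply: (measurableT_comp mexp); apply: measurable_mx_fdot; exact: sU.1.
have mg : measurable_fun setT g.
  by apply: (measurableT_comp mexp); apply: measurable_mx_fdot; exact: sD.1.
under eq_integral do rewrite /G2 fdot_col_mx mulrDr expRD EFinM.
rewrite fubini_tonelli1/=; last 2 first.
- apply: emeasurable_funM; first exact: (measurableT_comp mf).
  exact: (measurableT_comp mg).
- by move=> w; rewrite -EFinM lee_fin mulr_ge0// expR_ge0.
transitivity (\int[P]_w (f w * ((Num.sqrt (1 - 2 * s))^-1 ^+ q)%:E))%E.
  apply: eq_integral => w _; rewrite /fubini_F/= ge0_integralZl//.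
  by rewrite (ih _ _ _ _ sD).
have f0 w : setT w -> (0 <= f w)%E by rewrite lee_fin expR_ge0.
have k0 : (0 <= ((Num.sqrt (1 - 2 * s))^-1 ^+ q)%:E)%E.
  by rewrite lee_fin exprn_ge0// invr_ge0 sqrtr_ge0.
rewrite (ge0_integralZr P measurableT mf f0 k0).
rewrite exprS EFinM; congr (_ * _)%E.
rewrite -integral_expR_normal_prob//.
rewrite -(@integral_law _ _ _ P (fun w => fdot (const_mx 1) (@usubmx _ 1 q 1 (G w)))
  (normal_prob 0 1) (fun x => (expR (s * x ^+ 2))%:E)).
- apply: eq_integral => w _; rewrite /f !fdotE !big_ord1.
  by rewrite [const_mx 1 0 0]mxE mul1r expr2.
- by apply: measurable_fdot; exact: sU.1.
- move=> B mB; rewrite [LHS]sU.2// fdotE !big_ord1 mxE mulr1 sqrtr1.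
  by rewrite /normal_law oner_eq0.
- apply/measurable_EFinP; apply: measurableT_comp => //.
  by apply: measurable_funM => //; exact: exprn_measurable.
- by move=> x; rewrite lee_fin expR_ge0.
Qed.

Lemma chernoff d (T : measurableType d) (P : probability T R) (Z : T -> R) a :
  measurable_fun setT Z ->
  (P [set w | (a <= Z w)%R] <= (expR (- a))%:E * \int[P]_w (expR (Z w))%:E)%E.
Proof.
move=> mZ; have mA : measurable [set w | a <= Z w].
  have := mZ measurableT `[a, +oo[%classic (measurable_itv _).
  by rewrite setTI; congr measurable; apply/seteqP; split => w /=;
    rewrite in_itv/= andbT.
have mexp : measurable_fun setT (fun w => (expR (Z w))%:E).
  by apply/measurable_EFinP; apply: measurableT_comp.
rewrite -[X in P X]setIT -(@integral_indic _ _ R P setT measurableT)//.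
rewrite -ge0_integralZl//.
apply: ge0_le_integral => //.
- by apply/measurable_EFinP; exact: measurable_indic.
- by apply: emeasurable_funM.
- move=> w _; rewrite -EFinM lee_fin -expRD indicE.
  have [|] := boolP (w \in [set w | a <= Z w]); rewrite ?expR_ge0//.
  rewrite inE/= => h; rewrite -expR0 ler_expR; lra.
Qed.

(** Chernoff bound at the level [q u^2] with its optimal parameter [s = (1 - u^-2) / 2]. The sign of
    [s] follows that of [u - 1], so one statement covers the upper tail for [u > 1] and the lower
    tail for [u < 1]. The bound [exp (- s q u^2) u^q] is simplified by [u <= exp (u - 1)]. *)
Lemma chi_square_tail q d (T : measurableType d) (P : probability T R)
    (G : T -> 'cV[R]_q) (u : R) : 0 < u -> std_gauss P G ->
  (P [set w | ((1 - u ^- 2) / 2 * (q%:R * u ^+ 2) <=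
      (1 - u ^- 2) / 2 * fdot (G w) (G w))%R] <=
   (expR (- (q%:R * (u - 1) ^+ 2 / 2)))%:E)%E.
Proof.
move=> u0 sG; set s := (1 - u ^- 2) / 2.
have s1 : 1 - 2 * s = u ^- 2 by rewrite /s; field; rewrite gt_eqF.
have s2 : s < 2^-1.
  have h : 0 < u ^- 2 by rewrite invr_gt0 exprn_gt0.
  rewrite /s; lra.
have mZ : measurable_fun setT (fun w => s * fdot (G w) (G w)).
  by apply: measurable_funM => //; apply: measurable_mx_fdot; exact: sG.1.
apply: (le_trans (chernoff P _ mZ)).
rewrite (chi_square_mgf s2 sG) s1 -EFinM lee_fin sqrtrV ?sqr_ge0//.
rewrite sqrtr_sqr gtr0_norm// invrK.
apply: (@le_trans _ _ (expR (- (s * (q%:R * u ^+ 2))) * expR (u - 1) ^+ q)).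
  rewrite ler_wpM2l ?expR_ge0// lerXn2r ?nnegrE ?expR_ge0 ?(ltW u0)//.
  by have := expR_ge1Dx (u - 1); rewrite addrC subrK.
rewrite -expRM_natl -expRD ler_expR le_eqVlt; apply/orP; left; apply/eqP.
by rewrite /s; field; rewrite gt_eqF.
Qed.

Lemma chi_tail q d (T : measurableType d) (P : probability T R)
    (G : T -> 'rV[R]_q) (t : R) : 0 <= t -> std_gauss P G ->
  (P [set w | (t < `|Num.sqrt (fdot (G w) (G w)) - Num.sqrt q%:R|)%R] <=
   (2 * expR (- (t ^+ 2 / 2)))%:E)%E.
Proof.
move=> t0 sG; have sG' := std_gauss_tr sG.
have fE w : fdot (G w)^T (G w)^T = fdot (G w) (G w) by rewrite fdot_tr trmxK.
pose E (u : R) := [set w | ((1 - u ^- 2) / 2 * (q%:R * u ^+ 2) <=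
      (1 - u ^- 2) / 2 * fdot (G w) (G w))%R].
have EP u : 0 < u -> (P (E u) <= (expR (- (q%:R * (u - 1) ^+ 2 / 2)))%:E)%E.
  move=> u0; have := chi_square_tail u0 sG'.
  by congr (_ <= _)%E; congr (P _); apply/seteqP; split => w; rewrite /E/= fE.
have mE u : measurable (E u).
  have mZ : measurable_fun setT (fun w => (1 - u ^- 2) / 2 * fdot (G w) (G w)).
    by apply: measurable_funM => //; apply: measurable_mx_fdot; exact: sG.1.
  have := mZ measurableT `[(1 - u ^- 2) / 2 * (q%:R * u ^+ 2), +oo[%classic (measurable_itv _).
  by rewrite setTI; congr measurable; apply/seteqP; split => w /=;
    rewrite in_itv/= andbT.
have mS : measurable_fun setT (fun w => Num.sqrt (fdot (G w) (G w))).
  apply: (@measurableT_comp _ _ _ _ _ _ (@Num.sqrt R)).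
    by apply: continuous_measurable_fun; exact: sqrt_continuous.
  by apply: measurable_mx_fdot; exact: sG.1.
set B := [set w | _].
have mB : measurable B.
  have mN : measurable_fun setT
     (fun w => `|Num.sqrt (fdot (G w) (G w)) - Num.sqrt q%:R|).
    by apply: measurableT_comp => //; exact: measurable_funB.
  have := mN measurableT `]t, +oo[%classic (measurable_itv _).
  by rewrite setTI; congr measurable; apply/seteqP; split => w /=;
    rewrite in_itv/= andbT.
have [q0|q0] := posnP q.
  suff -> : B = set0 by rewrite measure0 lee_fin mulr_ge0// expR_ge0.
  apply/seteqP; split => w //=; rewrite /B/=.
  suff -> : fdot (G w) (G w) = 0 by rewrite q0 subrr normr0 ltNge t0.
  rewrite fdotE big1// => i _; rewrite big1// => j _; exfalso.
  by move: j; rewrite q0 => -[].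
have sq : 0 < Num.sqrt (q%:R : R) by rewrite sqrtr_gt0 ltr0n.
have sqq : Num.sqrt (q%:R : R) ^+ 2 = q%:R by rewrite sqr_sqrtr.
(* Deviations by [t] are the levels [u = 1 + b] and [u = 1 - b], and then [q (u - 1)^2 = t^2]. *)
pose b := t / Num.sqrt q%:R.
have b0 : 0 <= b by rewrite divr_ge0// ltW.
have qb : q%:R * b ^+ 2 = t ^+ 2.
  by rewrite /b expr_div_n sqq mulrCA divff ?mulr1// pnatr_eq0 -lt0n.
have bound u : 0 < u -> (u - 1) ^+ 2 = b ^+ 2 ->
    (P (E u) <= (expR (- (t ^+ 2 / 2)))%:E)%E.
  by move=> u0 ub; rewrite (le_trans (EP _ u0))// ub qb.
have up w : Num.sqrt q%:R + t < Num.sqrt (fdot (G w) (G w)) -> E (1 + b) w.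
  move=> h; rewrite /E/= ler_wpM2l//.
    rewrite divr_ge0// subr_ge0 invf_le1 ?exprn_gt0//; last by lra.
    by rewrite exprn_ege1//; lra.
  rewrite -[leRHS]sqr_sqrtr ?fdot_ge0// -sqq -exprMn ler_sqr ?nnegrE ?sqrtr_ge0//.
    rewrite mulrDr mulr1 /b mulrCA divff ?mulr1 ?gt_eqF//; exact: ltW.
  by rewrite mulr_ge0 ?sqrtr_ge0//; lra.
have lo w : Num.sqrt (fdot (G w) (G w)) < Num.sqrt q%:R - t ->
    0 < 1 - b /\ E (1 - b) w.
  move=> h; have b1 : 0 < 1 - b.
    rewrite subr_gt0 /b ltr_pdivrMr// mul1r -subr_gt0.
    by apply: le_lt_trans h; rewrite sqrtr_ge0.
  split => //; rewrite /E/= ler_wnM2l//.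
    rewrite pmulr_lle0// subr_le0 invf_ge1 ?exprn_gt0//.
    by rewrite exprn_ile1//; lra.
  rewrite -[leLHS]sqr_sqrtr ?fdot_ge0// -sqq -exprMn ler_sqr ?nnegrE ?sqrtr_ge0//.
    rewrite mulrBr mulr1 /b mulrCA divff ?mulr1 ?gt_eqF//; exact: ltW.
  by rewrite mulr_ge0 ?sqrtr_ge0// ltW.
have b10 : 0 < 1 + b by lra.
(* If [b >= 1], a deviation downwards by more than [t] would make the norm negative, and the upper
   tail alone remains. *)
have [b1|b1] := ltrP 0 (1 - b).
  apply: (@le_trans _ _ (P (E (1 + b) `|` E (1 - b)))).
    rewrite le_measure ?inE//; first exact: measurableU.
    move=> w; rewrite /B/= ltr_normr => /orP[h|h].
      by left; apply: up; lra.
    by right; apply: (lo w _).2; lra.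
  apply: (le_trans (measureU2 _ _ _)) => //.
  rewrite mulr_natl mulr2n EFinD leeD//; apply: bound => //; ring.
apply: (@le_trans _ _ (P (E (1 + b)))).
  rewrite le_measure ?inE//.
  move=> w; rewrite /B/= ltr_normr => /orP[h|h].
    by apply: up; lra.
  by have [|h1 _] := lo w; lra.
apply: (le_trans (bound _ _ _)) => //; first by ring.
by rewrite lee_fin; have := expR_ge0 (- (t ^+ 2 / 2)); lra.
Qed.

End chi_tail.

(** * Householder bidiagonalisation *)

Section householder.
Context {R : realType}.

Definition e0row n : 'rV[R]_n := \row_j ((j : nat) == 0%N)%:R.

Definition hhvec n (g : 'rV[R]_n) : 'rV[R]_n :=
  g - Num.sqrt (fdot g g) *: e0row n.

(* The Householder reflection taking [g] to a multiple of the first basis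
   vector; division by 0 makes it the identity when [hhvec g = 0]. *)
Definition householder n (g : 'rV[R]_n) : 'M[R]_n :=
  1%:M - (2 / fdot (hhvec g) (hhvec g)) *: ((hhvec g)^T *m hhvec g).

Lemma rV_mul_tr n (u v : 'rV[R]_n) : u *m v^T = (fdot u v)%:M.
Proof.
by rewrite [LHS]mx11_scalar fdotE big_ord1 mxE; congr _%:M; apply: eq_bigr => j _; rewrite mxE.
Qed.

Lemma fdot_eq0 m n (U : 'M[R]_(m, n)) : fdot U U = 0 -> U = 0.
Proof.
rewrite fdotE => /eqP; rewrite psumr_eq0; last first.
  by move=> i _; apply: sumr_ge0 => j _; rewrite -expr2 sqr_ge0.
move=> /allP h; apply/matrixP => i j; rewrite mxE; apply/eqP.
have /= := h i (mem_index_enum _); rewrite psumr_eq0; last first.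
  by move=> k _; rewrite -expr2 sqr_ge0.
move=> /allP /(_ j (mem_index_enum _)) /=.
by rewrite -expr2 sqrf_eq0.
Qed.

Lemma fdot_e0row n : (0 < n)%N -> fdot (e0row n) (e0row n) = 1.
Proof.
case: n => // n _; rewrite fdotE big_ord1 (bigD1 ord0)//= !mxE mulr1 big1 ?addr0// => j j0.
by rewrite mxE; case: eqP => [j0'|]; [case/eqP: j0; apply/val_inj|rewrite mulr0].
Qed.

Lemma tr_householder n (g : 'rV[R]_n) : (householder g)^T = householder g.
Proof.
by rewrite /householder linearB/= trmx1 linearZ/= trmx_mul trmxK.
Qed.

Lemma householderK n (g : 'rV[R]_n) : householder g *m (householder g)^T = 1%:M.
Proof.
rewrite tr_householder /householder; set u := hhvec g; set c := 2 / _.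
have [u0|u0] := eqVneq (fdot u u) 0.
  by rewrite /c u0 invr0 mulr0 scale0r subr0 mulmx1.
have NN : (u^T *m u) *m (u^T *m u) = fdot u u *: (u^T *m u).
  by rewrite mulmxA -(mulmxA u^T) rV_mul_tr mul_mx_scalar -scalemxAl.
move: (u^T *m u) NN => N NN.
rewrite mulmxBr mulmx1 mulmxBl mul1mx -scalemxAl -scalemxAr NN !scalerA.
have -> : c * c * fdot u u = c + c by rewrite /c; field.
by rewrite scalerDl opprB addrK subrK.
Qed.

Lemma mul_householder n (g : 'rV[R]_n) :
  g *m householder g = Num.sqrt (fdot g g) *: e0row n.
Proof.
case: n g => [|n] g; first by rewrite !(thinmx0 (_ *m _)) (thinmx0 (_ *: _)).
set r := Num.sqrt _; set u := hhvec g.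
have r2 : r ^+ 2 = fdot g g by rewrite sqr_sqrtr// fdot_ge0.
have ee := fdot_e0row (ltn0Sn n).
have hu V : fdot u V = fdot g V - r * fdot (e0row n.+1) V.
  by rewrite /u /hhvec -scaleNr fdotDl fdotZl mulNr.
(* [g] and [r e0] have the same norm, hence [|u|^2 = 2 <g, u>] and the reflection subtracts exactly
   [u] from [g]. *)
have uu : fdot u u = 2 * fdot g u.
  by rewrite hu (fdotC g u) (fdotC (e0row _) u) !hu -r2 ee (fdotC g (e0row _)); ring.
rewrite /householder -/u mulmxBr mulmx1 -scalemxAr mulmxA rV_mul_tr mul_scalar_mx scalerA.
have [u0|u0] := eqVneq (fdot u u) 0.
  have u00 : u = 0 by exact: fdot_eq0.
  by rewrite u00 scaler0 subr0; apply/eqP; rewrite -subr_eq0; apply/eqP.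
have -> : 2 / fdot u u * fdot g u = 1 by rewrite uu; field; move: u0; rewrite uu mulf_eq0 negb_or => /andP[].
by rewrite scale1r /u /hhvec opprB addrC subrK.
Qed.

Lemma measurable_householder d (T : measurableType d) n (G : T -> 'rV[R]_n) :
  measurable_mx G -> measurable_mx (fun w => householder (G w)).
Proof.
move=> mG.
have mS : measurable_fun setT (fun w => Num.sqrt (fdot (G w) (G w))).
  apply: (@measurableT_comp _ _ _ _ _ _ (@Num.sqrt R)).
    by apply: continuous_measurable_fun; exact: sqrt_continuous.
  exact: measurable_mx_fdot.
have mu : measurable_mx (fun w => hhvec (G w)).
  move=> i j; under eq_fun do rewrite !mxE.
  apply: measurable_funB; first exact: mG.
  by apply: measurable_funM => //; exact: measurable_cst.
have mf : measurable_fun setT (fun w => fdot (hhvec (G w)) (hhvec (G w))).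
  exact: measurable_mx_fdot.
have mc : measurable_fun setT (fun w => 2 / fdot (hhvec (G w)) (hhvec (G w))).
  apply: measurable_funM; first exact: measurable_cst.
  (* The inverse is written as a power with exponent -1; this agrees with the inverse on all
     nonnegative reals, including the value 0 at 0. *)
  under eq_fun do rewrite -powR_inv1 ?fdot_ge0//.
  by apply: (@measurableT_comp _ _ _ _ _ _ (@powR R ^~ (-1))) => //; exact: measurable_powR.
move=> i j; under eq_fun do rewrite !mxE.
apply: measurable_funB; first exact: measurable_cst.
apply: measurable_funM => //; apply: measurable_sum => k.
by under eq_fun do rewrite mxE; apply: measurable_funM; exact: mu.
Qed.

End householder.

Section bidiagonalisation.
Context {R : realType}.

(* One step of the alternating row/column Householder reduction removes the
   first row; [bad t] holds if some removed row has a norm that deviates by more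
   than [t] from the square root of its length. *)
Fixpoint bad (t : R) (k m n : nat) : 'M[R]_(m, n) -> Prop :=
  match k with
  | 0 => fun=> False
  | k'.+1 =>
    match m return 'M[R]_(m, n) -> Prop with
    | 0 => fun=> False
    | m'.+1 => fun G =>
      let g := @usubmx _ 1 m' n G in
      t < `|Num.sqrt (fdot g g) - Num.sqrt n%:R| \/
      bad t k' (@dsubmx _ 1 m' n G *m householder g)^T
    end
  end.

Lemma measurable_bad t k m n : measurable_mx_set (@bad t k m n).
Proof.
elim: k m n => [|k ih] [|m] n d T G mG /=.
- by rewrite [X in measurable X](_ : _ = set0).
- by rewrite [X in measurable X](_ : _ = set0).
- by rewrite [X in measurable X](_ : _ = set0).
have mg := @measurable_mx_usub _ _ _ 1 m n G mG.
have mS : measurable_fun setT (fun w =>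
    Num.sqrt (fdot (@usubmx _ 1 m n (G w)) (@usubmx _ 1 m n (G w)))).
  apply: (@measurableT_comp _ _ _ _ _ _ (@Num.sqrt R)).
    by apply: continuous_measurable_fun; exact: sqrt_continuous.
  exact: measurable_mx_fdot.
apply: measurableU.
  have mN : measurable_fun setT (fun w =>
      `|Num.sqrt (fdot (@usubmx _ 1 m n (G w)) (@usubmx _ 1 m n (G w))) - Num.sqrt n%:R|).
    by apply: measurableT_comp => //; exact: measurable_funB.
  have := mN measurableT `]t, +oo[%classic (measurable_itv _).
  by rewrite setTI; congr measurable; apply/seteqP; split => w /=;
    rewrite in_itv/= andbT.
apply: ih; apply: measurable_mx_tr; apply: measurable_mxM.
  exact: (@measurable_mx_dsub _ _ _ 1 m n G mG).
exact: measurable_householder.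
Qed.

(** By [std_gauss_law] the first row and the other rows may be drawn from the two factors of a
    product. For a fixed first factor the reflection is a constant orthogonal matrix, so the section
    of the remaining event is the same kind of event for a standard Gaussian matrix with one row
    fewer, transposed. The induction hypothesis bounds every section uniformly. *)
Lemma bad_prob t k m n d (T : measurableType d) (P : probability T R)
    (G : T -> 'M[R]_(m, n)) : 0 <= t -> std_gauss P G ->
  (P [set w | bad t k (G w)] <= (k%:R * (2 * expR (- (t ^+ 2 / 2))))%:E)%E.
Proof.
move=> t0; set e := 2 * _; have e0 : 0 <= e by rewrite mulr_ge0// expR_ge0.
elim: k m n d T P G => [|k ih] [|m] n d T P G sG.
- by rewrite [X in P X](_ : _ = set0)// measure0 lee_fin mulr_ge0.
- by rewrite [X in P X](_ : _ = set0)// measure0 lee_fin mulr_ge0.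
- by rewrite [X in P X](_ : _ = set0)// measure0 lee_fin mulr_ge0.
pose G2 (w : T * T) : 'M[R]_(1 + m, n) :=
  col_mx (@usubmx _ 1 m n (G w.1)) (@dsubmx _ 1 m n (G w.2)).
have sG2 : std_gauss (P \x P)%E G2 by exact: (@std_gauss_split R _ _ P 1 m n G).
have sU := @std_gauss_usub R _ _ P 1 m n G sG.
have sD := @std_gauss_dsub R _ _ P 1 m n G sG.
have -> : P [set w | bad t k.+1 (G w)] = (P \x P)%E [set w | bad t k.+1 (G2 w)].
  exact: (std_gauss_law sG sG2 (@measurable_bad t k.+1 (1 + m) n)).
pose g w := @usubmx _ 1 m n (G w).
pose A := [set w | t < `|Num.sqrt (fdot (g w) (g w)) - Num.sqrt n%:R|].
pose B := [set w : T * T |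
  bad t k (@dsubmx _ 1 m n (G w.2) *m householder (g w.1))^T].
have mB : measurable B.
  apply: (@measurable_bad t k n m _ _
    (fun w : T * T => (@dsubmx _ 1 m n (G w.2) *m householder (g w.1))^T)).
  apply/measurable_mx_tr/measurable_mxM.
    exact: (@measurable_mx_comp _ _ _ _ _ _ _ (fun w => @dsubmx _ 1 m n (G w)) snd sD.1).
  apply: (@measurable_mx_comp _ _ _ _ _ _ _ (fun w => householder (g w)) fst) => //.
  by apply: measurable_householder; exact: sU.1.
have mS : measurable_fun setT (fun w => Num.sqrt (fdot (g w) (g w))).
  apply: (@measurableT_comp _ _ _ _ _ _ (@Num.sqrt R)).
    by apply: continuous_measurable_fun; exact: sqrt_continuous.
  by apply: measurable_mx_fdot; exact: sU.1.
have mA : measurable A.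
  have mN : measurable_fun setT (fun w => `|Num.sqrt (fdot (g w) (g w)) - Num.sqrt n%:R|).
    by apply: measurableT_comp => //; exact: measurable_funB.
  have := mN measurableT `]t, +oo[%classic (measurable_itv _).
  by rewrite setTI; congr measurable; apply/seteqP; split => w /=;
    rewrite in_itv/= andbT.
have mAT : measurable (A `*` [set: T]) by exact: measurableX.
have -> : [set w | bad t k.+1 (G2 w)] = (A `*` [set: T]) `|` B.
  apply/seteqP; split => -[w1 w2]; rewrite /G2 /=.
    by rewrite col_mxKu col_mxKd => -[h|h]; [left|right].
  by rewrite col_mxKu col_mxKd => -[[h _]|h]; [left|right].
apply: (le_trans (measureU2 _ mAT mB)).
rewrite -natr1 mulrDl mul1r addrC EFinD leeD//; last first.
  have pA := product_measure1E P P mA measurableT.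
  apply: (le_trans _ (chi_tail t0 sU)).
  rewrite le_eqVlt; apply/orP; left; apply/eqP.
  apply: (eq_trans pA); rewrite -[RHS]mule1; congr (_ * _)%E.
  exact: probability_setT.
rewrite /product_measure1.
apply: (@le_trans _ _ (\int[P]_w (k%:R * e)%:E)%E); last first.
  rewrite (@integral_cst _ _ _ P setT measurableT).
  rewrite [X in (_ * X)%E](_ : _ = 1%E) ?mule1//.
  exact: probability_setT.
apply: ge0_le_integral => //.
- exact: measurable_fun_xsection.
- move=> w _ /=.
  have -> : xsection B w = [set w' | bad t k (@dsubmx _ 1 m n (G w') *m householder (g w))^T].
    by apply/seteqP; split => w'; rewrite /xsection /= inE.
  apply: ih; apply: std_gauss_tr; apply: std_gauss_mulr => //.
  exact: householderK.
Qed.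

(** A single sequence holds both diagonals, even indices for the diagonal and odd ones for the
    subdiagonal. This is the order in which the reduction produces the entries, so one step prepends
    one term. *)
Definition bidiag m n (a : nat -> R) : 'M[R]_(m, n) :=
  \matrix_(i, j) if (i : nat) == j then a i.*2 else
    if (i : nat) == j.+1 then a j.*2.+1 else 0.

(** The remainder is transposed before the recursive call: the two orthogonal factors exchange
    roles, and the diagonal of the remainder becomes the subdiagonal. The clause on [e0row] drives
    the induction. The inner factor [U'^T] multiplies on the right the first row, which is already a
    multiple of [e0row], and must not disturb it; the new left factor is a block matrix with a
    leading 1 and so fixes [e0row] again. *)
Lemma bidiagonalise t k m n (G : 'M[R]_(m, n)) : (m + n <= k)%N ->
  ~ bad t k G ->
  exists (U : 'M[R]_m) (V : 'M[R]_n) (a : nat -> R),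
  [/\ U *m U^T = 1%:M, V *m V^T = 1%:M, e0row m *m U = e0row m /\ e0row m *m U^T = e0row m,
    U *m G *m V = bidiag m n a &
    (forall i, (i < m)%N -> (i < n)%N ->
      `|a i.*2 - Num.sqrt (n - i)%:R| <= t) /\
    (forall i, (i.+1 < m)%N -> (i < n)%N ->
      `|a i.*2.+1 - Num.sqrt (m - i.+1)%:R| <= t)].
Proof.
elim: k m n G => [|k ih] [|m] n G mnk nbad.
- exists 1%:M, 1%:M, (fun=> 0); split; rewrite ?trmx1 ?mulmx1//.
  by apply/matrixP => -[].
- by rewrite addSn in mnk.
- exists 1%:M, 1%:M, (fun=> 0); split; rewrite ?trmx1 ?mulmx1//.
  by apply/matrixP => -[].
set g := @usubmx _ 1 m n G; set D := @dsubmx _ 1 m n G.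
have [nb1 nb2] : `|Num.sqrt (fdot g g) - Num.sqrt n%:R| <= t /\
    ~ bad t k (D *m householder g)^T.
  split; last by move=> h; apply: nbad; right.
  by rewrite leNgt; apply/negP => h; apply: nbad; left.
have [|U' [V' [a' [UU VV [eU eUT] UGV [b1 b2]]]]] := ih _ _ _ _ nb2.
  by move: mnk; rewrite addSn ltnS addnC.
pose r := Num.sqrt (fdot g g).
exists (@block_mx _ 1 m 1 m 1%:M 0 0 V'^T), (householder g *m U'^T),
  (fun n => if n is n'.+1 then a' n' else r).
split.
- rewrite (@tr_block_mx _ 1 m 1 m) (@mulmx_block _ 1 m 1 m 1 m) !trmx1 !trmx0 !mulmx0 !mul0mx mulmx1.
  by rewrite !addr0 !add0r trmxK (mulmx1C VV) -scalar_mx_block.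
- rewrite trmx_mul trmxK mulmxA -(mulmxA _ U'^T) (mulmx1C UU) mulmx1.
  exact: householderK.
- have e0E : e0row (1 + m) = @row_mx R 1 1 m 1%:M 0.
    apply/rowP => j; rewrite !mxE; case: splitP => k' jk; rewrite !mxE jk.
      by rewrite !ord1.
    by rewrite add1n.
  rewrite -[m.+1]/(1 + m)%N e0E (@tr_block_mx _ 1 m 1 m) !(@mul_row_block _ 1 1 m 1 m).
  by rewrite !trmx0 trmx1 !mulmx0 !mul0mx mulmx1 !addr0.
- rewrite -{1}(@vsubmxK _ 1 m n G) -/g -/D (@mul_block_col _ 1 m 1 m n).
  rewrite mul1mx !mul0mx addr0 add0r (@mul_col_mx _ 1 m n n).
  rewrite !mulmxA mul_householder -scalemxAl eUT.
  have -> : V'^T *m D *m householder g *m U'^T = (bidiag n m a')^T.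
    by rewrite -UGV !trmx_mul trmxK !mulmxA !tr_householder.
  apply/matrixP => i j; case: (@split_ordP 1 m i) => i' ->.
    apply: (eq_trans (@col_mxEu R 1 m n _ _ i' j)); rewrite !mxE !ord1 /=; by case: (nat_of_ord j) => [|j1]; rewrite ?mulr1 ?mulr0.
  apply: (eq_trans (@col_mxEd R 1 m n _ _ i' j)); rewrite !mxE /= add1n eqSS (eq_sym (j : nat) i').
  have [->|ij] := eqVneq (i' : nat) j; first by rewrite gtn_eqF.
  by rewrite [(j : nat) == _]eq_sym; case: eqP => // <-.
- split => -[|i] im iN.
  + by rewrite subn0.
  + exact: b2.
  + by rewrite subSS; apply: b1 => //; rewrite -ltnS.
  + by rewrite subSS; apply: b1 => //; rewrite -ltnS.
Qed.

End bidiagonalisation.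

(** * Jacobi forms *)

Section jacobi.
Context {R : realType}.
Implicit Types (z a b : nat -> R) (lam s delta kappa rho h tau : R).

Definition spike lam (j : nat) : R := if j == 0%N then Num.sqrt (1 + lam) else 1.

(* [Bid^T D z] has [j]-th entry [a_j d_j z_j + b_j z_(j+1)], where [a], [b] are
   the diagonal and the subdiagonal of [Bid] and [D] is diagonal with entries [d]. *)
Definition jacobi_form (n p : nat) lam a b z : R :=
  \sum_(j < p) (if (j < n)%N then (a j * (spike lam j * z j) + b j * z j.+1) ^+ 2
                else 0).

Definition sqnorm (p : nat) z : R := \sum_(j < p) z j ^+ 2.

Definition spike_sqnorm (p : nat) lam z : R :=
  \sum_(j < p) (spike lam j * z j) ^+ 2.

Lemma spike_sqr lam j : 0 <= lam ->
  spike lam j ^+ 2 = if j == 0%N then 1 + lam else 1.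
Proof.
by move=> l0; rewrite /spike; case: ifP => _; rewrite ?expr1n// sqr_sqrtr//; lra.
Qed.

Lemma sqnorm_ge0 p z : 0 <= sqnorm p z.
Proof. by apply: sumr_ge0 => j _; rewrite sqr_ge0. Qed.

(** Regrouping by [Z]: the coefficient of [Z j.+1] is [c j.+1 + e j]. The boundary term at the end
    vanishes in the applications, where the sequence is zero at [p]. *)
Lemma sum_shift_le (c e Z : nat -> R) h k : (forall j, 0 <= Z j) -> c 0%N <= h ->
  (forall j, (j < k)%N -> c j.+1 + e j <= h) ->
  \sum_(j < k.+1) (c j * Z j + e j * Z j.+1) <=
  h * \sum_(j < k.+1) Z j + e k * Z k.+1.
Proof.
move=> Z0 c0; elim: k => [|k ih] ce.
  by rewrite !big_ord1 lerD2r ler_wpM2r.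
rewrite big_ord_recr [X in _ <= h * X + _]big_ord_recr/=.
have h1 := ih (fun j jk => ce j (ltnW jk)).
have h2 : (c k.+1 + e k) * Z k.+1 <= h * Z k.+1 by rewrite ler_wpM2r// ce.
by move: h1 h2; rewrite mulrDr mulrDl; lra.
Qed.

(** This controls one summand of the form: [y] is the unperturbed entry, [e] its perturbation, [A]
    and [B] are the two neighbouring coordinates. The difference is [e (2 y + e)], and AM-GM removes
    the mixed terms. *)
Lemma sqr_perturb (A B y e s tau : R) : 0 <= tau -> 0 <= s ->
  `|e| <= tau * (`|A| + `|B|) -> `|y| <= `|A| + s * `|B| ->
  `|(y + e) ^+ 2 - y ^+ 2| <=
  tau * ((4 + 2 * tau) * A ^+ 2 + (2 + 2 * tau) * (1 + s ^+ 2) * B ^+ 2).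
Proof.
move=> t0 s0 he hy.
have -> : (y + e) ^+ 2 - y ^+ 2 = e * (2 * y + e) by ring.
rewrite -(real_normK (num_real A)) -(real_normK (num_real B)) normrM.
have := normr_ge0 A; have := normr_ge0 B.
move: `|A| `|B| he hy => {}A {}B he hy B0 A0.
have h2 : `|2 * y + e| <= 2 * (A + s * B) + tau * (A + B).
  apply: (le_trans (ler_normD _ _)); apply: lerD => //.
  by rewrite normrM ger0_norm// ler_pM2l.
apply: (@le_trans _ _ (tau * (A + B) * (2 * (A + s * B) + tau * (A + B)))).
  by apply: ler_pM.
rewrite -mulrA ler_wpM2l//.
have ab : 2 * (A * B) <= A ^+ 2 + B ^+ 2.
  by rewrite -subr_ge0 (_ : _ - _ = (A - B) ^+ 2) ?sqr_ge0//; ring.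
have sab : 2 * (s * (A * B)) <= A ^+ 2 + s ^+ 2 * B ^+ 2.
  by rewrite -subr_ge0 (_ : _ - _ = (A - s * B) ^+ 2) ?sqr_ge0//; ring.
have sb : 2 * s * B ^+ 2 <= (1 + s ^+ 2) * B ^+ 2.
  rewrite ler_wpM2r ?sqr_ge0// -subr_ge0 (_ : _ - _ = (1 - s) ^+ 2) ?sqr_ge0//.
  by ring.
have tab := ler_wpM2l t0 ab.
have ts : 0 <= tau * s ^+ 2 * B ^+ 2 by rewrite !mulr_ge0// sqr_ge0.
have sB : 0 <= s ^+ 2 * B ^+ 2 by rewrite mulr_ge0// sqr_ge0.
have B2 : 0 <= B ^+ 2 by rewrite sqr_ge0.
have A2 : 0 <= A ^+ 2 by rewrite sqr_ge0.
nra.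
Qed.

Lemma sum_shift_sqr (p : nat) z : z p = 0 ->
  \sum_(j < p) z j.+1 ^+ 2 <= \sum_(j < p) z j ^+ 2.
Proof.
case: p => [|p] zp; first by rewrite !big_ord0.
rewrite big_ord_recr/= zp expr0n/= addr0 [leRHS]big_ord_recl/=.
by rewrite lerDr sqr_ge0.
Qed.

Lemma spike_sqnorm_le p lam z : 0 <= lam ->
  spike_sqnorm p lam z <= (1 + lam) * sqnorm p z.
Proof.
move=> l0; rewrite /spike_sqnorm /sqnorm mulr_sumr; apply: ler_sum => j _.
rewrite exprMn spike_sqr// ler_wpM2r ?sqr_ge0//; case: ifP => _; lra.
Qed.

Lemma jacobi_form_perturb n p lam s tau a b a' b' z :
  0 <= lam -> 0 <= s -> 0 <= tau -> z p = 0 ->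
  (forall j, (j < n)%N -> (j < p)%N -> 0 <= a j <= 1 /\ `|a' j - a j| <= tau) ->
  (forall j, (j < n)%N -> (j.+1 < p)%N -> 0 <= b j <= s /\ `|b' j - b j| <= tau) ->
  `|jacobi_form n p lam a' b' z - jacobi_form n p lam a b z| <=
  tau * (8 + 4 * tau) * (1 + lam + s ^+ 2) * sqnorm p z.
Proof.
move=> l0 s0 t0 zp ha hb.
rewrite /jacobi_form -sumrB (le_trans (ler_norm_sum _ _ _))//.
apply: (@le_trans _ _ (\sum_(j < p) tau * ((4 + 2 * tau) * (spike lam j * z j) ^+ 2 +
   (2 + 2 * tau) * (1 + s ^+ 2) * z j.+1 ^+ 2))).
  apply: ler_sum => j _; case: ifP => jn; last first.
    rewrite subrr normr0 mulr_ge0// addr_ge0// mulr_ge0 ?sqr_ge0//; first by lra.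
    by rewrite mulr_ge0 ?addr_ge0 ?sqr_ge0 ?mulr_ge0.
  have [/andP[a0 a1] aa] := ha j jn (ltn_ord j).
  set A := spike lam j * z j; set B := z j.+1.
  have [jp|jp] := ltnP j.+1 p.
    have [/andP[b0 b1] bb] := hb j jn jp.
    have -> : a' j * A + b' j * B =
        (a j * A + b j * B) + ((a' j - a j) * A + (b' j - b j) * B) by ring.
    apply: sqr_perturb => //.
      rewrite (le_trans (ler_normD _ _))// !normrM mulrDr.
      by rewrite lerD// ler_wpM2r.
    rewrite (le_trans (ler_normD _ _))// !normrM [`|a j|]ger0_norm//.
    rewrite [`|b j|]ger0_norm// lerD//.
      by rewrite -[leRHS]mul1r ler_wpM2r.
    by rewrite ler_wpM2r.
  (* No bound is assumed for the last subdiagonal entry; it multiplies [z p = 0]. *)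
  have B0 : B = 0.
    by rewrite /B; have -> : j.+1 = p by apply/eqP; rewrite eqn_leq jp ltn_ord.
  have -> : a' j * A + b' j * B = (a j * A + b j * B) + (a' j - a j) * A.
    by rewrite B0; ring.
  apply: sqr_perturb => //.
    by rewrite normrM B0 normr0 addr0 ler_wpM2r.
  rewrite B0 normr0 !mulr0 !addr0 normrM [`|a j|]ger0_norm//.
  by rewrite -[leRHS]mul1r ler_wpM2r.
rewrite -mulr_sumr big_split/= -!mulr_sumr -!mulrA ler_wpM2l// mulrA.
have h1 := spike_sqnorm_le p z l0.
have h2 := sum_shift_sqr zp.
rewrite -/(spike_sqnorm p lam z); rewrite -/(sqnorm p z) in h2.
move: (spike_sqnorm p lam z) (\sum_(j < p) z j.+1 ^+ 2) (sqnorm p z)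
  (sqnorm_ge0 p z) h1 h2 => A B N N0 h1 h2.
have s2 : 0 <= s ^+ 2 by rewrite sqr_ge0.
have k1 : (4 + 2 * tau) * A <= (4 + 2 * tau) * ((1 + lam) * N).
  by rewrite ler_wpM2l//; lra.
have k2 : (2 + 2 * tau) * ((1 + s ^+ 2) * B) <= (2 + 2 * tau) * ((1 + s ^+ 2) * N).
  by rewrite ler_wpM2l ?ler_wpM2l//; lra.
apply: (@le_trans _ _ ((4 + 2 * tau) * ((1 + lam) * N) +
    (2 + 2 * tau) * ((1 + s ^+ 2) * N))).
  apply: le_trans (lerD k1 k2); rewrite le_eqVlt; apply/orP; left; apply/eqP.
  ring.
rewrite -subr_ge0.
have -> : (8 + 4 * tau) * ((1 + lam + s ^+ 2) * N) -
  ((4 + 2 * tau) * ((1 + lam) * N) + (2 + 2 * tau) * ((1 + s ^+ 2) * N)) =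
  (2 + (4 + 2 * tau) * lam + (6 + 2 * tau) * s ^+ 2) * N by ring.
by rewrite mulr_ge0// !addr_ge0// mulr_ge0//; lra.
Qed.

(* AM-GM with the weights that make the eigenvector of the half-infinite
   constant-coefficient matrix an equality case. *)
Lemma jacobi_form_upper n p lam s kappa rho h a b z :
  0 <= lam -> 0 <= s -> 0 <= kappa -> kappa <= 1 -> 0 < rho -> z p = 0 -> (0 < p)%N ->
  (forall j, (j < n)%N -> (j < p)%N -> 0 <= a j <= 1) ->
  (forall j, (j < n)%N -> (j.+1 < p)%N -> 0 <= b j <= s) ->
  h = 1 - kappa + s ^+ 2 + s * (rho + rho^-1) ->
  (1 + lam) * (1 - kappa + s * rho) <= h ->
  jacobi_form n p lam a b z - kappa * spike_sqnorm p lam z <= h * sqnorm p z.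
Proof.
move=> l0 s0 k0 k1 r0 zp p0 ha hb hE hb0.
(* [c] and [e] are the coefficients of [z_j^2] and [z_(j+1)^2] after AM-GM. For every index but the
   first they add up to exactly [h]; the first index leaves the inequality that involves [lam]. *)
pose c j := (spike lam j) ^+ 2 * (1 - kappa + s * rho).
pose e := fun _ : nat => s ^+ 2 + s * rho^-1.
have e0 j : 0 <= e j by rewrite addr_ge0 ?sqr_ge0// mulr_ge0// invr_ge0 ltW.
apply: (@le_trans _ _ (\sum_(j < p) (c j * z j ^+ 2 + e j * z j.+1 ^+ 2))).
  rewrite /jacobi_form /spike_sqnorm mulr_sumr -sumrB; apply: ler_sum => j _.
  rewrite /c /e; set D := spike lam j; set A := z j; set B := z j.+1.
  have D0 : 0 <= D by rewrite /D /spike; case: ifP => // _; rewrite sqrtr_ge0.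
  have zz0 : 0 <= D ^+ 2 * A ^+ 2 by rewrite mulr_ge0// sqr_ge0.
  have tt : 0 <= s * rho * (D ^+ 2 * A ^+ 2) by rewrite mulr_ge0// mulr_ge0// ltW.
  have BB : 0 <= (s ^+ 2 + s * rho^-1) * B ^+ 2.
    by rewrite mulr_ge0 ?sqr_ge0//; exact: (e0 0%N).
  case: ifP => jn; last by nra.
  have /andP[a0 a1] := ha j jn (ltn_ord j).
  (* AM-GM: [2 s |D A B| <= s rho D^2 A^2 + s B^2 / rho] *)
  have amgm : 2 * s * (`|D * A| * `|B|) <=
      s * rho * (D ^+ 2 * A ^+ 2) + s * rho^-1 * B ^+ 2.
    rewrite -exprMn -(real_normK (num_real (D * A))) -(real_normK (num_real B)).
    rewrite -subr_ge0.
    have -> : s * rho * `|D * A| ^+ 2 + s * rho^-1 * `|B| ^+ 2 -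
      2 * s * (`|D * A| * `|B|) = s * rho^-1 * (rho * `|D * A| - `|B|) ^+ 2.
      by field; rewrite gt_eqF.
    by rewrite mulr_ge0 ?sqr_ge0// mulr_ge0// invr_ge0 ltW.
  have b2 : exists2 b', 0 <= b' <= s & b j * B = b' * B.
    have [jp|jp] := ltnP j.+1 p; first by exists (b j) => //; exact: hb.
    exists 0; first by rewrite lexx.
    rewrite /B; have -> : j.+1 = p by apply/eqP; rewrite eqn_leq jp ltn_ord.
    by rewrite zp !mulr0.
  have [b' /andP[b0 b1] ->] := b2.
  have : (a j * (D * A) + b' * B) ^+ 2 <= (`|D * A| + s * `|B|) ^+ 2.
    rewrite -[leLHS]real_normK ?num_real// ler_sqr ?nnegrE ?addr_ge0 ?mulr_ge0//.
    rewrite (le_trans (ler_normD _ _))// !normrM [`|a j|]ger0_norm// [`|b'|]ger0_norm//.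
    rewrite lerD//; last by rewrite ler_wpM2r.
    by rewrite -[leRHS]mul1r ler_wpM2r ?mulr_ge0.
  have -> : (`|D * A| + s * `|B|) ^+ 2 =
      D ^+ 2 * A ^+ 2 + 2 * s * (`|D * A| * `|B|) + s ^+ 2 * B ^+ 2.
    by rewrite -exprMn -(real_normK (num_real (D * A))) -(real_normK (num_real B)); ring.
  rewrite [(D * A) ^+ 2]exprMn => H; lra.
case: p zp p0 {ha hb} => // p zp _.
have := @sum_shift_le c e (fun j => z j ^+ 2) h p.
rewrite zp expr0n/= mulr0 addr0; apply.
- by move=> j; rewrite sqr_ge0.
- by rewrite /c spike_sqr.
- by move=> j _; rewrite /c /e spike_sqr//= hE; lra.
Qed.

End jacobi.

(** * The deterministic form and its lower bound *)

Section ideal_jacobi.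
Context {R : realType}.
Implicit Types (z : nat -> R) (lam s kappa rho r h : R).

Definition adiag (n : nat) (j : nat) : R := Num.sqrt ((n - j)%:R / n%:R).

Definition asub (n p : nat) (j : nat) : R := Num.sqrt ((p - j.+1)%:R / n%:R).

Lemma adiag_sqr n j : (0 < n)%N -> (j <= n)%N ->
  adiag n j ^+ 2 = 1 - j%:R / n%:R.
Proof.
move=> n0 jn; rewrite sqr_sqrtr ?divr_ge0// natrB// mulrBl divff//.
by rewrite pnatr_eq0 -lt0n.
Qed.

Lemma asub_sqr n p j : (j < p)%N ->
  asub n p j ^+ 2 = p%:R / n%:R - j%:R / n%:R - n%:R^-1.
Proof.
move=> jp; rewrite sqr_sqrtr ?divr_ge0// natrB// -natr1; ring.
Qed.

Lemma adiag01 n j : (0 < n)%N -> 0 <= adiag n j <= 1.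
Proof.
move=> n0; rewrite sqrtr_ge0/= -[leRHS]sqrtr1 ler_sqrt// ler_pdivrMr ?ltr0n// mul1r.
by rewrite ler_nat leq_subr.
Qed.

Lemma asub_le n p j : 0 <= asub n p j <= Num.sqrt (p%:R / n%:R).
Proof.
rewrite sqrtr_ge0/= ler_sqrt ?divr_ge0// ler_wpM2r ?invr_ge0//.
by rewrite ler_nat leq_subr.
Qed.

(** With [u = j / n], the difference [(s - u)^2 - (1 - u) (s^2 - u - 1 / n)] equals
    [u (1 - s)^2 + (1 - u) / n]. The right-hand side is nonnegative since [u] is at most 1 and at
    most [s^2]. *)
Lemma adiag_asub_le n p j : (0 < n)%N -> (j < n)%N -> (j < p)%N ->
  0 <= Num.sqrt (p%:R / n%:R) - j%:R / n%:R :> R /\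
  adiag n j * asub n p j <= Num.sqrt (p%:R / n%:R) - j%:R / n%:R :> R.
Proof.
move=> n0 jn jp; set s := Num.sqrt _; set u := j%:R / n%:R.
have s0 : 0 <= s by rewrite sqrtr_ge0.
have s2 : s ^+ 2 = p%:R / n%:R by rewrite sqr_sqrtr// divr_ge0.
have nr : 0 < n%:R :> R by rewrite ltr0n.
have u0 : 0 <= u by rewrite divr_ge0.
have u1 : u <= 1 by rewrite ler_pdivrMr// mul1r ler_nat ltnW.
have us : u <= s ^+ 2 by rewrite s2 ler_wpM2r ?invr_ge0// ler_nat ltnW.
have su : 0 <= s - u by case: (lerP 1 s) => h; [lra|nra].
split => //.
have [/andP[a0 _] /andP[b0 _]] := (@adiag01 n j n0, asub_le n p j).
rewrite -ler_sqr ?nnegrE ?mulr_ge0// exprMn adiag_sqr ?(ltnW jn)// asub_sqr// -s2 -/u.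
have : 0 <= n%:R^-1 :> R by rewrite invr_ge0.
move: (n%:R^-1) => v v0; have : 0 <= (1 - u) * v by rewrite mulr_ge0 ?subr_ge0.
have : 0 <= u * (1 - s) ^+ 2 by rewrite mulr_ge0 ?sqr_ge0.
by move=> *; lra.
Qed.

(** The decay of the entries lowers the diagonal terms, which is harmful here, and lowers the mixed
    terms, which is helpful. With [u j = j / n], the squared diagonal entry is [1 - u j], while the
    product of the two entries is at most [s - u j]. After AM-GM with weight [r] the coefficients of
    an interior index add up to at most [- h + r^-1 / n], because the terms in [u] combine to
    [- u (r + r^-1 - 2)]. The bound on [r^-1] turns the excess into the stated error. *)
Lemma jacobi_form_lower n p lam r h z : (0 < n)%N -> (0 < p)%N -> z p = 0 ->
  0 <= lam -> 0 < r -> let s : R := Num.sqrt (p%:R / n%:R) in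
  h = s ^+ 2 - s * (r + r^-1) -> (1 + lam) * (s * r) <= - h ->
  (1 <= s -> h <= -1) -> r^-1 <= 1 + lam + s ->
  (h - 2 * (1 + lam + s ^+ 2) / n%:R) * sqnorm p z <=
  jacobi_form n p lam (adiag n) (asub n p) z - spike_sqnorm p lam z.
Proof.
move=> n0 p0 zp l0 r0 s hE hb hs rs.
have s0 : 0 <= s by rewrite sqrtr_ge0.
have s2 : s ^+ 2 = p%:R / n%:R by rewrite sqr_sqrtr// divr_ge0.
have nr : 0 < n%:R :> R by rewrite ltr0n.
pose v : R := n%:R^-1; have v0 : 0 < v by rewrite invr_gt0.
pose u (j : nat) : R := j%:R / n%:R.
have uS j : u j.+1 = u j + v by rewrite /u -natr1 mulrDl mul1r.
have u_ge0 j : 0 <= u j by rewrite divr_ge0.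
pose c j := if (j < n)%N then spike lam j ^+ 2 * (u j + (s - u j) * r)
  else spike lam j ^+ 2.
pose e j := if (j < n)%N then (s - u j) * r^-1 - (s ^+ 2 - u j - v) else 0.
pose g := - h + v * r^-1.
have ri : 0 < r^-1 by rewrite invr_gt0.
have rr : r * r^-1 = 1 by rewrite divff// gt_eqF.
have r2 : 2 <= r + r^-1.
  rewrite -subr_ge0 (_ : _ - _ = r^-1 * (r - 1) ^+ 2); last by field; rewrite gt_eqF.
  by rewrite mulr_ge0 ?sqr_ge0// ltW.
have vr : 0 <= v * r^-1 by rewrite mulr_ge0// ltW.
have main : spike_sqnorm p lam z - jacobi_form n p lam (adiag n) (asub n p) z <=
    g * sqnorm p z.
  apply: (@le_trans _ _ (\sum_(j < p) (c j * z j ^+ 2 + e j * z j.+1 ^+ 2))).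
    rewrite /spike_sqnorm /jacobi_form -sumrB; apply: ler_sum => j _.
    rewrite /c /e; set D := spike lam j; set A := z j; set B := z j.+1.
    case: ifP => jn; last by rewrite subr0 mul0r addr0 exprMn.
    have [su ab] := adiag_asub_le n0 jn (ltn_ord j); rewrite -/s -/(u j) in su ab.
    have a2 := @adiag_sqr n j n0 (ltnW jn); rewrite -/(u j) in a2.
    have b2 := @asub_sqr n p j (ltn_ord j); rewrite -s2 -/(u j) -/v in b2.
    have [/andP[a0 _] /andP[b0 _]] := (@adiag01 n j n0, asub_le n p j).
    have amgm : 2 * (s - u j) * `|D * A * B| <=
        (s - u j) * r * (D ^+ 2 * A ^+ 2) + (s - u j) * r^-1 * B ^+ 2.
      rewrite normrM -exprMn -(real_normK (num_real (D * A))) -(real_normK (num_real B)).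
      rewrite -subr_ge0.
      have -> : (s - u j) * r * `|D * A| ^+ 2 + (s - u j) * r^-1 * `|B| ^+ 2 -
        2 * (s - u j) * (`|D * A| * `|B|) = (s - u j) * r^-1 * (r * `|D * A| - `|B|) ^+ 2.
        by field; rewrite gt_eqF.
      by rewrite mulr_ge0 ?sqr_ge0// mulr_ge0// ltW.
    have ab' : 2 * (adiag n j * asub n p j) * `|D * A * B| <=
        2 * (s - u j) * `|D * A * B|.
      by rewrite ler_wpM2r// ler_pM2l.
    have ab2 : - (2 * (adiag n j * asub n p j) * `|D * A * B|) <=
        2 * (adiag n j * asub n p j) * (D * A * B).
      rewrite -mulrN ler_wpM2l ?mulr_ge0//.
      by rewrite lerNl (le_trans (ler_norm _))// normrN.
    have -> : (adiag n j * (D * A) + asub n p j * B) ^+ 2 =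
        adiag n j ^+ 2 * (D ^+ 2 * A ^+ 2) +
        2 * (adiag n j * asub n p j) * (D * A * B) + asub n p j ^+ 2 * B ^+ 2 by ring.
    rewrite a2 b2 [(D * A) ^+ 2]exprMn.
    by move: ab2 ab' amgm; lra.
  have := @sum_shift_le R c e (fun j => z j ^+ 2) g p.-1.
  rewrite prednK// zp expr0n/= mulr0 addr0; apply.
  - by move=> j; rewrite sqr_ge0.
  - by rewrite /c n0 spike_sqr//= /u mul0r subr0 add0r /g; lra.
  - move=> j; rewrite ltn_predRL => jp; rewrite /c /e spike_sqr//=.
    have [jn|jn] := ltnP j.+1 n.
      rewrite (ltnW jn) uS /g hE.
      have : 0 <= u j.+1 * (r + r^-1 - 2) by rewrite mulr_ge0// subr_ge0.
      by rewrite uS; lra.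
    (* An index at or beyond [n] exists only if [p > n]. The form has no summand there, so the whole
       coefficient 1 of the population form has to be covered by [- h]; just before, at index
       [n - 1], the mixed term still contributes. *)
    have s1 : 1 <= s.
      rewrite -[leLHS]sqrtr1 ler_sqrt ?divr_ge0// ler_pdivlMr// mul1r ler_nat.
      exact: leq_trans jn (ltnW jp).
    have [jn'|jn'] := ltnP j n; last by have := hs s1; rewrite addr0 /g; lra.
    have -> : u j = 1 - v.
      have := uS j; have -> : j.+1 = n by apply/eqP; rewrite eqn_leq jn jn'.
      by rewrite /u divff ?gt_eqF//; lra.
    rewrite /g hE.
    have : 0 <= (s - 1) * r by rewrite mulr_ge0 ?subr_ge0// ltW.
    by lra.
have N0 := sqnorm_ge0 p z.
have : v * r^-1 * sqnorm p z <= 2 * (1 + lam + s ^+ 2) / n%:R * sqnorm p z.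
  rewrite ler_wpM2r// -/v [leRHS]mulrC ler_pM2l//.
  have : 0 <= (s - 1) ^+ 2 by rewrite sqr_ge0.
  by have := sqr_ge0 s; lra.
move: main; rewrite /g; lra.
Qed.

End ideal_jacobi.

(** * Nearly optimal test vectors *)

Section test_vector.
Context {R : realType}.
Implicit Types (lam kappa sg rho h K theta : R).

Lemma sum_ord_trunc (f : nat -> R) (m p : nat) : (m <= p)%N ->
  (forall j, (m <= j)%N -> f j = 0) -> \sum_(j < p) f j = \sum_(j < m) f j.
Proof.
move=> mp f0; rewrite -(subnKC mp) big_split_ord/= [X in _ + X]big1 ?addr0//.
by move=> j _; rewrite f0// leq_addr.
Qed.

Lemma sqr_diff_le (a b s x rho theta : R) : 0 <= s -> 0 <= rho ->
  1 - theta <= a <= 1 -> 0 <= a -> 0 <= b -> s - theta <= b <= s ->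
  `|x| <= rho ->
  `|(a + x * b) ^+ 2 - (1 + x * s) ^+ 2| <=
  ((1 - a) + rho * theta) * (2 * (1 + s * rho)).
Proof.
move=> s0 r0 /andP[a1 a2] a0 b0 /andP[b1 b2] xr.
have -> : (a + x * b) ^+ 2 - (1 + x * s) ^+ 2 =
  - ((1 - a) + x * (s - b)) * (a + x * b + 1 + x * s) by ring.
rewrite normrM normrN ler_pM//.
  rewrite (le_trans (ler_normD _ _))// [`|1 - a|]ger0_norm ?subr_ge0// lerD2l.
  by rewrite normrM ler_pM// ger0_norm ?subr_ge0//; lra.
rewrite -[a + x * b + 1 + x * s]addrA (le_trans (ler_normD _ _))//.
have h (k m : R) : 0 <= k -> k <= 1 -> 0 <= m -> m <= s ->
    `|k + x * m| <= 1 + s * rho.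
  move=> k0 k1 m0 ms; rewrite (le_trans (ler_normD _ _))// normrM [`|k|]ger0_norm// [`|m|]ger0_norm//.
  by rewrite lerD// mulrC ler_pM.
by rewrite mulr_natl mulr2n lerD// h.
Qed.

(** [b] is the defect of the eigenvalue equation in the first row. For an outlier it vanishes; on a
    plateau, [rho = 1], it is a bounded defect in one row, small relative to a squared norm of order
    [L]. The hypothesis with [K] limits the error in the first row, which carries the factor
    [1 + lam]. *)
Lemma jacobi_form_test n p L lam kappa sg rho h K theta :
  (0 < n)%N -> (0 < p)%N -> 0 <= lam -> 0 <= kappa <= 1 -> sg ^+ 2 = 1 ->
  0 < rho <= 1 -> let s : R := Num.sqrt (p%:R / n%:R) in
  h = 1 - kappa + s ^+ 2 + sg * s * (rho + rho^-1) ->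
  let b := (1 + lam) * (1 - kappa + sg * (s * rho)) - h in
  b = 0 \/ rho = 1 -> `|b| <= s * (1 + s) ->
  (1 + lam) * rho * (1 + s * rho) <= K * (1 + lam + s ^+ 2) ->
  (0 < L)%N -> (L <= n)%N -> L%:R / n%:R <= theta ^+ 2 -> 0 <= theta <= 1 ->
  L%:R^-1 <= 2 * theta ->
  exists z : nat -> R, [/\ z p = 0, 0 < sqnorm p z &
    `|jacobi_form n p lam (adiag n) (asub n p) z - kappa * spike_sqnorm p lam z
      - h * sqnorm p z| <=
    (2 * K + 12) * theta * (1 + lam + s ^+ 2) * sqnorm p z].
Proof.
move=> n0 p0 l0 /andP[k0 k1] sg2 /andP[r0 r1] s hE b hb b1 hK L0 Ln Lt /andP[t0 t1] Li.
have s0 : 0 <= s by rewrite sqrtr_ge0.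
have s2 : s ^+ 2 = p%:R / n%:R by rewrite sqr_sqrtr// divr_ge0.
have nr : 0 < n%:R :> R by rewrite ltr0n.
have ss : 2 * s <= 1 + s ^+ 2.
  by rewrite -subr_ge0 (_ : _ - _ = (1 - s) ^+ 2) ?sqr_ge0//; ring.
have sgn : `|sg| = 1.
  by apply/eqP; rewrite -sqrp_eq1// real_normK ?num_real// sg2.
have s20 : 0 <= s ^+ 2 by rewrite sqr_ge0.
have K0 : 0 <= K.
  have : 0 <= K * (1 + lam + s ^+ 2).
    apply: le_trans hK; apply: mulr_ge0; last by rewrite addr_ge0// mulr_ge0// ltW.
    by rewrite mulr_ge0 ?(ltW r0)//; lra.
  by rewrite pmulr_lge0//; lra.
have adiag0 : adiag n 0 = 1 :> R.
  by rewrite /adiag subn0 divff ?sqrtr1// gt_eqF.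
(* If [p <= L] the support does not fit, but then [s <= theta]: the off-diagonal part is negligible
   and the first basis vector suffices. *)
have [pL|Lp] := leqP p L.
  pose z (j : nat) : R := (j == 0%N)%:R; exists z.
  have N1 : sqnorm p z = 1.
    rewrite /sqnorm (sum_ord_trunc (m := 1) (f := fun j => z j ^+ 2))//; last first.
      by move=> [|j] //= _; rewrite /z/= expr0n.
    by rewrite big_ord1 expr1n.
  split; [by case: p p0 {s hE b hb b1 hK s0 s2 ss s20 pL N1}|by rewrite N1|].
  have -> : jacobi_form n p lam (adiag n) (asub n p) z = 1 + lam.
    rewrite /jacobi_form (sum_ord_trunc (m := 1) (f := fun j : nat => if (j < n)%N then
      (adiag n j * (spike lam j * z j) + asub n p j * z j.+1) ^+ 2 else 0))//; last first.
      by move=> [|j] //= _; case: ifP; rewrite /z//= !mulr0 addr0 expr0n.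
    rewrite big_ord1 n0 /z/= mulr0 addr0 mulr1 adiag0 mul1r spike_sqr//=.
  have -> : spike_sqnorm p lam z = 1 + lam.
    rewrite /spike_sqnorm (sum_ord_trunc (m := 1) (f := fun j : nat => (spike lam j * z j) ^+ 2))//.
      by rewrite big_ord1 mulr1 spike_sqr.
    by move=> [|j] //= _; rewrite mulr0 expr0n.
  rewrite N1 !mulr1.
  have st : s <= theta.
    rewrite -ler_sqr ?nnegrE// s2; apply: le_trans Lt.
    by rewrite ler_wpM2r ?invr_ge0 ?ler_nat// ltW.
  have -> : 1 + lam - kappa * (1 + lam) - h = b - sg * ((1 + lam) * (rho * s)).
    by rewrite /b; ring.
  rewrite (le_trans (ler_normB _ _))//.
  have e1 : `|sg * ((1 + lam) * (rho * s))| <= (1 + lam) * theta.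
    rewrite normrM sgn mul1r ger0_norm.
      rewrite ler_wpM2l//; first lra.
      by rewrite -[leRHS]mul1r ler_pM// ltW.
    by rewrite mulr_ge0// ?mulr_ge0 ?(ltW r0)//; lra.
  have e2 : `|b| <= theta * (1 + s).
    by apply: (le_trans b1); rewrite ler_wpM2r//; lra.
  have e3 : 0 <= theta * (2 * K) * (1 + lam + s ^+ 2).
    by rewrite !mulr_ge0//; lra.
  have e4 : 0 <= theta * s ^+ 2 by rewrite mulr_ge0.
  have e5 : theta * (2 * s) <= theta * (1 + s ^+ 2) by rewrite ler_wpM2l.
  have e6 : 0 <= theta * lam by rewrite mulr_ge0.
  by lra.
pose w := Num.sqrt (1 + lam); have w2 : w ^+ 2 = 1 + lam by rewrite sqr_sqrtr//; lra.
pose y (j : nat) : R := w * (sg * rho) ^+ j.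
have yS j : y j.+1 = sg * rho * y j by rewrite /y exprS; ring.
have y2 j : y j ^+ 2 = (1 + lam) * (rho ^+ 2) ^+ j.
  by rewrite exprMn w2 [in LHS]exprAC [(sg * rho) ^+ 2]exprMn sg2 mul1r.
have q01 : 0 <= rho ^+ 2 <= 1.
  by rewrite sqr_ge0/= exprn_ile1// ltW.
(* The geometric sequence is prescribed after multiplication by the spike, so the first entry of [z]
   is 1 while [y 0] is [sqrt (1 + lam)]. *)
pose z (j : nat) := if (j <= L)%N then (if j == 0%N then 1 else y j) else 0.
have wz j : (j <= L)%N -> spike lam j * z j = y j.
  move=> jL; rewrite /z /spike jL; case: j {jL} => [|j] /=; last by rewrite mul1r.
  by rewrite /y expr0.
have z0 j : (L.+1 <= j)%N -> z j = 0 by move=> jL; rewrite /z leqNgt jL.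
exists z.
pose Y := \sum_(j < L) y j ^+ 2.
have NE : sqnorm p z = 1 + rho ^+ 2 * Y.
  rewrite /sqnorm (sum_ord_trunc (m := L.+1) (f := fun j => z j ^+ 2))//; last first.
    by move=> j jL; rewrite z0// expr0n.
  rewrite big_ord_recl/= {1}/z/= expr1n mulr_sumr; congr (_ + _).
  apply: eq_bigr => j _; rewrite /z /= /bump/= add1n ltn_ord/=.
  by rewrite !y2 exprS mulrCA.
have Y0 : 0 <= Y by apply: sumr_ge0 => j _; rewrite sqr_ge0.
have N1 : 1 <= sqnorm p z.
  by rewrite NE lerDl mulr_ge0//; case/andP: q01.
have DE : spike_sqnorm p lam z = Y + y L ^+ 2.
  rewrite /spike_sqnorm (sum_ord_trunc (m := L.+1) (f := fun j => (spike lam j * z j) ^+ 2))//.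
    by rewrite big_ord_recr/= wz//; congr (_ + _); apply: eq_bigr => j _; rewrite wz// ltnW.
  by move=> j jL; rewrite z0// mulr0 expr0n.
have geomE : (1 - rho ^+ 2) * Y = (1 + lam) - y L ^+ 2.
  rewrite /Y y2; elim: (L) => [|m ih]; first by rewrite big_ord0 expr0; ring.
  by rewrite big_ord_recr/= mulrDr ih y2 [_ ^+ m.+1]exprS; ring.
(* [y_j^2] is nonincreasing and the squared norm contains [y_1^2, ..., y_L^2], so the cut-off costs
   a share of at most [1 / L]. *)
have yL : L%:R * y L ^+ 2 <= sqnorm p z.
  rewrite NE -[leLHS]add0r lerD// mulr_sumr mulr_natl -[X in _ *+ X]card_ord -sumr_const.
  apply: ler_sum => j _; rewrite !y2 mulrCA ler_wpM2l//; first lra.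
  rewrite -exprS; case/andP: q01 => q0 q1.
  by rewrite ler_wiXn2l.
have yLn : y L ^+ 2 <= 2 * theta * sqnorm p z.
  have Lr : 0 < L%:R :> R by rewrite ltr0n.
  apply: (@le_trans _ _ (L%:R^-1 * sqnorm p z)); last by rewrite ler_wpM2r ?sqnorm_ge0.
  by rewrite -ler_pdivrMl ?invr_gt0// invrK.
have bn : `|b| <= s * (1 + s) * (2 * theta * sqnorm p z).
  case: hb => [->|re]; first by rewrite normr0 !mulr_ge0// ?sqnorm_ge0//; lra.
  (* On a plateau [y L ^+ 2 = 1 + lam >= 1], so the truncation bound [2 theta N] is itself at least
     1 and absorbs the defect. *)
  apply: (le_trans b1); rewrite -[leLHS]mulr1 ler_wpM2l ?mulr_ge0//; first lra.
  apply: le_trans yLn; rewrite y2 re expr1n expr1n mulr1; lra.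
(* At the last index of the support the subdiagonal term is absent, and for [L = n] the whole
   summand is. *)
pose tL := if (L < n)%N then (adiag n L * y L) ^+ 2 else 0.
have tL01 : 0 <= tL <= y L ^+ 2.
  rewrite /tL; case: ifP => _; rewrite ?lexx ?sqr_ge0//=.
  have /andP[h0 h1] := @adiag01 R n L n0.
  by rewrite exprMn ler_piMl ?sqr_ge0// exprn_ile1.
pose x := sg * rho.
pose F (j : nat) := (adiag n j + x * asub n p j) ^+ 2 - (1 + x * s) ^+ 2.
have QE : jacobi_form n p lam (adiag n) (asub n p) z =
    \sum_(j < L) y j ^+ 2 * F j + (1 + x * s) ^+ 2 * Y + tL.
  rewrite /jacobi_form (sum_ord_trunc (m := L.+1) (f := fun j : nat => if (j < n)%N then
      (adiag n j * (spike lam j * z j) + asub n p j * z j.+1) ^+ 2 else 0))//; last first.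
    by move=> j jL; rewrite !z0 ?(leqW jL)// !mulr0 addr0 expr0n/= if_same.
  rewrite big_ord_recr/= (z0 L.+1)// wz// mulr0 addr0; congr (_ + _).
  rewrite mulr_sumr -big_split/=; apply: eq_bigr => j _.
  rewrite (leq_trans (ltn_ord j) Ln) wz ?(ltnW (ltn_ord j))//.
  have -> : z j.+1 = y j.+1 by rewrite /z ltn_ord.
  by rewrite yS /F -/x; ring.
have xr : `|x| <= rho by rewrite normrM sgn mul1r gtr0_norm.
have u_le (j : nat) : (j <= L)%N -> j%:R / n%:R <= theta ^+ 2.
  by move=> jL; apply: le_trans Lt; rewrite ler_wpM2r ?invr_ge0 ?ler_nat// ltW.
have ha j : (j < L)%N -> 1 - theta <= @adiag R n j <= 1.
  move=> jL; have /andP[h0 h1] := @adiag01 R n j n0.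
  apply/andP; split; last exact: h1.
  rewrite -ler_sqr ?nnegrE ?subr_ge0// adiag_sqr//; last exact: leq_trans (ltnW jL) Ln.
  have := u_le j (ltnW jL); have : theta ^+ 2 <= theta by rewrite expr2 ler_piMl.
  by lra.
(* From [s^2 - (j + 1) / n >= s^2 - theta^2] one gets only [s - theta] after the square root: this
   is why [theta] and not [theta^2] is the size of the error. *)
have hbs j : (j < L)%N -> s - theta <= @asub R n p j <= s.
  move=> jL; have /andP[h0 h1] := @asub_le R n p j.
  apply/andP; split; last exact: h1.
  have [st|st] := lerP s theta; first by lra.
  rewrite -ler_sqr ?nnegrE ?subr_ge0 ?(ltW st)// asub_sqr//; last exact: ltn_trans Lp.
  rewrite -s2; have := u_le j.+1 jL; rewrite -natr1 mulrDl mul1r.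
  have : theta * theta <= s * theta by rewrite ler_wpM2r// ltW.
  by lra.
have Fj j : (j < L)%N -> `|F j| <= ((1 - adiag n j) + rho * theta) * (2 * (1 + s * rho)).
  move=> jL; apply: sqr_diff_le; rewrite ?ha ?hbs//; first exact: ltW.
    by case/andP: (@adiag01 R n j n0).
  by case/andP: (@asub_le R n p j).
have sr : s * rho <= s by rewrite ler_piMr.
have FS : `|\sum_(j < L) y j ^+ 2 * F j| <=
    2 * theta * (K * (1 + lam + s ^+ 2)) + 4 * theta * (1 + s) * sqnorm p z.
  (* The term [j = 0] has weight [1 + lam], which the squared norm of [z] does not contain; it is
     paid for by [K], using that the first diagonal entry is exactly 1. The other weights sum to at
     most the squared norm. *)
  have [m Lm] : exists m, L = m.+1 by exists L.-1; rewrite prednK.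
  rewrite Lm big_ord_recl/= (le_trans (ler_normD _ _))// lerD//.
    rewrite normrM y2 expr0 mulr1 ger0_norm; last lra.
    apply: (@le_trans _ _ ((1 + lam) * (rho * theta * (2 * (1 + s * rho))))).
      rewrite ler_wpM2l//; first lra.
      by have := Fj 0%N L0; rewrite adiag0 subrr add0r.
    by have := ler_wpM2l t0 hK; lra.
  apply: (le_trans (ler_norm_sum _ _ _)).
  apply: (@le_trans _ _ (\sum_(j < m) 4 * theta * (1 + s) * y j.+1 ^+ 2)).
    apply: ler_sum => j _; rewrite normrM ger0_norm ?sqr_ge0// mulrC.
    rewrite ler_wpM2r ?sqr_ge0//.
    have jL : (bump 0 j < L)%N by rewrite Lm /bump/= add1n ltnS.
    apply: (le_trans (Fj _ jL)); have /andP[h1 h2] := ha _ jL.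
    have h3 : rho * theta <= theta by rewrite ler_piMl.
    have h4 : 0 <= rho * theta by rewrite mulr_ge0// ltW.
    have h5 : 0 <= s * rho by rewrite mulr_ge0// ltW.
    apply: (@le_trans _ _ ((2 * theta) * (2 * (1 + s)))); last by lra.
    by apply: ler_pM; lra.
  rewrite -mulr_sumr ler_wpM2l//; first by rewrite !mulr_ge0//; lra.
  rewrite NE mulr_sumr Lm -[leLHS]add0r lerD//.
  rewrite big_ord_recr/= -[leLHS]addr0 lerD//; last first.
    by rewrite mulr_ge0 ?sqr_ge0.
  by apply: ler_sum => j _; rewrite !y2 [in leLHS]exprS mulrCA.
split; [exact: z0|exact: lt_le_trans N1|].
(* Away from both ends the geometric sequence solves the constant-coefficient equation exactly. What
   survives is the variation [F] of the entries, the defect [b] and the boundary terms at [L]. *)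
have E : jacobi_form n p lam (adiag n) (asub n p) z - kappa * spike_sqnorm p lam z
      - h * sqnorm p z = \sum_(j < L) y j ^+ 2 * F j + b
      - y L ^+ 2 * (1 - kappa + x * s) + (tL - kappa * y L ^+ 2).
  rewrite QE DE NE.
  have YE : rho ^+ 2 * Y = Y - ((1 + lam) - y L ^+ 2) by rewrite -geomE; ring.
  have rhoE : rho^-1 * (rho ^+ 2 * Y) = rho * Y.
    by rewrite mulrA expr2 mulrA mulVf ?mul1r// gt_eqF.
  have hr : h * (rho ^+ 2 * Y) = (1 - kappa + s ^+ 2) * (rho ^+ 2 * Y) +
     sg * s * rho * (rho ^+ 2 * Y) + sg * s * (rho^-1 * (rho ^+ 2 * Y)).
    by rewrite hE; ring.
  have -> : h * (1 + rho ^+ 2 * Y) = h + h * (rho ^+ 2 * Y) by ring.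
  rewrite hr rhoE /b /x.
  have -> : (1 + sg * rho * s) ^+ 2 * Y = Y + 2 * (sg * rho * s) * Y +
      s ^+ 2 * (rho ^+ 2 * Y).
    have -> : s ^+ 2 * (rho ^+ 2 * Y) = sg ^+ 2 * (s ^+ 2 * (rho ^+ 2 * Y)).
      by rewrite sg2 mul1r.
    by ring.
  by rewrite YE; ring.
rewrite E.
have xs : `|1 - kappa + x * s| <= 1 + s.
  rewrite (le_trans (ler_normD _ _))// lerD//; first by rewrite ger0_norm; lra.
  by rewrite normrM [`|s|]ger0_norm// -[leRHS]mul1r ler_wpM2r// (le_trans xr).
have e1 : `|y L ^+ 2 * (1 - kappa + x * s)| <= (1 + s) * (2 * theta * sqnorm p z).
  by rewrite normrM mulrC ler_pM// ger0_norm ?sqr_ge0.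
have e2 : `|tL - kappa * y L ^+ 2| <= 2 * theta * sqnorm p z.
  apply: le_trans yLn; have /andP[h1 h2] := tL01.
  have h3 : 0 <= kappa * y L ^+ 2 by rewrite mulr_ge0 ?sqr_ge0.
  have h4 : kappa * y L ^+ 2 <= y L ^+ 2 by rewrite ler_piMl ?sqr_ge0.
  by rewrite ler_norml; lra.
apply: (le_trans (ler_normD _ _)); rewrite (le_trans (lerD (ler_normB _ _) e2))//.
rewrite -[leLHS]addrA (le_trans (lerD (ler_normD _ _) (lexx _)))//.
move: (sqnorm p z) N1 FS bn e1 => N N1 FS bn e1 {E QE NE DE e2 yLn tL01 geomE yL}.
have tN : 0 <= theta * N by rewrite mulr_ge0//; lra.
have c1 : theta * (K * (1 + lam + s ^+ 2)) <= theta * N * (K * (1 + lam + s ^+ 2)).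
  rewrite ler_wpM2r ?mulr_ge0//; first lra.
  by rewrite ler_peMr.
have c2 : theta * N * (2 * s) <= theta * N * (1 + s ^+ 2) by rewrite ler_wpM2l.
have c3 : 0 <= theta * N * lam by rewrite mulr_ge0.
have c4 : 0 <= theta * N * s ^+ 2 by rewrite mulr_ge0.
lra.
Qed.

End test_vector.

(** * Extremal eigenvalues *)

Section spectral.
Context {R : realType}.

Lemma enormE p (x : 'cV[R]_p) : enorm x = Num.sqrt (fdot x x).
Proof.
rewrite /enorm fdotE; congr Num.sqrt; apply: eq_bigr => i _.
by rewrite big_ord1 expr2.
Qed.

Definition mx_abs_sum m n (A : 'M[R]_(m, n)) : R := \sum_i \sum_j `|A i j|.

Lemma mx_abs_sum_ge0 m n (A : 'M[R]_(m, n)) : 0 <= mx_abs_sum A.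
Proof. by apply: sumr_ge0 => i _; apply: sumr_ge0. Qed.

Lemma fdot_mulE p (A : 'M[R]_p) (x : 'cV[R]_p) :
  fdot x (A *m x) = \sum_i \sum_j A i j * (x i 0 * x j 0).
Proof.
rewrite fdotE; apply: eq_bigr => i _; rewrite big_ord1 mxE mulr_sumr.
by apply: eq_bigr => j _; rewrite mulrCA.
Qed.

Lemma fdot_mul_le p (A : 'M[R]_p) (x : 'cV[R]_p) :
  fdot x (A *m x) <= mx_abs_sum A * fdot x x.
Proof.
rewrite fdot_mulE /mx_abs_sum mulr_suml; apply: ler_sum => i _.
rewrite mulr_suml; apply: ler_sum => j _.
apply: (le_trans (ler_norm _)); rewrite normrM ler_wpM2l//.
have xE : fdot x x = \sum_k x k 0 ^+ 2.
  by rewrite fdotE; apply: eq_bigr => k _; rewrite big_ord1 expr2.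
have le_i k : x k 0 ^+ 2 <= fdot x x.
  by rewrite xE (bigD1 k)//= lerDl; apply: sumr_ge0 => l _; rewrite sqr_ge0.
have := le_i i; have := le_i j.
rewrite normrM -(real_normK (num_real (x i 0))) -(real_normK (num_real (x j 0))).
move: `|x i 0| `|x j 0| (fdot x x) => a b c bc ac.
have := sqr_ge0 (a - b); rewrite sqrrB; lra.
Qed.

Lemma fdot_gt0 m n (U : 'M[R]_(m, n)) : U != 0 -> 0 < fdot U U.
Proof.
move=> U0; rewrite lt_neqAle fdot_ge0 andbT eq_sym.
by apply: contra U0 => /eqP /fdot_eq0 ->.
Qed.

(** The form of [N] is nonnegative at [x - k^-1 N x]; since [k] exceeds the bound for the form of
    [N], this gradient step yields the estimate. *)
Lemma fdotB_psd p (N : 'M[R]_p) (x : 'cV[R]_p) : N^T = N ->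
  (forall y : 'cV[R]_p, 0 <= fdot y (N *m y)) ->
  fdot (N *m x) (N *m x) <= (mx_abs_sum N + 1) * fdot x (N *m x).
Proof.
move=> NT N0; set k := mx_abs_sum N + 1.
have k0 : 0 < k by rewrite ltr_wpDl// mx_abs_sum_ge0.
set y := N *m x.
have h1 := N0 (x + (- k^-1) *: y).
have h2 := fdot_mul_le N y.
have E : fdot (x + (- k^-1) *: y) (N *m (x + (- k^-1) *: y)) =
    fdot x y - 2 * k^-1 * fdot y y + k^-1 * k^-1 * fdot y (N *m y).
  have Dr u c : fdot u (y + c *: (N *m y)) = fdot u y + c * fdot u (N *m y).
    by rewrite fdotC fdotDl fdotZl !(fdotC u).
  rewrite mulmxDr -scalemxAr -/y fdotDl !fdotZl !Dr.
  have -> : fdot x (N *m y) = fdot y y by rewrite fdot_mull NT.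
  by ring.
rewrite E in h1; have := fdot_ge0 y; move: h1 h2.
have -> : mx_abs_sum N = k - 1 by rewrite /k addrK.
have ki : 0 < k^-1 by rewrite invr_gt0.
have kk : k * k^-1 = 1 by rewrite divff// gt_eqF.
move: (fdot y y) (fdot x y) (fdot y (N *m y)) k^-1 ki kk => a b c q q0 kq h1 h2 a0.
have h3 : q * q * c <= q * q * ((k - 1) * a) by rewrite ler_wpM2l// mulr_ge0// ltW.
have h4 : q * q * ((k - 1) * a) = q * a - q * q * a.
  have -> : q * q * ((k - 1) * a) = q * a * (k * q) - q * q * a by ring.
  by rewrite kq mulr1.
have h5 : 0 <= q * q * a by rewrite !mulr_ge0// ltW.
have h6 : q * a <= b by lra.
by have := ler_wpM2l (ltW k0) h6; rewrite mulrA kq mul1r.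
Qed.

(** The supremum [mu] of the Rayleigh quotient is an eigenvalue without any compactness: were
    [mu - A] invertible, its form would dominate a positive multiple of [|x|^2] by [fdotB_psd], and
    [mu] could be lowered. *)
Lemma top_eigenvalue p (A : 'M[R]_p) : (0 < p)%N -> A^T = A ->
  exists2 mu, eigenvalue A mu &
    forall x : 'cV[R]_p, fdot x (A *m x) <= mu * fdot x x.
Proof.
move=> p0 AT.
pose S := [set fdot x (A *m x) | x in [set x : 'cV[R]_p | fdot x x = 1]].
have S_ub : ubound S (mx_abs_sum A).
  by move=> _ [x x1 <-]; have := fdot_mul_le A x; rewrite x1 mulr1.
have S0 : S !=set0.
  pose i0 := Ordinal p0.
  pose e : 'cV[R]_p := delta_mx i0 0.
  exists (fdot e (A *m e)); exists e => //=.
  rewrite fdotE (bigD1 i0)//= big_ord1 mxE !eqxx mulr1 big1 ?addr0// => i ii.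
  by rewrite big_ord1 mxE (negbTE ii) mulr0.
have hS : has_sup S by split => //; exists (mx_abs_sum A).
pose mu := sup S.
have unit_mu (x : 'cV[R]_p) : fdot x x = 1 -> fdot x (A *m x) <= mu.
  by move=> x1; apply: sup_upper_bound => //; exists x.
have mu_ub (x : 'cV[R]_p) : fdot x (A *m x) <= mu * fdot x x.
  have [->|x0] := eqVneq x 0; first by rewrite !fdot0l mulr0.
  have f0 := fdot_gt0 x0; set f := fdot x x in f0 *.
  have s0 : Num.sqrt f != 0 by rewrite gt_eqF// sqrtr_gt0.
  have := unit_mu ((Num.sqrt f)^-1 *: x).
  rewrite -scalemxAr !fdotZl ![fdot x (_ *: _)]fdotC !fdotZl -/f !mulrA -invfM -expr2.
  rewrite sqr_sqrtr ?(ltW f0)// mulVf ?gt_eqF// => /(_ erefl).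
  by rewrite [fdot _ x]fdotC mulrC ler_pdivrMr.
exists mu => //.
pose N := mu%:M - A.
have NT : N^T = N by rewrite linearB/= tr_scalar_mx AT.
have NE (x : 'cV[R]_p) : fdot x (N *m x) = mu * fdot x x - fdot x (A *m x).
  by rewrite mulmxBl mul_scalar_mx fdotC -scaleN1r fdotDl !fdotZl mulN1r [fdot (A *m x) _]fdotC.
have N0 (y : 'cV[R]_p) : 0 <= fdot y (N *m y) by rewrite NE subr_ge0.
have [Nu|Nu] := boolP (N \in unitmx); last first.
  rewrite /eigenvalue /eigenspace kermx_eq0 row_free_unit.
  by rewrite -opprB -/N -scaleN1r unitmxZ// unitrN1.
exfalso.
pose B := (invmx N)^T *m invmx N.
pose k := (mx_abs_sum B + 1) * (mx_abs_sum N + 1).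
have k0 : 0 < k by rewrite mulr_gt0// ltr_wpDl// mx_abs_sum_ge0.
have xk (x : 'cV[R]_p) : fdot x x <= k * fdot x (N *m x).
  have h1 : fdot x x <= mx_abs_sum B * fdot (N *m x) (N *m x).
    rewrite -{1 2}(mulKmx Nu x) fdot_mull; apply: le_trans (fdot_mul_le B (N *m x)).
    by rewrite [leLHS]fdotC /B -[in leRHS]mulmxA.
  have h2 := fdotB_psd x NT N0.
  apply: (le_trans h1); rewrite /k -mulrA.
  apply: (@le_trans _ _ ((mx_abs_sum B + 1) * fdot (N *m x) (N *m x))).
    by rewrite ler_wpM2r ?fdot_ge0// lerDl.
  by rewrite ler_wpM2l// addr_ge0// mx_abs_sum_ge0.
have : mu <= mu - k^-1.
  apply: ge_sup => // _ [x /= x1 <-].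
  have := xk x; rewrite NE x1 mulr1 mulrC -ler_pdivrMr// div1r.
  lra.
have : 0 < k^-1 by rewrite invr_gt0.
by lra.
Qed.

Lemma eigenvalue_le p (A : 'M[R]_p) a M : eigenvalue A a ->
  (forall x : 'cV[R]_p, fdot x (A *m x) <= M * fdot x x) -> a <= M.
Proof.
move=> /eigenvalueP[v vA v0] AM.
have vT0 : v^T != 0 by rewrite -trmx0 (inj_eq trmx_inj).
have := AM v^T; have : fdot v^T (A *m v^T) = a * fdot v^T v^T.
  by rewrite /fdot trmxK mulmxA vA -scalemxAl mxtraceZ.
by move=> ->; rewrite ler_pM2r// fdot_gt0.
Qed.

Lemma lambda_maxP p (A : 'M[R]_p) : (0 < p)%N -> A^T = A ->
  eigenvalue A (lambda_max A) /\
  forall x : 'cV[R]_p, fdot x (A *m x) <= lambda_max A * fdot x x.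
Proof.
move=> p0 AT; have [mu muA mu_ub] := top_eigenvalue p0 AT.
suff -> : lambda_max A = mu by [].
apply/eqP; rewrite eq_le; apply/andP; split.
  apply: ge_sup; first by exists mu.
  by move=> a /= aA; exact: eigenvalue_le aA mu_ub.
apply: sup_upper_bound => //; split; first by exists mu.
by exists mu => a /= aA; exact: eigenvalue_le aA mu_ub.
Qed.

Lemma lambda_max_le p (A : 'M[R]_p) M : (0 < p)%N -> A^T = A ->
  lambda_max A <= M <-> forall x : 'cV[R]_p, fdot x (A *m x) <= M * fdot x x.
Proof.
move=> p0 AT; have [mA uA] := lambda_maxP p0 AT; split => [h x|].
  by apply: (le_trans (uA x)); rewrite ler_wpM2r// fdot_ge0.
exact: eigenvalue_le.
Qed.

Lemma lambda_max_ge p (A : 'M[R]_p) M (x : 'cV[R]_p) : (0 < p)%N -> A^T = A ->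
  0 < fdot x x -> M * fdot x x <= fdot x (A *m x) -> M <= lambda_max A.
Proof.
move=> p0 AT x0 h; have [_ uA] := lambda_maxP p0 AT.
by rewrite -(ler_pM2r x0); apply: le_trans (uA x).
Qed.

Lemma lambda_minE p (A : 'M[R]_p) : lambda_min A = - lambda_max (- A).
Proof.
rewrite /lambda_min /lambda_max /inf; congr (- sup _).
have H (B : 'M[R]_p) a : eigenvalue B a -> eigenvalue (- B) (- a).
  move=> /eigenvalueP[v vB v0]; apply/eigenvalueP; exists v => //.
  by rewrite mulmxN vB scaleNr.
apply/seteqP; split => [_ /= [a aA <-]|a /= aA]; first exact: H.
by exists (- a); rewrite ?opprK//= -[A]opprK; exact: H.
Qed.

(** The normalised top eigenvector of [A^T A] attains the supremum. *)
Lemma opnormE m p (A : 'M[R]_(m, p)) : (0 < p)%N ->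
  opnorm A = Num.sqrt (lambda_max (A^T *m A)).
Proof.
move=> p0; set B := A^T *m A.
have BT : B^T = B by rewrite trmx_mul trmxK.
have [/eigenvalueP[v vB v0] uB] := lambda_maxP p0 BT.
have BE (x : 'cV[R]_p) : fdot x (B *m x) = fdot (A *m x) (A *m x).
  by rewrite [RHS]fdot_mull fdotC mulmxA.
set mu := lambda_max B in vB uB *.
have ub x : enorm x <= 1 -> enorm (A *m x) <= Num.sqrt mu.
  rewrite !enormE -[X in _ <= X]sqrtr1 ler_sqrt// => x1.
  have vT0 : v^T != 0 by rewrite -trmx0 (inj_eq trmx_inj).
  have mu0 : 0 <= mu.
    have := uB v^T; rewrite BE => h.
    by rewrite -(pmulr_lge0 _ (fdot_gt0 vT0)) (le_trans _ h)// fdot_ge0.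
  by rewrite ler_sqrt// -BE (le_trans (uB x))// ler_piMr.
apply/eqP; rewrite eq_le; apply/andP; split.
  apply: ge_sup; last by move=> _ [x /= x1 <-]; exact: ub.
  by exists (enorm (A *m 0)); exists 0 => //=; rewrite enormE fdot0l sqrtr0.
have vT0 : v^T != 0 by rewrite -trmx0 (inj_eq trmx_inj).
have f0 := fdot_gt0 vT0; set f := fdot v^T v^T in f0.
have s0 : Num.sqrt f != 0 by rewrite gt_eqF// sqrtr_gt0.
pose x := (Num.sqrt f)^-1 *: v^T.
have x1 : fdot x x = 1.
  rewrite fdotZl fdotC fdotZl mulrA -invfM -expr2 sqr_sqrtr ?ltW// -/f.
  by rewrite mulVf// gt_eqF.
have <- : enorm (A *m x) = Num.sqrt mu.
  rewrite enormE -BE; congr Num.sqrt.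
  have -> : B *m x = mu *: x.
    by rewrite /x -scalemxAr -[B]trmxK -trmx_mul BT vB linearZ/= scalerA mulrC -scalerA.
  by rewrite fdotC fdotZl x1 mulr1.
apply: sup_upper_bound; last by exists x => //=; rewrite enormE x1 sqrtr1.
split.
  by exists (enorm (A *m 0)); exists 0 => //=; rewrite enormE fdot0l sqrtr0.
by exists (Num.sqrt mu) => _ [y /= y1 <-]; exact: ub.
Qed.

Lemma cvg_sum_ord n (f : 'I_n -> nat -> R) (l : 'I_n -> R) :
  (forall i, f i @ \oo --> l i) ->
  (fun k => \sum_i f i k) @ \oo --> \sum_i l i.
Proof.
elim: n f l => [|n ih] f l fl.
  by rewrite big_ord0; under eq_fun do rewrite big_ord0; exact: cvg_cst.
rewrite big_ord_recr/=; under eq_fun do rewrite big_ord_recr/=.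
by apply: cvgD; [exact: ih|exact: fl].
Qed.

Lemma rat_approx (x : R) : exists q : nat -> rat,
  (fun k => ratr (q k) : R) @ \oo --> x.
Proof.
have H k : exists q : rat, ratr q \in `]x - k.+1%:R^-1, x + k.+1%:R^-1[.
  by apply: rat_in_itvoo; rewrite ltrD2l gtrN ?invr_gt0.
exists (fun k => sval (cid (H k))).
have c0 : (fun k : nat => k.+1%:R^-1 : R) @ \oo --> (0 : R) by exact: cvg_harmonic.
have c1 : (fun k : nat => x - k.+1%:R^-1) @ \oo --> x.
  by rewrite -[X in _ --> X]subr0; apply: cvgB => //; exact: cvg_cst.
have c2 : (fun k : nat => x + k.+1%:R^-1) @ \oo --> x.
  by rewrite -[X in _ --> X]addr0; apply: cvgD => //; exact: cvg_cst.
apply: squeeze_cvgr c1 c2; apply: nearW => k.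
by case: cid => q /=; rewrite in_itv/= => /andP[h1 h2]; rewrite !ltW.
Qed.

(** Density of the rational vectors turns [lambda_max A <= M] into countably many inequalities,
    which is what makes [lambda_max] measurable. *)
Lemma quadratic_rat p (A : 'M[R]_p) M :
  (forall q : 'cV[rat]_p, let x := map_mx ratr q in fdot x (A *m x) <= M * fdot x x) ->
  forall x : 'cV[R]_p, fdot x (A *m x) <= M * fdot x x.
Proof.
move=> H x.
have [q qx] : exists q : nat -> 'cV[rat]_p, forall i,
    (fun k => ratr (q k i 0) : R) @ \oo --> x i 0.
  have /choice[q qx] : forall i : 'I_p, exists q : nat -> rat,
      (fun k => ratr (q k) : R) @ \oo --> x i 0 by move=> i; exact: rat_approx.
  exists (fun k => \col_i q i k) => i.
  by under eq_fun do rewrite mxE; exact: qx.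
pose X k : 'cV[R]_p := map_mx ratr (q k).
have cq (B : 'M[R]_p) : (fun k => fdot (X k) (B *m X k)) @ \oo --> fdot x (B *m x).
  rewrite fdot_mulE; under eq_fun do rewrite fdot_mulE.
  apply: cvg_sum_ord => i; apply: cvg_sum_ord => j.
  apply: cvgM; first exact: cvg_cst.
  by apply: cvgM; under eq_fun do rewrite mxE; exact: qx.
have c1 := cq A; have c2 := cq (M%:M).
have mE (y : 'cV[R]_p) : fdot y (M%:M *m y) = M * fdot y y.
  by rewrite mul_scalar_mx fdotC fdotZl.
rewrite -mE -(cvg_lim _ c1)// -(cvg_lim _ c2)//.
apply: ler_lim.
- by apply/cvg_ex; exists (fdot x (A *m x)).
- by apply/cvg_ex; exists (fdot x (M%:M *m x)).
- by apply: nearW => k; rewrite mE; exact: H.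
Qed.

Lemma measurable_lambda_max d (T : measurableType d) p (A : T -> 'M[R]_p) :
  (0 < p)%N -> measurable_mx A -> (forall w, (A w)^T = A w) ->
  measurable_fun setT (fun w => lambda_max (A w)).
Proof.
move=> p0 mA AT.
apply: (measurability (@RGenOInfty.G R)) => [|/= _ [_] [r] -> <-].
  exact: RGenOInfty.measurableE.
rewrite setTI.
pose E (q : 'cV[rat]_p) := let x : 'cV[R]_p := map_mx ratr q in
  [set w | fdot x (A w *m x) <= r * fdot x x].
have mE q : measurable (E q).
  have mf : measurable_fun setT
      (fun w => fdot (map_mx ratr q : 'cV[R]_p) (A w *m map_mx ratr q)).
    apply: measurable_fdot; apply: measurable_mxM => //; exact: measurable_mx_cst.
  have := mf measurableT `]-oo, r * fdot (map_mx ratr q) (map_mx ratr q : 'cV[R]_p)]%classic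
    (measurable_itv _).
  by rewrite setTI; congr measurable; apply/seteqP; split => w /=; rewrite in_itv/=.
have -> : (fun w => lambda_max (A w)) @^-1` `]r, +oo[ =
    ~` (\bigcap_(n in [set: nat]) (if unpickle n is Some q then E q else setT)).
  rewrite -[LHS]setCK; congr (~` _); apply/seteqP; split => w /=.
    rewrite in_itv/= andbT => /negP; rewrite -leNgt => /(lambda_max_le _ p0 (AT w)) h n _.
    by case: unpickle => // q; exact: h.
  move=> h; rewrite in_itv/= andbT; apply/negP; rewrite -leNgt.
  apply/(lambda_max_le _ p0 (AT w))/quadratic_rat => q.
  by have := h (pickle q) I; rewrite pickleK.
apply: measurableC; apply: bigcapT_measurable => n.
by case: unpickle => [q|]; [exact: mE|exact: measurableT].
Qed.

End spectral.

(** * Whitening of the data *)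

Section gaussian_sum.
Context {R : realType} d (T : measurableType d) (P : probability T R).

(** The law of the pair [(X, Y)] and that of the pair drawn separately on the product space agree on
    rectangles, hence everywhere, and the convolution formula applies. *)
Lemma normal_law_add (X Y : T -> R) s t (B : set R) :
  0 <= s -> 0 <= t -> measurable_fun setT X -> measurable_fun setT Y ->
  (forall A B, measurable A -> measurable B ->
    P (X @^-1` A `&` Y @^-1` B) = (P (X @^-1` A) * P (Y @^-1` B))%E) ->
  (forall B, measurable B -> P (X @^-1` B) = normal_law 0 s B) ->
  (forall B, measurable B -> P (Y @^-1` B) = normal_law 0 t B) ->
  measurable B ->
  P [set w | B (X w + Y w)] = normal_law 0 (Num.sqrt (s ^+ 2 + t ^+ 2)) B.
Proof.
move=> s0 t0 mX mY XY lX lY mB.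
rewrite -(normal_law_conv s0 t0 mX mY lX lY mB).
pose f (w : T) : measurableTypeR R * measurableTypeR R := (X w, Y w).
pose g (w : T * T) : measurableTypeR R * measurableTypeR R := (X w.1, Y w.2).
have mf : measurable_fun setT f by exact: measurable_fun_pair.
have mg : measurable_fun setT g.
  by apply: measurable_fun_pair; [exact: (measurableT_comp mX)|exact: (measurableT_comp mY)].
pose m1 : {measure set _ -> \bar R} :=
  measure_function_pushforward__canonical__measure_function_Measure P mf.
pose m2 : {measure set _ -> \bar R} :=
  measure_function_pushforward__canonical__measure_function_Measure (P \x P)%E mg.
pose C : set (set (measurableTypeR R * measurableTypeR R)) :=
  [set A `*` B | A in measurable & B in measurable].
have mC : measurable [set z : measurableTypeR R * measurableTypeR R | B (z.1 + z.2)].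
  have mD : measurable_fun setT (fun z : measurableTypeR R * measurableTypeR R => z.1 + z.2 : R).
    by apply: measurable_funD.
  by rewrite -[X in measurable X]setTI; exact: mD.
apply: (@measure_unique _ R _ C (fun=> setT) _ _ _ _ m1 m2 _ _ _ mC).
- exact: measurable_prod_measurableType.
- move=> _ _ [A1 mA1 [B1 mB1 <-]] [A2 mA2 [B2 mB2 <-]].
  exists (A1 `&` A2); first exact: measurableI.
  exists (B1 `&` B2); first exact: measurableI.
  by rewrite setXI.
- by move=> _; exists setT => //; exists setT => //; rewrite setXTT.
- by rewrite bigcup_const//; exists 0%N.
- move=> _ [A1 mA1 [B1 mB1 <-]].
  rewrite [LHS](XY _ _ mA1 mB1).
  have mXA : measurable (X @^-1` A1) by rewrite -[X in measurable X]setTI; exact: mX.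
  have mYB : measurable (Y @^-1` B1) by rewrite -[X in measurable X]setTI; exact: mY.
  exact: (esym (product_measure1E P P mXA mYB)).
- move=> _; rewrite /m1/= /pushforward preimage_setT.
  by rewrite (le_lt_trans (probability_le1 P measurableT))// ltry.
Qed.

Context (I : finType) (Y : I -> T -> R) (sigma : I -> R).
Hypothesis mY : forall i, measurable_fun setT (Y i).
Hypothesis sigma_ge0 : forall i, 0 <= sigma i.
Hypothesis lawY : forall i B, measurable B -> P (Y i @^-1` B) = normal_law 0 (sigma i) B.
Hypothesis indepY : forall (J : {set I}) (B : I -> set R),
  (forall i, measurable (B i)) ->
  P (\bigcap_(i in [set` J]) Y i @^-1` B i) = (\prod_(i in J) P (Y i @^-1` B i))%E.

Let indep_seq (s : seq I) (B : I -> set R) : uniq s -> (forall i, measurable (B i)) ->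
  P (\bigcap_(i in [set` s]) Y i @^-1` B i) = (\prod_(i <- s) P (Y i @^-1` B i))%E.
Proof.
move=> us mB; rewrite big_uniq//=.
have := indepY [set x in s]%SET mB.
rewrite (eq_bigl (mem s)); last by move=> i; rewrite inE.
by move=> <-; congr (P _); apply/seteqP; split => w h i /=; [rewrite inE => /h|move=> si; apply: h; rewrite /= inE].
Qed.

(** The head of the list has to be independent of the sum over the tail. For fixed [A], the measures
    of [E] given by [P (E and Y k in A)] and [P (Y k in A) P E] agree on the cylinder sets of the
    tail; these are stable under intersection and generate a sigma-algebra for which the sum is
    measurable. *)
Lemma normal_law_sum (s : seq I) (B : set R) : uniq s -> measurable B ->
  P [set w | B (\sum_(i <- s) Y i w)] =
  normal_law 0 (Num.sqrt (\sum_(i <- s) sigma i ^+ 2)) B.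
Proof.
elim: s B => [|k s ih] B us mB.
  rewrite big_nil sqrtr0 /normal_law eqxx.
  under eq_set do rewrite big_nil.
  rewrite diracE; have [|] := boolP (0 \in B); rewrite ?inE ?notin_setE => h.
    by rewrite (_ : [set _ | B 0] = setT) ?probability_setT//; apply/seteqP; split.
  by rewrite (_ : [set _ | B 0] = set0) ?measure0//; apply/seteqP; split.
have /andP[ks us'] := us.
under eq_set do rewrite big_cons.
rewrite big_cons -[X in Num.sqrt (_ + X)]sqr_sqrtr; last first.
  by apply: sumr_ge0 => i _; rewrite sqr_ge0.
apply: (@normal_law_add (Y k) (fun w => \sum_(i <- s) Y i w)) => //.
- exact: measurable_sum.
- move=> A B' mA mB'.
  pose G : set (set T) := [set E | exists C : I -> set R, (forall i, measurable (C i)) /\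
     E = \bigcap_(i in [set` s]) Y i @^-1` C i].
  have mYC i C : measurable C -> measurable (Y i @^-1` C).
    by move=> mC; rewrite -[X in measurable X]setTI; exact: mY.
  have Gm : G `<=` measurable.
    move=> _ [C [mC ->]].
    by apply: fin_bigcap_measurable => // i _; exact: (mYC i (C i) (mC i)).
  have PA0 : 0 <= fine (P (Y k @^-1` A)) by rewrite fine_ge0.
  pose m1 : {measure set T -> \bar R} := mrestr P (mYC k A mA).
  pose m2 : {measure set T -> \bar R} := mscale (NngNum PA0) P.
  have m1E E : m1 E = P (E `&` Y k @^-1` A) by [].
  have m2E E : m2 E = (P (Y k @^-1` A) * P E)%E.
    have -> : m2 E = ((fine (P (Y k @^-1` A)))%:E * P E)%E by [].
    by rewrite fineK ?fin_num_measure//; exact: (mYC k A mA).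
  have GS : <<s G >> ((fun w => \sum_(i <- s) Y i w) @^-1` B').
    have mS : measurable_fun (setT : set (g_sigma_algebraType G))
        (fun w => \sum_(i <- s) Y i w : R).
      rewrite [X in measurable_fun _ X](_ : _ =
        (fun w => \sum_(i <- s) (if i \in s then Y i w else 0))); last first.
        by apply/funext => w; rewrite [LHS]big_seq [RHS]big_seq; apply: eq_bigr => i ->.
      apply: measurable_sum => i.
      have [si|si] := boolP (i \in s); last exact: measurable_cst.
      move=> _ C mC; rewrite setTI; apply: sub_sigma_algebra.
      exists (fun j => if j == i then C else setT); split.
        by move=> j; case: ifP.
      apply/seteqP; split => w /=; first by move=> Cw j /= _; case: eqP => [->|].
      by move=> /(_ i si); rewrite eqxx.
    by rewrite -[X in <<s _ >> X]setTI; exact: mS.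
  have H : m1 ((fun w => \sum_(i <- s) Y i w) @^-1` B') =
      m2 ((fun w => \sum_(i <- s) Y i w) @^-1` B').
    apply: (@g_sigma_algebra_measure_unique _ R _ G Gm (fun=> setT)) GS.
    + move=> _; exists (fun=> setT); split => //.
      by apply/seteqP; split.
    + by rewrite bigcup_const//; exists 0%N.
    + move=> _ _ [C1 [mC1 ->]] [C2 [mC2 ->]].
      exists (fun i => C1 i `&` C2 i); split; first by move=> i; exact: measurableI.
      by rewrite -bigcapI.
    + move=> _ [C [mC ->]]; rewrite m1E m2E.
      pose C' i := if i == k then A else C i.
      have mC' i : measurable (C' i) by rewrite /C'; case: ifP.
      have := indep_seq us mC'.
      rewrite big_cons {2}/C' eqxx.
      have -> : (\prod_(i <- s) P (Y i @^-1` C' i) = P (\bigcap_(i in [set` s]) Y i @^-1` C i))%E.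
        rewrite (indep_seq us' mC) [LHS]big_seq [RHS]big_seq; apply: eq_bigr => i si.
        by rewrite /C'; case: eqP => // ik; move: ks; rewrite -ik si.
      move=> <-; congr (P _); apply/seteqP; split => w /=.
        move=> [h hA] i /=; rewrite inE /C' => /orP[/eqP ->|si]; first by rewrite eqxx.
        case: eqP => [ik|_]; last exact: h.
        by move: ks; rewrite -ik si.
      move=> h; split; last by have := h k; rewrite /= inE /C' eqxx; exact.
      move=> i si; have := h i; rewrite /= inE si orbT /C' => /(_ isT).
      by case: eqP => // ik; move: ks; rewrite -ik si.
    + move=> _; rewrite m1E setTI.
      by rewrite (le_lt_trans (probability_le1 P _)) ?ltry//; exact: (mYC k A mA).
  by rewrite setIC -m1E H m2E.
- exact: lawY.
- by move=> C mC; exact: ih.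
Qed.

End gaussian_sum.

Section whitening.
Context {R : realType}.

Definition data_mx n p (x : 'I_n -> 'cV[R]_p) : 'M[R]_(p, n) :=
  \matrix_(j, i) x i j 0.

Lemma sample_covE n p (x : 'I_n -> 'cV[R]_p) :
  sample_cov x = n%:R^-1 *: (data_mx x *m (data_mx x)^T).
Proof.
rewrite /sample_cov; congr (_ *: _); apply/matrixP => i j.
rewrite summxE mxE; apply: eq_bigr => k _.
by rewrite !mxE big_ord1 mxE.
Qed.

Definition spikemx p (a : R) : 'M[R]_p :=
  1%:M + (a - 1) *: ((e0row p)^T *m e0row p).

Lemma spikemxM p a b : (0 < p)%N -> spikemx p a *m spikemx p b = spikemx p (a * b).
Proof.
move=> p0; have NN : ((e0row p)^T *m e0row p) *m ((e0row p)^T *m e0row p) =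
    (e0row p)^T *m e0row p :> 'M[R]_p.
  by rewrite mulmxA -(mulmxA (e0row p)^T) rV_mul_tr fdot_e0row// mul_mx_scalar scale1r.
rewrite /spikemx; move: ((e0row p)^T *m e0row p) NN => N NN.
rewrite mulmxDr mulmx1 mulmxDl mul1mx -scalemxAl -scalemxAr NN scalerA.
rewrite -addrA -!scalerDl; congr (_ + _ *: _); ring.
Qed.

Lemma spikemx1 p : spikemx p 1 = 1%:M.
Proof. by rewrite /spikemx subrr scale0r addr0. Qed.

Lemma tr_spikemx p a : (spikemx p a)^T = spikemx p a.
Proof. by rewrite /spikemx linearD/= trmx1 linearZ/= trmx_mul trmxK. Qed.

Lemma enorm1_fdot p (v : 'cV[R]_p) : enorm v = 1 -> fdot v v = 1.
Proof.
by rewrite enormE => v1; rewrite -[LHS]sqr_sqrtr ?fdot_ge0// v1 expr1n.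
Qed.

Lemma householder_unit p (v : 'cV[R]_p) : enorm v = 1 ->
  householder v^T *m v = (e0row p)^T.
Proof.
move=> /enorm1_fdot v1; apply: trmx_inj.
rewrite trmx_mul tr_householder mul_householder trmxK.
by rewrite fdot_tr trmxK v1 sqrtr1 scale1r.
Qed.

Lemma spiked_covE p lam (v : 'cV[R]_p) : (0 < p)%N -> 0 <= lam -> enorm v = 1 ->
  spiked_cov lam v = householder v^T *m spikemx p (1 + lam) *m householder v^T.
Proof.
move=> p0 l0 v1; have hv := householder_unit v1.
have hh : householder v^T *m householder v^T = 1%:M.
  by have := householderK v^T; rewrite tr_householder.
have vE : v = householder v^T *m (e0row p)^T by rewrite -hv mulmxA hh mul1mx.
rewrite /spikemx addrAC subrr add0r mulmxDr mulmx1 mulmxDl hh -scalemxAr -scalemxAl.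
rewrite /spiked_cov addrC; congr (_ + _ *: _).
rewrite !mulmxA -vE -mulmxA; congr (_ *m _).
by rewrite {1}vE trmx_mul trmxK tr_householder.
Qed.

Context d (T : measurableType d) (P : probability T R).

(** A functional of the whitened matrix is a sum over the independent columns. The whitening factor
    cancels the covariance, so column [i] contributes the variance [fdot (col i U) (col i U)]. *)
Lemma spiked_std_gauss n p lam (v : 'cV[R]_p) (X : 'I_n -> T -> 'cV[R]_p) :
  (0 < p)%N -> 0 <= lam -> enorm v = 1 -> independent_vectors P X ->
  (forall i, gaussian_vector P (X i) 0 (spiked_cov lam v)) ->
  std_gauss P (fun w => spikemx p (Num.sqrt (1 + lam))^-1 *m householder v^T *m
    data_mx (X ^~ w)).
Proof.
move=> p0 l0 v1 iX gX; set h := householder v^T; set D := spikemx p _.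
have mdata : measurable_mx (fun w => data_mx (X ^~ w)).
  by move=> j i; under eq_fun do rewrite mxE; exact: (gX i).1.
split; first by apply: measurable_mxM => //; exact: measurable_mx_cst.
move=> U B mB.
pose W := (D *m h)^T *m U.
pose u i : 'cV[R]_p := col i W.
pose Y i w := ((u i)^T *m X i w) 0 0.
have fE w : fdot U (D *m h *m data_mx (X ^~ w)) = \sum_(i <- index_enum 'I_n) Y i w.
  rewrite fdot_mull fdotE exchange_big/=; apply: eq_bigr => i _.
  by rewrite /Y mxE; apply: eq_bigr => j _; rewrite !mxE.
under eq_set do rewrite fE.
pose sig i := Num.sqrt (((u i)^T *m spiked_cov lam v *m u i) 0 0).
have sqE i : ((u i)^T *m spiked_cov lam v *m u i) 0 0 = fdot (col i U) (col i U).
  have -> : fdot (col i U) (col i U) = ((col i U)^T *m col i U) 0 0.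
    by rewrite /fdot /mxtrace big_ord1.
  have -> : u i = (D *m h)^T *m col i U by rewrite /u /W !colE mulmxA.
  rewrite (spiked_covE p0 l0 v1) -/h trmx_mul trmxK !mulmxA.
  have hh : h *m h = 1%:M by have := householderK v^T; rewrite tr_householder.
  have hT : h^T = h by rewrite tr_householder.
  have DT : D^T = D by rewrite tr_spikemx.
  have s0 : Num.sqrt (1 + lam) != 0 by rewrite gt_eqF// sqrtr_gt0; lra.
  have s2 : Num.sqrt (1 + lam) * Num.sqrt (1 + lam) = 1 + lam.
    by rewrite -expr2 sqr_sqrtr//; lra.
  rewrite trmx_mul hT DT -!mulmxA (mulmxA h h) hh mul1mx (mulmxA h h) hh mul1mx.
  rewrite (mulmxA D) (mulmxA _ D) !spikemxM//.
  have -> : (Num.sqrt (1 + lam))^-1 * (1 + lam) * (Num.sqrt (1 + lam))^-1 = 1.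
    by move: (Num.sqrt (1 + lam)) s0 s2 => q q0 <-; field.
  by rewrite spikemx1 mul1mx.
have sig2 i : sig i ^+ 2 = fdot (col i U) (col i U).
  by rewrite sqr_sqrtr sqE ?fdot_ge0.
have -> : fdot U U = \sum_(i <- index_enum 'I_n) sig i ^+ 2.
  rewrite fdotE exchange_big/=; apply: eq_bigr => i _.
  by rewrite sig2 fdotE; apply: eq_bigr => j _; rewrite big_ord1 !mxE.
apply: normal_law_sum => //.
- move=> i; rewrite /Y; under eq_fun do rewrite mxE.
  apply: measurable_sum => j; apply: measurable_funM; first exact: measurable_cst.
  exact: (gX i).1.
- by move=> i; rewrite sqrtr_ge0.
- move=> i C mC; have := (gX i).2 (u i) C mC.
  by rewrite mulmx0 mxE.
- move=> J C mC; rewrite -(iX J (fun i => Y i @^-1` C i))//.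
  move=> i _.
  pose F := \big[setU/set0]_(j < p) preimage_set_system setT (fun w => X i w j 0) measurable.
  have mXj j : measurable_fun (setT : set (g_sigma_algebraType F)) (fun w => X i w j 0 : R).
    move=> _ A mA; apply: sub_sigma_algebra.
    rewrite /F (bigD1 j)//=; left; exists A => //.
  have mYi : measurable_fun (setT : set (g_sigma_algebraType F)) (Y i).
    rewrite /Y; under eq_fun do rewrite mxE.
    apply: measurable_sum => j; apply: measurable_funM; first exact: measurable_cst.
    exact: mXj.
  rewrite -[X in g_sigma_preimage _ X]setTI; exact: mYi.
- exact: index_enum_uniq.
Qed.

End whitening.

(** * Spectral edges *)

Section edges.
Context {R : realType}.
Implicit Types (lam s delta kappa sg rho h : R).

(* [rho] is the decay rate of the extremal (generalised) eigenvector of the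
   half-infinite Jacobi matrix and [h] the edge of its spectrum: [rho < 1] holds
   when an outlier eigenvalue leaves the bulk, and [rho = 1] otherwise. *)
Definition edge_data lam s kappa sg rho h : Prop :=
  let b := (1 + lam) * (1 - kappa + sg * (s * rho)) - h in
  [/\ 0 < rho <= 1, h = 1 - kappa + s ^+ 2 + sg * s * (rho + rho^-1),
    b = 0 \/ rho = 1, `|b| <= s * (1 + s) /\ sg * b <= 0 &
    (1 + lam) * rho * (1 + s * rho) <= 4 * (1 + lam + s ^+ 2)].

(** For [kappa = 0] the defect factors as [b = (1 + s rho) (lam - s / rho)]. Its root
    [rho = s / lam] is below 1 exactly when [lam > s]; otherwise [rho = 1]. *)
Lemma edge_Sfun lam delta : 0 <= lam -> 0 < delta ->
  exists rho, edge_data lam (Num.sqrt delta) 0 1 rho (Sfun lam delta).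
Proof.
move=> l0 d0; rewrite /Sfun /edge_data; set s := Num.sqrt delta.
have s0 : 0 < s by rewrite sqrtr_gt0.
have s2 : delta = s ^+ 2 by rewrite sqr_sqrtr// ltW.
have ss : 0 <= (1 - s) ^+ 2 by rewrite sqr_ge0.
case: ifP => [ls|/negbT]; last rewrite -ltNge => ls.
  have ls' : lam * s <= s * s by rewrite ler_wpM2r// ltW.
  have ls0 : 0 <= lam * s by rewrite mulr_ge0// ltW.
  exists 1; rewrite invr1; split; rewrite ?lexx ?ltr01//.
  - ring.
  - by right.
  - by split; [rewrite ler_norml; lra|lra].
  - lra.
have l1 : 0 < lam by apply: lt_trans ls.
have r0 : 0 < s / lam by rewrite divr_gt0.
have r1 : s / lam <= 1 by rewrite ler_pdivrMr// mul1r ltW.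
exists (s / lam); rewrite r0 r1 s2.
have E : (1 + lam) * (1 + s ^+ 2 / lam) =
    1 - 0 + s ^+ 2 + 1 * s * (s / lam + (s / lam)^-1).
  by field; rewrite !gt_eqF.
have b0 : (1 + lam) * (1 - 0 + 1 * (s * (s / lam))) -
    (1 + lam) * (1 + s ^+ 2 / lam) = 0 by field; rewrite gt_eqF.
split => //.
- by left.
- rewrite b0 normr0 mulr0 lexx; split => //.
  by rewrite mulr_ge0//; lra.
- have -> : (1 + lam) * (s / lam) = s / lam + s by field; rewrite gt_eqF.
  have h1 : s / lam + s <= 1 + s by lra.
  have h2 : 1 + s * (s / lam) <= 1 + s by rewrite lerD2l ler_piMr// ltW.
  apply: (@le_trans _ _ ((1 + s) * (1 + s))); last by lra.
  have p2 : 0 <= s * (s / lam) by rewrite mulr_ge0// ltW.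
  by apply: ler_pM => //; lra.
Qed.

(** For [kappa = 1] the equation [b = 0] reads [lam rho^2 = s rho + 1]. Its positive root is below 1
    exactly when [lam > 1 + s], and then [h = (1 + lam) s rho]. *)
Lemma edge_Hplus lam delta : 0 <= lam -> 0 < delta ->
  exists rho, edge_data lam (Num.sqrt delta) 1 1 rho (Hplus lam delta).
Proof.
move=> l0 d0; rewrite /Hplus /edge_data; set s := Num.sqrt delta.
have s0 : 0 < s by rewrite sqrtr_gt0.
have s2 : delta = s ^+ 2 by rewrite sqr_sqrtr// ltW.
have ss : 0 <= (1 - s) ^+ 2 by rewrite sqr_ge0.
case: ifP => [ls|/negbT]; last rewrite -ltNge => ls.
  have ls' : lam * s <= (1 + s) * s by rewrite ler_wpM2r// ltW.
  have ls0 : 0 <= lam * s by rewrite mulr_ge0// ltW.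
  exists 1; rewrite invr1; split; rewrite ?lexx ?ltr01// ?s2.
  - ring.
  - by right.
  - by split; [rewrite ler_norml; lra|lra].
  - lra.
have l1 : 0 < lam by lra.
set q := Num.sqrt (delta + 4 * lam).
have q2 : q ^+ 2 = s ^+ 2 + 4 * lam by rewrite sqr_sqrtr ?s2// addr_ge0 ?sqr_ge0//; lra.
have q0 : 0 < q by rewrite sqrtr_gt0 s2 addr_gt0 ?exprn_gt0//; lra.
pose r := (s + q) / (2 * lam).
have r0 : 0 < r by rewrite divr_gt0//; lra.
have rE : lam * r ^+ 2 = s * r + 1.
  have -> : lam * r ^+ 2 = (s ^+ 2 + 2 * s * q + q ^+ 2) / (4 * lam).
    by rewrite /r; field; rewrite gt_eqF.
  by rewrite q2 /r; field; rewrite gt_eqF.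
have r1 : r <= 1.
  rewrite leNgt; apply/negP => r1.
  have : lam * r ^+ 2 > (1 + s) * r ^+ 2 by rewrite ltr_pM2r// exprn_gt0.
  have : r < r ^+ 2 by rewrite expr2 ltr_pMl.
  have : s * r < s * r ^+ 2 by rewrite ltr_pM2l// expr2 ltr_pMl.
  by rewrite rE; lra.
have ri : r^-1 = lam * r - s.
  by apply: (mulfI (lt0r_neq0 r0)); rewrite divff ?gt_eqF//; lra.
have hE : (1 + lam) / (2 * lam) * (s + q) * s = (1 + lam) * (s * r).
  by rewrite /r; field; rewrite gt_eqF.
exists r; rewrite r0 r1 hE ri.
have b0 : (1 + lam) * (1 - 1 + 1 * (s * r)) - (1 + lam) * (s * r) = 0 by ring.
split => //.
- ring.
- by left.
- rewrite b0 normr0 mulr0 lexx; split => //.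
  by rewrite mulr_ge0//; lra.
- have -> : (1 + lam) * r * (1 + s * r) = r + s * r * r + lam * r + s * (lam * r ^+ 2).
    by ring.
  have h1 : lam * r <= lam by rewrite ler_piMr.
  have h2 : s * r <= s by rewrite ler_piMr// ltW.
  have h3 : s * r * r <= s by apply: le_trans h2; rewrite ler_piMr// mulr_ge0// ltW.
  have h4 : s * (s * r) <= s * s by rewrite ler_pM2l.
  by rewrite rE; lra.
Qed.

(** With the opposite sign [b = 0] becomes [lam rho^2 + s rho = 1], and then
    [h = - (1 + lam) s rho]. The last two conclusions are the additional hypotheses of
    [jacobi_form_lower]. *)
Lemma edge_Hminus lam delta : 0 <= lam -> 0 < delta ->
  exists rho, [/\ edge_data lam (Num.sqrt delta) 1 (-1) rho (Hminus lam delta),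
    1 <= Num.sqrt delta -> Hminus lam delta <= -1 &
    rho^-1 <= 1 + lam + Num.sqrt delta].
Proof.
move=> l0 d0; rewrite /Hminus /edge_data; set s := Num.sqrt delta.
have s0 : 0 < s by rewrite sqrtr_gt0.
have s2 : delta = s ^+ 2 by rewrite sqr_sqrtr// ltW.
have ss : 0 <= (1 - s) ^+ 2 by rewrite sqr_ge0.
case: ifP => [ls|/negbT]; last rewrite -ltNge => ls.
  have ls' : lam * s <= (1 - s) * s by rewrite ler_wpM2r// ltW.
  have ls0 : 0 <= lam * s by rewrite mulr_ge0// ltW.
  exists 1; rewrite invr1; split.
  - split; rewrite ?lexx ?ltr01// ?s2.
    + ring.
    + by right.
    + by split; [rewrite ler_norml; lra|lra].
    + lra.
  (* On the plateau [lam <= 1 - s], so [1 <= s] forces [s = 1], where the edge is -1. *)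
  - by move=> s1; rewrite s2; have -> : s = 1 by [lra|]; lra.
  - lra.
have [r [r0 r1 rE hE]] : exists r, [/\ 0 < r, r <= 1, lam * r ^+ 2 + s * r = 1 &
    (if lam == 0 then -1 else (1 + lam) / (2 * lam) * (s - Num.sqrt (delta + 4 * lam)) * s)
      = - ((1 + lam) * (s * r))].
  (* For [lam = 0] the equation is linear with root [1 / s], in agreement with the limit value
     -1. *)
  have [l1|l1] := eqVneq lam 0.
    have s1 : 1 < s by move: ls; rewrite l1; lra.
    exists s^-1; rewrite invr_gt0 s0 invf_le1// (ltW s1) l1; split => //.
      by field; rewrite gt_eqF.
    by field; rewrite gt_eqF.
  have l2 : 0 < lam by rewrite lt_neqAle eq_sym l1.
  set q := Num.sqrt (delta + 4 * lam).
  have q2 : q ^+ 2 = s ^+ 2 + 4 * lam by rewrite sqr_sqrtr ?s2// addr_ge0 ?sqr_ge0//; lra.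
  have q0 : 0 < q by rewrite sqrtr_gt0 s2 addr_gt0 ?exprn_gt0//; lra.
  have sq : s < q by rewrite -ltr_sqr ?nnegrE ?ltW// q2; lra.
  pose r := (q - s) / (2 * lam).
  have r0 : 0 < r by rewrite divr_gt0//; lra.
  have rE : lam * r ^+ 2 + s * r = 1.
    have -> : lam * r ^+ 2 + s * r = (q ^+ 2 - s ^+ 2) / (4 * lam).
      by rewrite /r; field; rewrite gt_eqF.
    by rewrite q2; field; rewrite gt_eqF.
  exists r; split => //.
  - rewrite leNgt; apply/negP => r1.
    have : r < r ^+ 2 by rewrite expr2 ltr_pMl.
    have : 1 < r by [].
    have h1 : lam * r <= lam * r ^+ 2 by rewrite ler_pM2l// ltW// expr2 ltr_pMl.
    have h2 : 1 * 1 < (lam + s) * r by rewrite ltr_pM//; lra.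
    by lra.
  - by rewrite /r; field; rewrite gt_eqF.
have ri : r^-1 = lam * r + s.
  by apply: (mulfI (lt0r_neq0 r0)); rewrite divff ?gt_eqF//; lra.
have h1 : lam * r <= lam by rewrite ler_piMr.
have h2 : s * r <= s by rewrite ler_piMr// ltW.
exists r; rewrite hE; split.
- rewrite r0 r1 ri.
  have b0 : (1 + lam) * (1 - 1 + -1 * (s * r)) - - ((1 + lam) * (s * r)) = 0 by ring.
  split => //.
  + ring.
  + by left.
  + rewrite b0 normr0 mulr0 lexx; split => //.
    by rewrite mulr_ge0//; lra.
  + have -> : (1 + lam) * r * (1 + s * r) = r + s * r * r + lam * r + s * (lam * r ^+ 2).
      by ring.
    have h3 : s * r * r <= s by apply: le_trans h2; rewrite ler_piMr// mulr_ge0// ltW.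
    have h4 : s * (lam * r ^+ 2) <= s.
      by rewrite ler_piMr//; [exact: ltW|have : 0 <= s * r by [rewrite mulr_ge0// ltW|]; lra].
    by lra.
(* [(1 + lam) s r >= s r + lam r^2 = 1], since [r <= 1 <= s]. *)
- move=> s1; have : lam * r ^+ 2 <= lam * (s * r).
    rewrite ler_wpM2l// expr2 ler_pM2r//; lra.
  lra.
- rewrite ri; lra.
Qed.

End edges.

(** * Spectrum of the sample covariance matrix *)

Section transfer.
Context {R : realType}.

(** Extension by zero: neighbouring indices need no bounds, and the condition [z p = 0] of the
    estimates on forms holds automatically. *)
Definition coord p (zeta : 'cV[R]_p) (k : nat) : R :=
  if insub k is Some i then zeta i 0 else 0.

Lemma coord_ord p (zeta : 'cV[R]_p) (i : 'I_p) : coord zeta i = zeta i 0.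
Proof. by rewrite /coord valK. Qed.

Lemma coord_ge p (zeta : 'cV[R]_p) k : (p <= k)%N -> coord zeta k = 0.
Proof. by move=> pk; rewrite /coord insubN// -leqNgt. Qed.

Lemma fdot_coord p (zeta : 'cV[R]_p) : fdot zeta zeta = sqnorm p (coord zeta).
Proof.
by rewrite fdotE; apply: eq_bigr => i _; rewrite big_ord1 coord_ord expr2.
Qed.

Lemma sum_pick p (f : nat -> R) (c : nat -> R) j :
  (forall k, (p <= k)%N -> f k = 0) ->
  \sum_(i < p) (if (i : nat) == j then c i else 0) * f i = c j * f j.
Proof.
move=> fp; have [jp|jp] := ltnP j p; last first.
  rewrite fp// mulr0 big1// => i _; case: eqP => [ij|]; rewrite ?mul0r//.
  by move: jp; rewrite -ij leqNgt ltn_ord.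
rewrite (bigD1 (Ordinal jp))//= eqxx big1 ?addr0// => i ij.
rewrite ifF ?mul0r//; apply/negbTE; apply: contra ij => /eqP ij.
by apply/eqP/val_inj.
Qed.

Lemma coord_spikemx p lam (zeta : 'cV[R]_p) k :
  coord (spikemx p (Num.sqrt (1 + lam)) *m zeta) k = spike lam k * coord zeta k.
Proof.
have [kp|kp] := ltnP k p; last by rewrite !coord_ge// mulr0.
rewrite -[k]/(nat_of_ord (Ordinal kp)) !coord_ord.
rewrite /spikemx mulmxDl mul1mx -scalemxAl -mulmxA.
have -> : e0row p *m zeta = (coord zeta 0)%:M.
  rewrite [LHS]mx11_scalar; congr _%:M; rewrite mxE.
  rewrite -[RHS]mul1r -(@sum_pick p (coord zeta) (fun=> 1) 0%N); last exact: coord_ge.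
  by apply: eq_bigr => i _; rewrite mxE coord_ord; case: eqP.
rewrite mul_mx_scalar !mxE /spike /=; case: k kp => [|k] kp /=; last first.
  by rewrite !mulr0 addr0 mul1r.
by rewrite -(coord_ord zeta (Ordinal kp)) /=; ring.
Qed.

Lemma coord_bidiag_tr n p (a : nat -> R) (y : 'cV[R]_p) (j : 'I_n) :
  ((bidiag p n a)^T *m y) j 0 =
  a j.*2 * coord y j + a j.*2.+1 * coord y j.+1.
Proof.
rewrite mxE -(@sum_pick p (coord y) (fun i => a i.*2) j); last exact: coord_ge.
rewrite -(@sum_pick p (coord y) (fun=> a j.*2.+1) j.+1); last exact: coord_ge.
rewrite -big_split/=; apply: eq_bigr => i _; rewrite !mxE coord_ord -mulrDl.
congr (_ * _); case: (ltngtP (i : nat) j) => [ij|ij|->].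
- by rewrite [_ == _.+1]ltn_eqF ?addr0// ltnS ltnW.
- by rewrite add0r.
- by rewrite ltn_eqF// addr0.
Qed.

Lemma sum_swap_ord n p (F : nat -> R) : (forall j, (p <= j)%N -> F j = 0) ->
  \sum_(j < n) F j = \sum_(j < p) (if (j < n)%N then F j else 0).
Proof.
move=> F0; have [np|pn] := leqP n p.
  rewrite (sum_ord_trunc (m := n) (f := fun j => if (j < n)%N then F j else 0))//.
    by apply: eq_bigr => j _; rewrite ltn_ord.
  by move=> j nj; rewrite ltnNge nj.
rewrite (sum_ord_trunc (m := p) (f := F) (ltnW pn))//.
by apply: eq_bigr => j _; rewrite (ltn_trans (ltn_ord j) pn).
Qed.

Context (n p : nat) (lam : R) (v : 'cV[R]_p) (G : 'M[R]_(p, n)).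
Context (U : 'M[R]_p) (V : 'M[R]_n) (a : nat -> R).
Hypotheses (n0 : (0 < n)%N) (p0 : (0 < p)%N) (l0 : 0 <= lam) (v1 : enorm v = 1).
Hypotheses (UU : U *m U^T = 1%:M) (VV : V *m V^T = 1%:M).
Hypotheses (eU : e0row p *m U = e0row p) (eUT : e0row p *m U^T = e0row p).
Hypothesis UGV : U *m G *m V = bidiag p n a.

Let h := householder v^T.
Let D := spikemx p (Num.sqrt (1 + lam)).
Let Y := h *m D *m G.
Let a' j := a j.*2 / Num.sqrt n%:R.
Let b' j := a j.*2.+1 / Num.sqrt n%:R.

Let hh : h *m h = 1%:M.
Proof. by have := householderK v^T; rewrite tr_householder. Qed.

Let hT : h^T = h. Proof. exact: tr_householder. Qed.

Let UTU : U^T *m U = 1%:M. Proof. exact: mulmx1C. Qed.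

Let DU : D *m U^T = U^T *m D.
Proof.
rewrite /D /spikemx mulmxDl mulmxDr mul1mx mulmx1; congr (_ + _).
rewrite -scalemxAl -scalemxAr; congr (_ *: _).
rewrite -mulmxA eUT mulmxA; congr (_ *m _).
by rewrite -{1}eU trmx_mul.
Qed.

Lemma transfer_norm (zeta : 'cV[R]_p) :
  fdot (h *m U^T *m zeta) (h *m U^T *m zeta) = sqnorm p (coord zeta).
Proof.
rewrite -fdot_coord -mulmxA fdot_mull hT (mulmxA h h) hh mul1mx.
by rewrite fdot_mull trmxK mulmxA UU mul1mx.
Qed.

Lemma transfer_surj (x : 'cV[R]_p) : exists zeta, x = h *m U^T *m zeta.
Proof.
exists (U *m h *m x).
by rewrite !mulmxA -(mulmxA h) UTU mulmx1 hh mul1mx.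
Qed.

Lemma transfer_form kappa (zeta : 'cV[R]_p) (x := h *m U^T *m zeta) :
  fdot x ((n%:R^-1 *: (Y *m Y^T) - kappa *: spiked_cov lam v) *m x) =
  jacobi_form n p lam a' b' (coord zeta) - kappa * spike_sqnorm p lam (coord zeta).
Proof.
have DT : D^T = D by rewrite tr_spikemx.
have fB (A B : 'M[R]_p) : fdot x ((A - B) *m x) = fdot x (A *m x) - fdot x (B *m x).
  by rewrite mulmxBl fdotC -scaleN1r fdotDl fdotZl mulN1r !(fdotC x).
have fZ c (A : 'M[R]_p) : fdot x ((c *: A) *m x) = c * fdot x (A *m x).
  by rewrite -scalemxAl fdotC fdotZl (fdotC x).
rewrite fB !fZ; congr (_ - _ * _).
- have -> : fdot x (Y *m Y^T *m x) = fdot (Y^T *m x) (Y^T *m x).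
    by rewrite -mulmxA fdot_mull.
  have -> : Y^T *m x = V *m ((bidiag p n a)^T *m (D *m zeta)).
    rewrite /Y -UGV !trmx_mul !mulmxA VV mul1mx /x hT DT ?mulmxA.
    rewrite -(mulmxA _ h h) hh mulmx1 -(mulmxA _ D U^T) DU !mulmxA.
    by [].
  rewrite fdot_mull (mulmxA V^T V) (mulmx1C VV) mul1mx fdotE.
  transitivity (n%:R^-1 * \sum_(j < n) (a j.*2 * (spike lam j * coord zeta j) +
      a j.*2.+1 * coord zeta j.+1) ^+ 2).
    congr (_ * _); apply: eq_bigr => j _; rewrite big_ord1 -expr2 coord_bidiag_tr.
    by rewrite !coord_spikemx {3}/spike/= mul1r.
  rewrite mulr_sumr (@sum_swap_ord n p (fun j => n%:R^-1 *
    (a j.*2 * (spike lam j * coord zeta j) + a j.*2.+1 * coord zeta j.+1) ^+ 2)).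
    apply: eq_bigr => j _; case: ifP => // _.
    have s0 : Num.sqrt n%:R != 0 :> R by rewrite gt_eqF// sqrtr_gt0 ltr0n.
    have <- : Num.sqrt n%:R ^+ 2 = n%:R :> R by rewrite sqr_sqrtr.
    by rewrite /a' /b'; field.
  by move=> j pj; rewrite !coord_ge ?(leqW pj)// !mulr0 addr0 expr0n/= mulr0.
- rewrite (spiked_covE p0 l0 v1) -/h.
  have -> : spikemx p (1 + lam) = D *m D.
    by rewrite /D spikemxM// -expr2 sqr_sqrtr// addr_ge0.
  have -> : fdot x (h *m (D *m D) *m h *m x) = fdot (D *m zeta) (D *m zeta).
    have hx : h *m x = U^T *m zeta by rewrite /x (mulmxA h) (mulmxA h) hh mul1mx.
    rewrite -mulmxA hx -(mulmxA h) fdot_mull hT hx -mulmxA fdot_mull DT.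
    rewrite (mulmxA D (U^T)) DU -(mulmxA U^T) fdot_mull trmxK (mulmxA U) UU mul1mx.
    by [].
  rewrite fdot_coord /sqnorm /spike_sqnorm; apply: eq_bigr => j _.
  by rewrite coord_spikemx.
Qed.

End transfer.

(** * From quadratic forms to extremal eigenvalues *)

Section spectrum.
Context {R : realType}.

(** Let [w] be an eigenvector of [A^2] for its top eigenvalue [mu]. Then [w A + sqrt mu w] is an
    eigenvector of [A] for [sqrt mu], unless it is zero; in that case [- sqrt mu] is an eigenvalue
    of [A], and nonnegativity gives [mu = 0]. *)
Lemma opnorm_psd p (A : 'M[R]_p) : (0 < p)%N -> A^T = A ->
  (forall x : 'cV[R]_p, 0 <= fdot x (A *m x)) -> opnorm A = lambda_max A.
Proof.
move=> p0 AT A0; have [/eigenvalueP[v vA v0] uA] := lambda_maxP p0 AT.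
have eig_ge0 (u : 'rV[R]_p) a : u *m A = a *: u -> u != 0 -> 0 <= a.
  move=> uAE u0; have := A0 u^T.
  have -> : fdot u^T (A *m u^T) = a * fdot u^T u^T.
    by rewrite /fdot trmxK mulmxA uAE -scalemxAl mxtraceZ.
  by rewrite pmulr_lge0// fdot_gt0// -trmx0 (inj_eq trmx_inj).
have AAT : (A^T *m A)^T = A^T *m A by rewrite trmx_mul trmxK.
have [/eigenvalueP[w wA w0] uAA] := lambda_maxP p0 AAT.
have l0 := eig_ge0 _ _ vA v0.
rewrite opnormE//; apply/eqP; rewrite eq_le; apply/andP; split; last first.
  rewrite -[leLHS]ger0_norm// -sqrtr_sqr ler_wsqrtr//.
  apply: (@lambda_max_ge _ _ _ _ v^T) => //.
    by rewrite fdot_gt0// -trmx0 (inj_eq trmx_inj).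
  rewrite /fdot trmxK AT !mulmxA vA -scalemxAl vA -!scalemxAl !mxtraceZ.
  by rewrite mulrA -expr2.
set mu := lambda_max (A^T *m A) in wA uAA *.
have mu0 : 0 <= mu.
  rewrite /mu; apply: le_trans (lambda_max_ge p0 AAT (x := v^T) (M := 0) _ _) => //.
    by rewrite fdot_gt0// -trmx0 (inj_eq trmx_inj).
  by rewrite mul0r AT -mulmxA fdot_mull AT fdot_ge0.
have [m0|m0] := eqVneq (w *m A + Num.sqrt mu *: w) 0.
  have wE : w *m A = (- Num.sqrt mu) *: w by apply/eqP; rewrite scaleNr -addr_eq0 m0.
  by have := eig_ge0 _ _ wE w0; rewrite oppr_ge0 => /le_trans; exact.
apply: (@eigenvalue_le _ _ A) => //; apply/eigenvalueP; exists (w *m A + Num.sqrt mu *: w) => //.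
rewrite mulmxDl -mulmxA -{1}AT wA -scalemxAl scalerDr scalerA -expr2 sqr_sqrtr//.
by rewrite addrC.
Qed.

Lemma lambda_max_sandwich p (A W : 'M[R]_p) (f : (nat -> R) -> R) h E :
  (0 < p)%N -> A^T = A ->
  (forall z z', (forall k, (k <= p)%N -> z k = z' k) -> f z = f z') ->
  (forall zeta : 'cV[R]_p, fdot (W *m zeta) (W *m zeta) = sqnorm p (coord zeta)) ->
  (forall x : 'cV[R]_p, exists zeta, x = W *m zeta) ->
  (forall zeta : 'cV[R]_p, fdot (W *m zeta) (A *m (W *m zeta)) = f (coord zeta)) ->
  (forall z, z p = 0 -> f z <= (h + E) * sqnorm p z) ->
  (exists z, [/\ z p = 0, 0 < sqnorm p z & (h - E) * sqnorm p z <= f z]) ->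
  `|lambda_max A - h| <= E.
Proof.
move=> p0 AT fext Wn Ws Wf up [z [zp z0 low]].
rewrite ler_norml lerBrDl; apply/andP; split; last first.
  rewrite lerBlDl.
  apply: (proj2 (lambda_max_le (h + E) p0 AT)) => x; have [zeta ->] := Ws x.
  by rewrite Wn Wf up// coord_ge.
pose zeta : 'cV[R]_p := \col_i z i.
have zE k : (k <= p)%N -> coord zeta k = z k.
  rewrite leq_eqVlt => /orP[/eqP ->|kp]; first by rewrite coord_ge.
  by rewrite -[k]/(nat_of_ord (Ordinal kp)) coord_ord mxE.
have nE : sqnorm p (coord zeta) = sqnorm p z.
  by apply: eq_bigr => i _; rewrite zE// ltnW.
apply: (@lambda_max_ge _ _ _ _ (W *m zeta)) => //; first by rewrite Wn nE.
by rewrite Wn Wf nE (fext _ z).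
Qed.

Lemma jacobi_form_ext n p lam a b (z z' : nat -> R) :
  (forall k, (k <= p)%N -> z k = z' k) ->
  jacobi_form n p lam a b z = jacobi_form n p lam a b z'.
Proof.
move=> zz; apply: eq_bigr => j _; rewrite !zz//; first exact: ltnW.
Qed.

Lemma spike_sqnorm_ext p lam (z z' : nat -> R) :
  (forall k, (k <= p)%N -> z k = z' k) -> spike_sqnorm p lam z = spike_sqnorm p lam z'.
Proof. by move=> zz; apply: eq_bigr => j _; rewrite zz// ltnW. Qed.

Context (n p : nat) (lam : R) (v : 'cV[R]_p) (G : 'M[R]_(p, n)) (tau theta : R).
Context (L : nat).
Hypotheses (n0 : (0 < n)%N) (p0 : (0 < p)%N) (l0 : 0 <= lam) (v1 : enorm v = 1).
Hypotheses (t0 : 0 <= tau) (good : ~ bad (tau * Num.sqrt n%:R) (p + n) G).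
Hypotheses (th01 : 0 <= theta <= 1) (L0 : (0 < L)%N) (Ln : (L <= n)%N).
Hypotheses (Lt : L%:R / n%:R <= theta ^+ 2) (Li : L%:R^-1 <= 2 * theta).

Let delta : R := p%:R / n%:R.
Let s : R := Num.sqrt delta.
Let Y := householder v^T *m spikemx p (Num.sqrt (1 + lam)) *m G.
Let A kappa := n%:R^-1 *: (Y *m Y^T) - kappa *: spiked_cov lam v.
(** Three errors: random entries replaced by deterministic ones, the test vector with
    [2 K + 12 = 20] for [K = 4], and the loss of order [1 / n] in [jacobi_form_lower]. *)
Let E := (tau * (8 + 4 * tau) + 20 * theta + 2 / n%:R) * (1 + lam + delta).

Let d0 : 0 < delta. Proof. by rewrite divr_gt0 ?ltr0n. Qed.
Let s0 : 0 <= s. Proof. exact: sqrtr_ge0. Qed.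
Let s2 : s ^+ 2 = delta. Proof. by rewrite sqr_sqrtr// ltW. Qed.
Let th0 : 0 <= theta. Proof. by case/andP: th01. Qed.

Let AT kappa : (A kappa)^T = A kappa.
Proof.
rewrite /A linearB !linearZ/= trmx_mul trmxK; congr (_ + _ *: - _).
by rewrite /spiked_cov linearD/= linearZ/= trmx_mul trmxK trmx1.
Qed.

Let model : exists (W : 'M[R]_p) (a b : nat -> R),
  [/\ (forall zeta : 'cV[R]_p, fdot (W *m zeta) (W *m zeta) = sqnorm p (coord zeta)),
   (forall x : 'cV[R]_p, exists zeta, x = W *m zeta),
   (forall kappa (zeta : 'cV[R]_p), fdot (W *m zeta) (A kappa *m (W *m zeta)) =
     jacobi_form n p lam a b (coord zeta) - kappa * spike_sqnorm p lam (coord zeta)) &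
   forall z, z p = 0 ->
    `|jacobi_form n p lam a b z - jacobi_form n p lam (adiag n) (asub n p) z| <=
    tau * (8 + 4 * tau) * (1 + lam + delta) * sqnorm p z].
Proof.
have [U [V [a [UU VV [eU eUT] UGV [ha hb]]]]] := bidiagonalise (leqnn _) good.
exists (householder v^T *m U^T).
exists (fun j => a j.*2 / Num.sqrt n%:R), (fun j => a j.*2.+1 / Num.sqrt n%:R).
have sn : 0 < Num.sqrt n%:R :> R by rewrite sqrtr_gt0 ltr0n.
split.
- by move=> zeta; exact: transfer_norm.
- by move=> x; exact: transfer_surj.
- by move=> kappa zeta; apply: (transfer_form _ _ _ _ _ VV).
- move=> z zp; rewrite -s2; apply: jacobi_form_perturb => // j jn jp.
  + split; first exact: adiag01.
    rewrite /adiag sqrtrM ?ler0n// sqrtrV ?ler0n// -mulrBl normrM.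
    by rewrite normfV (gtr0_norm sn) ler_pdivrMr// ha.
  + split; first exact: asub_le.
    rewrite /asub sqrtrM ?ler0n// sqrtrV ?ler0n// -mulrBl normrM.
    by rewrite normfV (gtr0_norm sn) ler_pdivrMr// hb.
Qed.

Lemma lambda_max_edge kappa rho h : 0 <= kappa <= 1 ->
  edge_data lam s kappa 1 rho h -> `|lambda_max (A kappa) - h| <= E.
Proof.
move=> k01 [/andP[r0 r1] hE b0 [b1 b2] K4]; have [k0 k1] := andP k01.
have [W [a [b [Wn Ws Wf pert]]]] := model.
apply: (lambda_max_sandwich (f := fun z => jacobi_form n p lam a b z - kappa * spike_sqnorm p lam z) p0 (AT kappa) _ Wn Ws) => //.
- by move=> z z' zz; rewrite (jacobi_form_ext _ _ _ _ zz) (spike_sqnorm_ext _ zz).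
- move=> z zp; have := pert z zp; rewrite ler_norml => /andP[_ h1].
  have h2 : jacobi_form n p lam (adiag n) (asub n p) z - kappa * spike_sqnorm p lam z
      <= h * sqnorm p z.
    apply: (@jacobi_form_upper _ n p lam s kappa rho h) => //.
    + by move=> j jn jp; exact: adiag01.
    + by move=> j jn jp; exact: asub_le.
    + by rewrite hE !mul1r.
    + by move: b2; rewrite !mul1r subr_le0.
  have h3 : 0 <= (20 * theta + 2 / n%:R) * (1 + lam + delta) * sqnorm p z.
    rewrite !mulr_ge0 ?sqnorm_ge0 ?addr_ge0 ?mulr_ge0 ?invr_ge0 ?ler0n// ltW//.
  by move: h1 h2 h3; rewrite /E; lra.
- have [z [zp z0 hz]] := jacobi_form_test n0 p0 l0 k01 (expr1n _ 2)
    (introT andP (conj r0 r1)) hE b0 b1 K4 L0 Ln Lt th01 Li.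
  exists z; split => //; have := pert z zp; rewrite -/delta -/s s2 in hz.
  move: hz; rewrite !ler_norml => /andP[h1 _] /andP[h2 _].
  have h3 : 0 <= (2 / n%:R) * (1 + lam + delta) * sqnorm p z.
    rewrite !mulr_ge0 ?sqnorm_ge0 ?addr_ge0 ?mulr_ge0 ?invr_ge0 ?ler0n// ltW//.
  by move: h1 h2 h3; rewrite /E; lra.
Qed.

Lemma lambda_min_edge rho h : edge_data lam s 1 (-1) rho h -> (1 <= s -> h <= -1) ->
  rho^-1 <= 1 + lam + s -> `|lambda_min (A 1) - h| <= E.
Proof.
move=> [/andP[r0 r1] hE b0 [b1 b2] K4] hs rs.
have [W [a [b [Wn Ws Wf pert]]]] := model.
rewrite lambda_minE -opprD normrN -[h]opprK.
apply: (lambda_max_sandwich (f := fun z => spike_sqnorm p lam z - jacobi_form n p lam a b z) p0 _ _ Wn Ws) => //.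
- by rewrite linearN/= AT.
- by move=> z z' zz; rewrite (jacobi_form_ext _ _ _ _ zz) (spike_sqnorm_ext _ zz).
- by move=> zeta; rewrite mulNmx fdotC -scaleN1r fdotZl fdotC Wf mulN1r mul1r opprB.
- move=> z zp; have := pert z zp; rewrite ler_norml => /andP[h1 _].
  have h2 := @jacobi_form_lower _ n p lam rho h z n0 p0 zp l0 r0.
  have {h2} := h2 _ _ hs rs; rewrite -/delta -/s s2 => h2.
  have {}h2 := h2 _ _.
  have h3 : 0 <= (20 * theta) * (1 + lam + delta) * sqnorm p z.
    rewrite !mulr_ge0 ?sqnorm_ge0 ?addr_ge0 ?mulr_ge0 ?invr_ge0 ?ler0n// ltW//.
  have {h2} : (h - 2 * (1 + lam + delta) / n%:R) * sqnorm p z <=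
     jacobi_form n p lam (adiag n) (asub n p) z - spike_sqnorm p lam z.
    apply: h2; first by rewrite hE s2; ring.
    by move: b2; rewrite subrr add0r; lra.
  by move: h1 h3; rewrite /E; lra.
- have k01 : 0 <= (1 : R) <= 1 by rewrite ler01 lexx.
  have sg : (-1 : R) ^+ 2 = 1 by rewrite sqrrN expr1n.
  have [z [zp z0 hz]] := jacobi_form_test n0 p0 l0 k01 sg
    (introT andP (conj r0 r1)) hE b0 b1 K4 L0 Ln Lt th01 Li.
  exists z; split => //; have := pert z zp; rewrite -/delta -/s s2 in hz.
  move: hz; rewrite !ler_norml => /andP[_ h1] /andP[_ h2].
  have h3 : 0 <= (2 / n%:R) * (1 + lam + delta) * sqnorm p z.
    rewrite !mulr_ge0 ?sqnorm_ge0 ?addr_ge0 ?mulr_ge0 ?invr_ge0 ?ler0n// ltW//.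
  by move: h1 h2 h3; rewrite /E; lra.
Qed.

Lemma spectrum_approx (B := n%:R^-1 *: (Y *m Y^T)) :
  [/\ `|opnorm B - Sfun lam delta| <= E,
      `|lambda_max (B - spiked_cov lam v) - Hplus lam delta| <= E &
      `|lambda_min (B - spiked_cov lam v) - Hminus lam delta| <= E].
Proof.
have B0 : B = A 0 by rewrite /A scale0r subr0.
have B1 : B - spiked_cov lam v = A 1 by rewrite /A scale1r.
split.
- have [rho ed] := edge_Sfun l0 d0; rewrite opnorm_psd//.
  + by rewrite B0; apply: (lambda_max_edge _ ed); rewrite lexx ler01.
  + by rewrite B0 AT.
  + move=> x; rewrite /B -scalemxAl fdotC fdotZl mulr_ge0// ?invr_ge0// fdotC.
    by rewrite -mulmxA fdot_mull fdot_ge0.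
- have [rho ed] := edge_Hplus l0 d0; rewrite B1; apply: (lambda_max_edge _ ed).
  by rewrite lexx ler01.
- have [rho [ed h1 h2]] := edge_Hminus l0 d0; rewrite B1.
  exact: (lambda_min_edge ed h1 h2).
Qed.

End spectrum.

(** * Choice of the scales *)

Section scales.
Context {R : realType}.

(** This is [ln (1 + x) <= x] at [x = 1 / d - 1]. *)
Lemma ln_nat_ge (d : nat) : (2 <= d)%N -> 1 / 2 <= ln d%:R :> R.
Proof.
move=> d2; have d0 : 0 < d%:R :> R by rewrite ltr0n (ltn_trans _ d2).
have d2' : 2 <= d%:R :> R by rewrite ler_nat.
have di : d%:R^-1 <= 2^-1 :> R by rewrite lef_pV2// posrE.
have di0 : 0 < d%:R^-1 :> R by rewrite invr_gt0.
have : ln (1 + (d%:R^-1 - 1)) <= d%:R^-1 - 1 :> R by apply: le_ln1Dx; lra.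
rewrite addrCA subrr addr0 lnV ?posrE//; lra.
Qed.

(* The witnesses are [q = n^(1/4)] and [w = (ln d)^(3/4)]. *)
Lemma scalesE (n d : nat) : (2 <= d)%N -> ln d%:R ^+ 3 <= n%:R :> R ->
  exists q w : R, [/\ n%:R `^ (- (1 / 4)) * ln d%:R `^ (3 / 4) = w / q,
    n%:R = q ^+ 4, ln d%:R ^+ 3 = w ^+ 4, 1 <= q & 0 < w <= q].
Proof.
move=> d2 ln3; have l2 := ln_nat_ge d2; have l0 : 0 < ln d%:R :> R by lra.
have n0 : 0 < n%:R :> R by rewrite (lt_le_trans _ ln3)// exprn_gt0.
have n1 : 1 <= n%:R :> R by rewrite ler1n -(ltr0n R).
exists (n%:R `^ (1 / 4)), (ln d%:R `^ (3 / 4)).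
have q4 : n%:R = (n%:R `^ (1 / 4)) ^+ 4 :> R.
  rewrite -powR_mulrn ?powR_ge0// -powRrM (_ : 1 / 4 * 4%:R = 1); last by field.
  by rewrite powRr1// ltW.
have w4 : ln d%:R ^+ 3 = (ln d%:R `^ (3 / 4)) ^+ 4 :> R.
  rewrite -[RHS]powR_mulrn ?powR_ge0// -powRrM (_ : 3 / 4 * 4%:R = 3%:R); last by field.
  by rewrite powR_mulrn// ltW.
split => //; first by rewrite powRN mulrC.
  by rewrite -(@ler_pXn2r _ 4)// ?nnegrE ?powR_ge0// expr1n -q4.
rewrite powR_gt0//=.
by rewrite -(@ler_pXn2r _ 4)// ?nnegrE ?powR_ge0// -w4 -q4.
Qed.

(* [L] is the integer part of [n^(1/2)] and [theta = n^(-1/4)]. *)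
Lemma scales (n d : nat) : (2 <= d)%N -> ln d%:R ^+ 3 <= n%:R :> R ->
  let eps : R := n%:R `^ (- (1 / 4)) * ln d%:R `^ (3 / 4) in
  [/\ (0 < n)%N, 0 <= eps <= 1,
    4 * d%:R * expR (- ((6 * eps * Num.sqrt n%:R) ^+ 2 / 2)) <=
      expR (- Num.sqrt n%:R),
    n%:R^-1 <= 2 * eps &
    exists (L : nat) (theta : R), [/\ 0 <= theta <= 1, theta <= 2 * eps,
      (0 < L <= n)%N, L%:R / n%:R <= theta ^+ 2 & L%:R^-1 <= 2 * theta]].
Proof.
move=> d2 ln3 eps; have l2 := ln_nat_ge d2.
have [q [w [epsE nE wE q1 /andP[w0 wq]]]] := scalesE d2 ln3.
have q0 : 0 < q by lra.
have d0 : 0 < d%:R :> R by rewrite ltr0n (ltn_trans _ d2).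
rewrite {}/eps epsE; have l0 : 0 < ln d%:R :> R by lra.
have n0 : (0 < n)%N by rewrite -(ltr0n R) nE exprn_gt0.
(* [w^4 = (ln d)^3 >= 1/8], which exceeds [(1/2)^4]. *)
have w2 : 1 / 2 <= w.
  rewrite leNgt; apply/negP => wlt.
  have : w ^+ 4 < (1 / 2) ^+ 4 by rewrite ltr_pXn2r// nnegrE; lra.
  have : (1 / 2) ^+ 3 <= ln d%:R ^+ 3 :> R by rewrite ler_pXn2r// nnegrE; lra.
  by rewrite wE; lra.
have sE : Num.sqrt n%:R = q ^+ 2 :> R.
  by rewrite nE (exprM q 2 2) sqrtr_sqr ger0_norm ?sqr_ge0.
have q2 : 1 <= q ^+ 2 by rewrite exprn_ege1.
have qi : q^-1 <= 2 * (w / q) by rewrite mulrA -[leLHS]mul1r ler_pM2r ?invr_gt0//; lra.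
have qi1 : q^-1 <= 1 by rewrite invf_le1.
have qi0 : 0 < q^-1 by rewrite invr_gt0.
split => //.
- by apply/andP; split; [rewrite divr_ge0// ltW|rewrite ler_pdivrMr// mul1r].
- have -> : 6 * (w / q) * Num.sqrt n%:R = 6 * w * q :> R.
    by rewrite sE; field; rewrite gt_eqF.
  have dE : d%:R = expR (ln d%:R) :> R by rewrite lnK.
  have e2 : 4 <= expR 2 :> R.
    have e1 : 2 <= expR 1 :> R by apply: le_trans (expR_ge1Dx 1); lra.
    have -> : expR 2 = expR 1 ^+ 2 :> R by rewrite -expRM_natl mulr1.
    have : 2 ^+ 2 <= expR 1 ^+ 2 :> R by rewrite ler_pXn2r ?nnegrE ?expR_ge0.
    by lra.
  rewrite sE {1}dE; apply: (@le_trans _ _ (expR 2 * expR (ln d%:R) *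
      expR (- ((6 * w * q) ^+ 2 / 2)))).
    by rewrite ler_pM2r ?expR_gt0// ler_pM2r ?expR_gt0.
  (* It remains to see that [2 + ln d + q^2 <= 18 w^2 q^2]. The three terms are at most 8, 4 and 4
     times [w^2 q^2], which the factor 6 in the deviation accommodates. *)
  rewrite -!expRD ler_expR.
  have -> : (6 * w * q) ^+ 2 / 2 = 18 * (w ^+ 2 * q ^+ 2) by field.
  have w22 : 1 / 4 <= w ^+ 2.
    have : (1 / 2) ^+ 2 <= w ^+ 2 by rewrite ler_pXn2r// nnegrE; lra.
    by lra.
  have wq2 : w ^+ 2 <= q ^+ 2 by rewrite ler_pXn2r// nnegrE ltW.
  have h1 : 1 / 4 * q ^+ 2 <= w ^+ 2 * q ^+ 2 by rewrite ler_pM2r//; lra.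
  have h2 : ln d%:R <= 4 * (w ^+ 2 * q ^+ 2).
    apply: (@le_trans _ _ (4 * ln d%:R ^+ 3)).
      have : (1 / 2) ^+ 2 <= ln d%:R ^+ 2 :> R by rewrite ler_pXn2r// nnegrE; lra.
      move=> h; have : 1 / 4 * ln d%:R <= ln d%:R ^+ 2 * ln d%:R :> R by rewrite ler_pM2r//; lra.
      by rewrite exprSr; lra.
    rewrite wE ler_pM2l// (_ : w ^+ 4 = w ^+ 2 * w ^+ 2); last by rewrite -exprD.
    by rewrite ler_pM2l// exprn_gt0.
  by lra.
- apply: le_trans qi; rewrite nE lef_pV2 ?posrE ?exprn_gt0//.
  by rewrite -[leLHS]expr1 ler_weXn2l.
- exists (Num.truncn (q ^+ 2)), q^-1.
  have [L1 L2] := andP (truncn_itv (sqr_ge0 q)).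
  have L0 : (0 < Num.truncn (q ^+ 2))%N by rewrite truncn_gt0.
  set L := Num.truncn _ in L0 L1 L2 *.
  have L0r : 1 <= L%:R :> R by rewrite ler1n.
  split => //.
  + by rewrite ltW.
  + rewrite L0/= -(ler_nat R) (le_trans L1)// nE.
    by rewrite ler_weXn2l.
  + rewrite nE ler_pdivrMr ?exprn_gt0// exprVn.
    by rewrite (_ : (q ^+ 2)^-1 * q ^+ 4 = q ^+ 2)//; field; rewrite gt_eqF.
  + rewrite -[2]invrK -invfM lef_pV2 ?posrE ?mulr_gt0//; last lra.
    have : q <= q ^+ 2 by rewrite -{1}[q]expr1 ler_weXn2l.
    by move: L2; rewrite -natr1; lra.
Qed.

End scales.

(** * Measurability of the deviation events *)

Section measurable_spectrum.
Context {R : realType} d (T : measurableType d).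

Lemma measurable_deviation (f : T -> R) e h : measurable_fun setT f ->
  measurable [set w | (e < `|f w - h|)%R].
Proof.
move=> mf; have mN : measurable_fun setT (fun w => `|f w - h|).
  apply: measurableT_comp => //; apply: measurable_funB => //.
rewrite -[X in measurable X]setTI [X in _ `&` X](_ : _ =
  (fun w => `|f w - h|) @^-1` [set` `]e, +oo[]).
  exact: mN.
by apply/seteqP; split => w /=; rewrite in_itv/= andbT.
Qed.

Lemma measurable_lambda_min p (A : T -> 'M[R]_p) :
  (0 < p)%N -> measurable_mx A -> (forall w, (A w)^T = A w) ->
  measurable_fun setT (fun w => lambda_min (A w)).
Proof.
move=> p0 mA AT; under eq_fun do rewrite lambda_minE.
apply: measurableT_comp => //; apply: measurable_lambda_max => //.
  by move=> i j; under eq_fun do rewrite mxE; exact: measurableT_comp.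
by move=> w; rewrite linearN/= AT.
Qed.

Lemma measurable_opnorm m p (A : T -> 'M[R]_(m, p)) :
  (0 < p)%N -> measurable_mx A -> measurable_fun setT (fun w => opnorm (A w)).
Proof.
move=> p0 mA; under eq_fun do rewrite opnormE//.
apply: (@measurableT_comp _ _ _ _ _ _ (@Num.sqrt R)).
  by apply: continuous_measurable_fun; exact: sqrt_continuous.
apply: measurable_lambda_max => // [|w].
  by apply: measurable_mxM => //; exact: measurable_mx_tr.
by rewrite trmx_mul trmxK.
Qed.

End measurable_spectrum.

Theorem theorem3p16 (R : realType) :
  exists C c : R, 0 < C /\ 0 < c /\
  forall (disp : measure_display) (T : measurableType disp)
    (P : probability T R) (n p : nat) (lam : R) (v : 'cV[R]_p)
    (X : 'I_n -> T -> 'cV[R]_p),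
  let Sigma := spiked_cov lam v in
  let hatSigma := fun w : T => sample_cov (fun i => X i w) in
  let delta : R := p%:R / n%:R in
  let d := maxn n p in
  0 <= lam ->
  enorm v = 1 ->
  independent_vectors P X ->
  (forall i, gaussian_vector P (X i) 0 Sigma) ->
  (2 <= d)%N ->
  ln d%:R ^+ 3 <= n%:R :> R ->
  [/\ (P [set w | (error_bound C lam delta n d <
                    `| opnorm (hatSigma w) - Sfun lam delta |)%R]
         <= (expR (- c * Num.sqrt n%:R))%:E)%E,
      (P [set w | (error_bound C lam delta n d <
                    `| lambda_max (hatSigma w - Sigma) - Hplus lam delta |)%R]
         <= (expR (- c * Num.sqrt n%:R))%:E)%E &
      (P [set w | (error_bound C lam delta n d <
                    `| lambda_min (hatSigma w - Sigma) - Hminus lam delta |)%R]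
         <= (expR (- c * Num.sqrt n%:R))%:E)%E].
Proof.
(* With [tau = 6 eps], [eps <= 1], [theta <= 2 eps] and [1 / n <= 2 eps], the error is at most
   [(48 + 144 + 40 + 4) eps] times [1 + lam + delta]. *)
exists 236, 1; split => //; split => //.
move=> disp T P n p lam v X Sigma hatSigma delta d l0 v1 iX gX d2 ln3.
rewrite mulN1r; have [n0 /andP[e0 e1] tail ni [L [theta [th01 the /andP[L0 Ln] Lt Li]]]] :=
  scales d2 ln3.
set eps := _ * _ in e0 e1 tail ni the.
have p0 : (0 < p)%N.
  case: p v v1 {X Sigma hatSigma delta d iX gX d2 ln3 eps e0 e1 tail ni the} => // v.
  by rewrite /enorm big_ord0 sqrtr0 => /eqP; rewrite eq_sym oner_eq0.
have [mG sG] := spiked_std_gauss p0 l0 v1 iX gX.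
set G := fun w : T => _ in mG sG.
pose t := 6 * eps * Num.sqrt n%:R.
have t0 : 0 <= t by rewrite mulr_ge0 ?sqrtr_ge0// mulr_ge0.
pose B := [set w | bad t (p + n) (G w)].
have PB : (P B <= (expR (- Num.sqrt n%:R))%:E)%E.
  apply: (le_trans (bad_prob _ t0 (conj mG sG))); rewrite lee_fin.
  apply: le_trans tail; rewrite mulrA -/t ler_wpM2r ?expR_ge0//.
  have : (p + n)%:R <= (d + d)%:R :> R by rewrite ler_nat leq_add ?leq_maxr ?leq_maxl.
  by rewrite [(d + d)%:R]natrD; lra.
have mB : measurable B by exact: measurable_bad.
have spike0 : Num.sqrt (1 + lam) != 0 by rewrite gt_eqF// sqrtr_gt0; lra.
have hatE w : hatSigma w = n%:R^-1 *:
    ((householder v^T *m spikemx p (Num.sqrt (1 + lam)) *m G w) *m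
     (householder v^T *m spikemx p (Num.sqrt (1 + lam)) *m G w)^T).
  rewrite /hatSigma sample_covE /G.
  set D := spikemx p (Num.sqrt (1 + lam)); set D' := spikemx p _^-1.
  have DD : D *m D' = 1%:M by rewrite /D /D' spikemxM// divff// spikemx1.
  rewrite -(mulmxA D') (mulmxA (_ *m D)) -(mulmxA _ D) DD mulmx1 mulmxA.
  have := householderK v^T; rewrite tr_householder => ->.
  by rewrite mul1mx.
have close w : ~ B w ->
    let e := error_bound 236 lam delta n d in
    [/\ `|opnorm (hatSigma w) - Sfun lam delta| <= e,
     `|lambda_max (hatSigma w - Sigma) - Hplus lam delta| <= e &
     `|lambda_min (hatSigma w - Sigma) - Hminus lam delta| <= e].
  move=> Bw e; have e60 : 0 <= 6 * eps by rewrite mulr_ge0.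
  have [h1 h2 h3] := spectrum_approx n0 p0 l0 v1 e60 Bw th01 L0 Ln Lt Li.
  rewrite hatE; suff le_e : (6 * eps * (8 + 4 * (6 * eps)) + 20 * theta + 2 / n%:R) *
      (1 + lam + delta) <= e.
    by split; [apply: (le_trans h1)|apply: (le_trans h2)|apply: (le_trans h3)].
  have -> : e = 236 * eps * (1 + lam + delta) by rewrite /e /error_bound /eps; ring.
  apply: ler_wpM2r; first by rewrite !addr_ge0// divr_ge0.
  have : eps * eps <= eps by rewrite ler_piMr.
  by lra.
have mhat : measurable_mx hatSigma.
  have mY (w : T -> 'M[R]_(p, n)) : measurable_mx w ->
      measurable_mx (fun x => n%:R^-1 *: (w x *m (w x)^T)).
    move=> mw; apply: measurable_mxZ; first exact: measurable_cst.
    by apply: measurable_mxM => //; exact: measurable_mx_tr.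
  rewrite (funext hatE); apply: mY.
  by apply: measurable_mxM => //; exact: measurable_mx_cst.
have mdiff : measurable_mx (fun w => hatSigma w - Sigma).
  by apply: measurable_mxD => //; exact: measurable_mx_cst.
have dT w : (hatSigma w - Sigma)^T = hatSigma w - Sigma.
  rewrite hatE linearB linearZ/= [in LHS]trmx_mul trmxK; congr (_ - _).
  by rewrite /Sigma /spiked_cov linearD/= linearZ/= trmx_mul trmxK trmx1.
split; apply: (le_trans _ PB); apply: le_measure; rewrite ?inE//.
- by apply: measurable_deviation; exact: measurable_opnorm.
- by move=> w /=; apply: contraPP => /close[+ _ _]; rewrite leNgt => /negP.
- by apply: measurable_deviation; exact: measurable_lambda_max.
- by move=> w /=; apply: contraPP => /close[_ + _]; rewrite leNgt => /negP.
- by apply: measurable_deviation; exact: measurable_lambda_min.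
- by move=> w /=; apply: contraPP => /close[_ _ +]; rewrite leNgt => /negP.
Qed.
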